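(* Let $2\le a<b<c$ be pairwise relatively prime integers, let $S=\langle ab,ac,bc\rangle$, let $\mathbf{r}=(ab,ac,bc)$, let $g=g(S)$, and assume that $d\ge 2g(S)$. Then the Severi variety $M^3_{d,g;S,\mathbf{r}}$ is excess-dimensional whenever $4\le a<b<c$ and $(a,b,c)\ne(4,5,7)$.
   Context: We work over $\mathbb{C}$. $\mathbb{N}=\{0,1,2,\dots\}$ and $\langle n_1,\dots,n_s\rangle$ is the set of $\mathbb{N}$-linear combinations of $n_1,\dots,n_s$. For a numerical semigroup $S$ (a submonoid of $\mathbb{N}$ with finite complement), the genus $g(S)$ is the cardinality of $\mathbb{N}\setminus S$. A cusp is a unibranch curve singularity, locally given by a ring map $\phi:\mathbb{C}[x_1,\dots,x_n]\to\mathbb{C}[[t]]$; its value semigroup is the set of $t$-adic valuations of the nonzero elements of the image of $\phi$ (the local algebra). Its ramification profile is the increasing sequence $\mathbf{r}=(r_1,\dots,r_n)$ of vanishing orders, at the preimage of the cusp, of the parametrizing functions (after a linear change of coordinates so that these orders are strictly increasing). $M^n_d$ denotes the space of morphisms $\mathbb{P}^1\to\mathbb{P}^n$ of degree $d$. $M^n_{d,g;S,\mathbf{r}}\subset M^n_d$ denotes the (generalized) Severi variety of morphisms whose images are unicuspidal rational curves of arithmetic genus $g$, with cusp having value semigroup $S$ (with $g(S)=g$) and ramification profile $\mathbf{r}$. The variety $M^n_{d,g;S,\mathbf{r}}$ is called excess-dimensional if its codimension in $M^n_d$ is strictly less than $(n-2)g$; for $n=3$ this means codimension strictly less than $g$.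 *)

(* Defs.v *)
From HB Require Import structures.
From mathcomp Require Export all_boot all_order all_algebra.
From mathcomp Require Export finmap complex mpoly.
From mathcomp Require Export boolp classical_sets functions cardinality reals.

Set Implicit Arguments.
Unset Strict Implicit.
Unset Printing Implicit Defensive.

Import Order.TTheory GRing.Theory Num.Theory.
Local Open Scope classical_set_scope.
Local Open Scope ring_scope.

Definition semigroup_gen (s : seq nat) : set nat :=
  [set m | exists k : 'I_(size s) -> nat,
     m = (\sum_(i < size s) k i * nth 0%N s i)%N].

(* Junk value 0 when the complement of S is infinite. *)
Definition genus (S : set nat) : nat := #|` fset_set (~` S)|%fset.

Section Zariski.
Variables (K : fieldType) (p q : nat).
Implicit Types X Y Z : set 'M[K]_(p, q).

(* A subset of the projective space P('M[K]_(p, q)) is represented by the set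
   of all its (nonzero) representatives.  [mxvec] numbers the homogeneous
   coordinates. *)
Definition zero_locus (E : set {mpoly K[p * q]}) : set 'M[K]_(p, q) :=
  [set A | forall F, E F -> F.@[mxvec A 0] = 0].

Definition homogeneous_eqs (E : set {mpoly K[p * q]}) : Prop :=
  forall F, E F -> exists k : nat, F \is k.-homog.

(* Closed for the Zariski topology that X inherits from projective space. *)
Definition closed_in X Z : Prop :=
  exists2 E, homogeneous_eqs E & Z = X `&` zero_locus E.

Definition irreducible_closed X Y : Prop :=
  [/\ closed_in X Y, Y !=set0 &
      forall Z1 Z2, closed_in X Z1 -> closed_in X Z2 ->
        Y `<=` Z1 `|` Z2 -> Y `<=` Z1 \/ Y `<=` Z2].

Definition irreducible_chain X (k : nat) (W : nat -> set 'M[K]_(p, q)) : Prop :=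
  (forall i, (i <= k)%N -> irreducible_closed X (W i)) /\
  (forall i, (i < k)%N -> W i `<` W i.+1).

(* The empty set has no dimension, hence no codimension either. *)
Definition krull_dim X (k : nat) : Prop :=
  (exists W, irreducible_chain X k W) /\
  (forall l W, irreducible_chain X l W -> (l <= k)%N).

Definition codim Z X (k : nat) : Prop :=
  exists e m : nat, [/\ krull_dim Z e, krull_dim X m & m = (e + k)%N].

End Zariski.

(* Points of P^1 and P^n are given by nonzero row vectors, equality of points
   being equality of row spaces. *)
Section Maps.
Variables (K : fieldType) (n d : nat).
Implicit Types (A : 'M[K]_(n.+1, d.+1)) (P Q : 'rV[K]_2).

Definition binary_form A (i : 'I_n.+1) : {mpoly K[2]} :=
  \sum_(j < d.+1) A i j *: ('X_0 ^+ (d - j) * 'X_1 ^+ j).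

Definition map_eval A P : 'rV[K]_n.+1 := \row_i (binary_form A i).@[P 0].

(* The pullback of a form on P^n along the map defined by A. *)
Definition pullback A (F : {mpoly K[n.+1]}) : {mpoly K[2]} :=
  F \mPo [tuple binary_form A i | i < n.+1].

(* M^n_d: by absence of base points the map has degree exactly d. *)
Definition morphisms : set 'M[K]_(n.+1, d.+1) :=
  [set A | forall P, P != 0 -> map_eval A P != 0].

Definition line_form P : {mpoly K[2]} := P 0 1 *: 'X_0 - P 0 0 *: 'X_1.

Definition vanishing_order P (H : {mpoly K[2]}) (k : nat) : Prop :=
  exists2 G : {mpoly K[2]}, H = line_form P ^+ k * G & G.@[P 0] != 0.

(* The image C of the map carries its reduced structure, so two forms on P^n
   agree on C iff their pullbacks are equal.  An element of the local ring of C
   at the image of P is a fraction F / G as follows. *)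
Definition local_fraction A P (F G : {mpoly K[n.+1]}) : Prop :=
  (exists k : nat, F \is k.-homog /\ G \is k.-homog) /\
  G.@[map_eval A P 0] != 0.

(* The local ring of the curve C at the image of P is regular: its maximal
   ideal is generated by one element F0 / G0. *)
Definition smooth_at A P : Prop :=
  exists F0 G0 : {mpoly K[n.+1]},
    [/\ local_fraction A P F0 G0, F0.@[map_eval A P 0] = 0 &
      forall F G, local_fraction A P F G -> F.@[map_eval A P 0] = 0 ->
        exists F1 G1, local_fraction A P F1 G1 /\
          pullback A F * pullback A (G0 * G1)
          = pullback A (F0 * F1) * pullback A G].

(* Birational onto the image: the coordinate X_0 / X_1 of P^1 lies in the
   function field of the image. *)
Definition birational A : Prop :=
  exists (k : nat) (F G : {mpoly K[n.+1]}),
    [/\ F \is k.-homog, G \is k.-homog, pullback A G != 0 &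
        pullback A F * 'X_1 = pullback A G * 'X_0].

(* The image has exactly one singular point, the image of P, and this point is
   unibranch.  As the map is birational, it is the normalization of its image,
   so the branches at a point of the image are its preimages. *)
Definition unicuspidal A P : Prop :=
  [/\ birational A,
      ~ smooth_at A P,
      forall Q, Q != 0 -> (map_eval A Q == map_eval A P)%MS -> (Q == P)%MS &
      forall Q, Q != 0 -> ~~ (Q == P)%MS -> smooth_at A Q].

(* The denominator G of a local function F / G is a unit at P, so the t-adic
   valuation of F / G is the vanishing order of the pullback of F. *)
Definition value_semigroup A P : set nat :=
  [set v | exists F G, local_fraction A P F G /\
                       vanishing_order P (pullback A F) v].

Definition ramification_profile A P (r : n.-tuple nat) : Prop :=
  sorted ltn r /\
  exists T : 'M[K]_n.+1,
    [/\ T \in unitmx,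
        vanishing_order P (binary_form (T *m A) ord0) 0 &
        forall i : 'I_n,
          vanishing_order P (binary_form (T *m A) (lift ord0 i)) (tnth r i)].

(* The degree m part of the homogeneous coordinate ring of the image has
   dimension h. *)
Definition hilbert_function A (m h : nat) : Prop :=
  exists B : 'I_h -> {mpoly K[n.+1]},
    (forall i, B i \is m.-homog) /\
    (forall F, F \is m.-homog -> exists! c : 'rV[K]_h,
       pullback A F = \sum_(i < h) c 0 i *: pullback A (B i)).

Definition hilbert_polynomial A (p : {poly rat}) : Prop :=
  exists m0 : nat, forall m, (m0 <= m)%N ->
    exists2 h : nat, hilbert_function A m h & p.[m%:R] = h%:R.

(* p_a = 1 - p(0) for a curve with Hilbert polynomial p. *)
Definition arithmetic_genus A (g : nat) : Prop :=
  exists2 p : {poly rat}, hilbert_polynomial A p & p.[0] = 1 - g%:R.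

Definition severi (g : nat) (S : set nat) (r : n.-tuple nat) :
    set 'M[K]_(n.+1, d.+1) :=
  [set A | morphisms A /\ arithmetic_genus A g /\
    exists P, [/\ P != 0, unicuspidal A P, value_semigroup A P = S &
                  ramification_profile A P r]].

Definition excess_dimensional (g : nat) (S : set nat) (r : n.-tuple nat) :
    Prop :=
  exists2 k, codim (severi g S r) morphisms k & (k < (n - 2) * g)%N.

End Maps.

(* Main.v *)
From HB Require Import structures.
Require Import Defs.
From mathcomp Require Import separable cyclotomic.
From mathcomp Require Import zify ring.

(** A map of degree d from P^1 to P^3 is a 4 x (d+1) matrix up to scale, whose
rows are the coefficients of p0, p1, p2, p3, polynomials of degree at most d in
t = X_1 / X_0; the cusp is put at t = 0.  Let S be the semigroup, C = 2 g its
conductor, w = ab + ac + bc, and G the number of gaps of S that exceed abc.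
The proof exhibits a family of members of the Severi variety with at least
4(d+1) - (w + 2G + 4) independent parameters, one of them lost when matrices
are taken up to scale.  As the space of all maps has dimension at most
4(d+1) - 1, the codimension is less than w + 2G + 4, and this is at most g
for a >= 4, except for (4,5,7).

The family.  The leading terms 1, t^(ab), t^(ac), t^(bc) of p0, ..., p3
prescribe w + 4 coefficients.  Put x = p1/p0, y = p2/p0, z = p3/p0, computed
modulo t^C.  All of x^c, y^b, z^a begin with t^(abc).  If x^c - y^b and
x^c - z^a are, modulo t^C, linear combinations of monomials in x, y, z of orders
greater than abc, then every polynomial in x, y, z can be rewritten in terms of
the monomials x^i y^j z^k with j < b and k < a ([spanned_monomial]).  The orders
of these are distinct, so every order below C that occurs lies in S
([spanned_starts]).  A combination of monomials can match any coefficient at an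
element of S; the conditions thus consist of one equation for each of the two
relations and each gap n > abc.  The equation at n is linear with coefficient b
in the coefficient of t^(ac + n - abc) of p2, respectively a and
t^(bc + n - abc) of p3.  Hence it can be solved, by increasing n, over the
polynomial ring in the other coefficients ([solve_relations]), and 2G
coefficients are used up.

No other singularities.  If the forms of each large degree m restrict to all
t^n with C <= n <= md, then the map is an embedding away from the cusp, the cusp
has value semigroup S, and the arithmetic genus is g ([member_severi]).  This
property is inherited from degrees m and m + 1 by products ([fullD],
[two_generators]).  In one degree it holds as soon as a certain minor does not
vanish ([full_open]), so it is an open condition on the parameters, and a single
member of the family with this property suffices.

The base member.  It is p0 = 1 + s t^(d-1) + s^2 t^d, p1 = t^(ab), p2 = t^(ac),
p3 = t^(bc) + t^(bc+ab) + t^d with a suitable s.  The quotients of forms of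
degree k by p1^k, for all k, make up an algebra.  It contains t^e = p2/p1, where
e = a(c-b), and, for each fibre of t^e other than t = 0, a function which takes
distinct values at its e points.  A Vandermonde argument
([conducts_det], [eventually_closed_Xn]) then yields all high powers of t,
and finally all powers; clearing denominators and multiplying by the p_i gives
the property ([base_full]).

Dimension.  The Krull dimension is the maximal length of a chain of irreducible
closed sets.  Freeing the parameters one at a time produces a chain as long as
the number of parameters ([irreducible_chain_of_family]).  Conversely, a chain
of length k in a cone of nonzero vectors of K^N gives k + 1 algebraically
independent polynomials in N variables, so that k < N by counting monomials
([irreducible_chain_bound]).

The inequality.  Since S is symmetric, G counts the (i, j, k) with
(i+1)ab + (j+1)ac + (k+1)bc < abc.  A volume estimate gives
12 a G <= bc(a-1)(2a-1), which is small enough except for finitely many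
triples; for these the (i, j, k) are counted ([high_gaps_small]). *)

Set Implicit Arguments.
Unset Strict Implicit.
Unset Printing Implicit Defensive.

Import Order.TTheory GRing.Theory Num.Theory.
Local Open Scope classical_set_scope.
Local Open Scope nat_scope.

(** * The semigroup generated by ab, ac and bc *)

Lemma modular_quotient m u n : 0 < m -> coprime m u ->
  exists2 j, j < m & j * u = n %[mod m].
Proof.
move=> m0 cop; pose x := chinese m u n 0.
have /eqP : x = 0 %[mod u] by apply: chinese_modr.
rewrite mod0n => /dvdnP[y xE].
exists (y %% m); first by rewrite ltn_mod.
by rewrite modnMml -xE; apply: chinese_modl.
Qed.

Section Semigroup.
Variables a b c : nat.
Hypotheses (a2 : 2 <= a) (ab : a < b) (bc : b < c).
Hypotheses (cab : coprime a b) (cac : coprime a c) (cbc : coprime b c).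

Definition weight i j k := i * (a * b) + j * (a * c) + k * (b * c).

Definition inS n : bool := `[< exists i j k, n = weight i j k >].

Definition frob := 2 * (a * b * c) - (a * b + a * c + b * c).

Let a_gt0 : 0 < a. Proof. lia. Qed.
Let b_gt0 : 0 < b. Proof. lia. Qed.
Let c_gt0 : 0 < c. Proof. lia. Qed.
Hint Resolve a_gt0 b_gt0 c_gt0 : core.

Lemma inS_weight i j k : inS (weight i j k).
Proof. by apply/asboolP; exists i, j, k. Qed.

Lemma inSD m n : inS m -> inS n -> inS (m + n).
Proof.
move=> /asboolP[i [j [k ->]]] /asboolP[i' [j' [k' ->]]].
apply/asboolP; exists (i + i'), (j + j'), (k + k').
by rewrite /weight; ring.
Qed.

Lemma semigroup_genE : semigroup_gen [:: a * b; a * c; b * c] = [set n | inS n].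
Proof.
apply/seteqP; split=> n /=.
  move=> [k ->]; apply/asboolP; exists (k ord0), (k (inord 1)), (k (inord 2)).
  rewrite !big_ord_recl big_ord0 /= addn0 addnA /weight.
  by congr (_ + k _ * _ + k _ * _); apply: val_inj; rewrite /= inordK.
move=> /asboolP[i [j [k ->]]]; exists (fun l : 'I_3 => nth 0 [:: i; j; k] l).
by rewrite !big_ord_recl big_ord0 /= addn0 addnA.
Qed.

Lemma frobE : frob + (a * b + a * c + b * c) = 2 * (a * b * c).
Proof.
rewrite /frob subnK //.
have h1 : a * b * 2 <= a * b * c by rewrite leq_mul2l; lia.
have h2 : a * c * 2 <= a * c * b by rewrite leq_mul2l; lia.
have h3 : b * c * 2 <= b * c * a by rewrite leq_mul2l; lia.
lia.
Qed.

(** Taken modulo b and modulo a, the equation determines j and k; what remains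
is a multiple of ab, possibly negative. *)
Lemma normal_form n : exists i j k, [/\ j < b, k < a &
  n = weight i j k \/ n + i.+1 * (a * b) = j * (a * c) + k * (b * c)].
Proof.
have [j ltj jE] := @modular_quotient b (a * c) n ltac:(lia) ltac:(by rewrite coprimeMr
  coprime_sym cab).
have [k ltk kE] := @modular_quotient a (b * c) n ltac:(lia) ltac:(by rewrite coprimeMr cab).
pose m := j * (a * c) + k * (b * c).
have /eqP me : m == n %[mod a * b].
  rewrite chinese_remainder //; apply/andP; split; apply/eqP.
    by rewrite -kE /m (_ : j * (a * c) = j * c * a) ?modnMDl //; ring.
  by rewrite -jE /m addnC (_ : k * (b * c) = k * c * b) ?modnMDl //; ring.
have ab0 : 0 < a * b by rewrite muln_gt0 a_gt0 b_gt0.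
have [lemn|ltnm] := leqP m n.
  move/esym/eqP: me; rewrite eqn_mod_dvd // => /dvdnP[q qE].
  by exists q, j, k; split=> //; left; rewrite /weight -addnA -/m -qE subnK.
move/eqP: me; rewrite eqn_mod_dvd ?(ltnW ltnm) // => /dvdnP[q qE].
have q0 : 0 < q by rewrite lt0n; apply: contraTneq ltnm => q0; rewrite -leqNgt -subn_eq0 qE q0.
by exists q.-1, j, k; split=> //; right; rewrite prednK // -qE subnKC // ltnW.
Qed.

(** In the normal form n = i ab + j ac + k bc with j < b and k < a, an element n
is in S exactly when i >= 0, and n -> frob - n sends (i, j, k) to
(-i-1, b-1-j, a-1-k).  That n and frob - n are not both in S comes from the fact
that frob is not: an equation (i+1)ab + (j+1)ac + (k+1)bc = 2abc forces
c | i+1, b | j+1 and a | k+1, hence a left side of at least 3abc. *)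
Lemma inS_symmetric n : n <= frob -> inS (frob - n) = ~~ inS n.
Proof.
move=> len; apply/idP/idP; last first.
  have [i [j [k [ltj ltk [->|nE]]]]] := normal_form n; first by rewrite inS_weight.
  move=> _; apply/asboolP; exists i, (b - j.+1), (a - k.+1).
  have [j' bE] : exists j', b = j + j'.+1 by exists (b - j.+1); lia.
  have [k' aE] : exists k', a = k + k'.+1 by exists (a - k.+1); lia.
  have -> : b - j.+1 = j' by lia.
  have -> : a - k.+1 = k' by lia.
  have := frobE; rewrite /weight; move: len nE; move: frob => F len nE FE.
  suff : F + (a * b + a * c + b * c) =
    (i * (a * b) + j' * (a * c) + k' * (b * c)) + n + (a * b + a * c + b * c) by lia.
  rewrite FE.
  have -> : i * (a * b) + j' * (a * c) + k' * (b * c) + n + (a * b + a * c + b * c) =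
     (n + i.+1 * (a * b)) + j'.+1 * (a * c) + k'.+1 * (b * c) by ring.
  rewrite nE.
  have -> : j * (a * c) + k * (b * c) + j'.+1 * (a * c) + k'.+1 * (b * c) =
     (j + j'.+1) * (a * c) + (k + k'.+1) * (b * c) by ring.
  by rewrite -bE -aE; ring.
move=> /asboolP[i [j [k FE]]]; apply/asboolP => -[i' [j' [k' nE]]].
have : frob = weight (i + i') (j + j') (k + k').
  by rewrite -[LHS](subnK len) FE nE /weight; ring.
move: (i + i') (j + j') (k + k') => I J L FW {i j k i' j' k' FE nE}.
have E : I.+1 * (a * b) + J.+1 * (a * c) + L.+1 * (b * c) = 2 * (a * b * c).
  by rewrite -frobE FW /weight; ring.
have dI : c %| I.+1.
  have : c %| I.+1 * (a * b).
    rewrite -(@dvdn_addl (J.+1 * (a * c) + L.+1 * (b * c)) _ (I.+1 * (a * b))).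
      by rewrite addnA E; apply/dvdnP; exists (2 * (a * b)); ring.
    by apply/dvdnP; exists (J.+1 * a + L.+1 * b); ring.
  by rewrite Gauss_dvdl // coprimeMr ![coprime c _]coprime_sym cac.
have dJ : b %| J.+1.
  have : b %| J.+1 * (a * c).
    rewrite -(@dvdn_addl (I.+1 * (a * b) + L.+1 * (b * c)) _ (J.+1 * (a * c))).
      by rewrite addnCA addnA E; apply/dvdnP; exists (2 * (a * c)); ring.
    by apply/dvdnP; exists (I.+1 * a + L.+1 * c); ring.
  by rewrite Gauss_dvdl // coprimeMr coprime_sym cab.
have dL : a %| L.+1.
  have : a %| L.+1 * (b * c).
    rewrite -(@dvdn_addl (I.+1 * (a * b) + J.+1 * (a * c)) _ (L.+1 * (b * c))).
      by rewrite addnC E; apply/dvdnP; exists (2 * (b * c)); ring.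
    by apply/dvdnP; exists (I.+1 * b + J.+1 * c); ring.
  by rewrite Gauss_dvdl // coprimeMr cab.
have lI := dvdn_leq (ltn0Sn _) dI; have lJ := dvdn_leq (ltn0Sn _) dJ.
have lL := dvdn_leq (ltn0Sn _) dL.
have h1 : c * (a * b) <= I.+1 * (a * b) by rewrite leq_mul2r lI orbT.
have h2 : b * (a * c) <= J.+1 * (a * c) by rewrite leq_mul2r lJ orbT.
have h3 : a * (b * c) <= L.+1 * (b * c) by rewrite leq_mul2r lL orbT.
have h4 : 0 < a * b * c by rewrite !muln_gt0 a_gt0 b_gt0 c_gt0.
lia.
Qed.

(** Otherwise the normal form has i <= -1, and then n <= frob. *)
Lemma inS_large n : frob < n -> inS n.
Proof.
move=> ltn; have [i [j [k [ltj ltk [->|nE]]]]] := normal_form n; first exact: inS_weight.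
exfalso.
have h1 : j.+1 * (a * c) <= b * (a * c) by rewrite leq_mul2r ltj orbT.
have h2 : k.+1 * (b * c) <= a * (b * c) by rewrite leq_mul2r ltk orbT.
have := frobE; lia.
Qed.

Definition conductor := frob.+1.

Definition gaps := [seq n <- iota 0 conductor | ~~ inS n].

(** By symmetry, as many elements below the conductor lie in S as outside. *)
Lemma double_size_gaps : (size gaps).*2 = conductor.
Proof.
have sg : size gaps = \sum_(n < conductor) ~~ inS n.
  by rewrite size_filter -sum1_count big_mkcond -(big_mkord xpredT (fun n =>
    nat_of_bool (~~ inS n))) /index_iota subn0; apply: eq_bigr => n _; case: (inS n).
have sg' : size gaps = \sum_(n < conductor) inS n.
  rewrite sg (reindex_inj rev_ord_inj); apply: eq_bigr => n _ /=.
  by rewrite /conductor subSS inS_symmetric ?negbK // -ltnS.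
rewrite -addnn {1}sg sg' -big_split /= -[RHS]card_ord -sum1_card.
by apply: eq_bigr => n _; case: (inS n).
Qed.

Lemma genus_gaps : genus (semigroup_gen [:: a * b; a * c; b * c]) = size gaps.
Proof.
rewrite /genus semigroup_genE.
have gE n : (n \in [fset m in gaps]%fset) = ~~ inS n.
  rewrite in_fset /= mem_filter mem_iota add0n /=; apply: andb_idr => nS.
  by rewrite ltnNge; apply: contra nS; exact: inS_large.
have -> : ~` [set n | inS n] = [set` [fset m in gaps]%fset]%classic.
  apply/seteqP; split=> n; first by move=> /negP nS; rewrite /mkset /= gE.
  by rewrite /mkset /= gE => /negP.
by rewrite set_fsetK card_fseq undup_id // filter_uniq ?iota_uniq.
Qed.

Lemma genus_conductor :
  2 * genus (semigroup_gen [:: a * b; a * c; b * c]) = conductor.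
Proof. by rewrite genus_gaps mul2n double_size_gaps. Qed.

Definition high_gaps := [seq n <- gaps | a * b * c < n].

(** The number of i >= 0 with (i+1)ab + (j+1)ac + (k+1)bc <= abc. *)
Definition slice_bound j k := (c * (a * b - j.+1 * a - k.+1 * b)) %/ (a * b).

Definition high_gaps_bound :=
  sumn [seq sumn [seq slice_bound j k | j <- iota 0 b] | k <- iota 0 a].

(** The reflection n -> frob - n sends a gap greater than abc to some
i ab + j ac + k bc in S with (i+1)ab + (j+1)ac + (k+1)bc < abc. *)
Lemma size_high_gaps : size high_gaps <= high_gaps_bound.
Proof.
pose T := [seq weight t.1.1 t.1.2 t.2 | t <-
  flatten [seq flatten [seq [seq (i, j,
    k) | i <- iota 0 (slice_bound j k)] | j <- iota 0 b] | k <- iota 0 a]].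
have szT : size T = high_gaps_bound.
  rewrite size_map size_flatten /shape /high_gaps_bound -map_comp; congr sumn.
  apply: eq_map => k /=; rewrite size_flatten /shape -map_comp; congr sumn.
  by apply: eq_map => j /=; rewrite size_map size_iota.
rewrite -szT -(size_map (fun n => frob - n)).
apply: uniq_leq_size => [|m /mapP[n]].
  rewrite map_inj_in_uniq ?filter_uniq ?iota_uniq // => x y.
  rewrite !mem_filter !mem_iota /= !add0n /conductor.
  by move: frob => F /and3P[_ _ lx] /and3P[_ _ ly]; lia.
rewrite !mem_filter mem_iota /= add0n ltnS => /and3P[ltn nS len] ->.
rewrite -inS_symmetric // in nS.
have /asboolP[i [j [k mE]]] := nS.
apply/mapP; exists (i, j, k) => //=.
have : i.+1 * (a * b) + j.+1 * (a * c) + k.+1 * (b * c) < a * b * c.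
  have := frobE; move: mE; rewrite /weight; move: frob len ltn => F len ltn mE FE; lia.
move=> {mE} lt.
have ltk : k < a.
  rewrite ltnNge; apply/negP => lek.
  have : a * (b * c) <= k * (b * c) by rewrite leq_mul2r lek orbT.
  lia.
have ltj : j < b.
  rewrite ltnNge; apply/negP => lek.
  have : b * (a * c) <= j * (a * c) by rewrite leq_mul2r lek orbT.
  lia.
apply/flatten_mapP; exists k; first by rewrite mem_iota.
apply/flatten_mapP; exists j; first by rewrite mem_iota.
apply/mapP; exists i => //; rewrite mem_iota /= add0n /slice_bound.
by rewrite leq_divRL ?muln_gt0 ?a_gt0 ?b_gt0 // !mulnBr; lia.
Qed.

(** The terms are the areas of rectangles of width a which are disjoint and lie
under the line of slope -1 through (0, B), hence in a triangle of area
B^2 / 2. *)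
Lemma sum_slices m B : 2 * a * (\sum_(j < m) (B - j.+1 * a)) <= B ^ 2.
Proof.
elim: m B => [|m IH] B; first by rewrite big_ord0 muln0.
rewrite big_ord_recl /= mul1n.
have [leaB|ltBa] := leqP a B; last first.
  rewrite big1 ?addn0 => [|j _]; last by apply/eqP; rewrite subn_eq0; nia.
  by rewrite (_ : B - a = 0) ?muln0 //; lia.
rewrite [X in _ + X](_ : _ = \sum_(j < m) (B - a - j.+1 * a)); last first.
  by apply: eq_bigr => j _; rewrite /bump /= add1n mulSn subnDA.
have := IH (B - a).
move: (\sum_(_ < _) _) => s; have [x xE] : exists x, B = x + a by exists (B - a); lia.
by rewrite xE addnK -!mulnn; nia.
Qed.

Lemma sum_squares m : 6 * (\sum_(k < m.+1) k ^ 2) = m * m.+1 * (2 * m).+1.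
Proof.
elim: m => [|m IH]; first by rewrite big_ord_recl big_ord0.
by rewrite big_ord_recr /= mulnDr IH; ring.
Qed.

(** The sum over i is bounded by a quotient, the sum over j by the area of a
triangle ([sum_slices]), and the sum over k is a sum of squares.  An
integral in place of the last one would not suffice for (a, b) = (4, 5). *)
Lemma high_gaps_bound_volume : 12 * a * high_gaps_bound <= b * c * (a.-1 * (2 * a).-1).
Proof.
have ab0 : 0 < a * b by rewrite muln_gt0 a_gt0 b_gt0.
have -> : high_gaps_bound = \sum_(k < a) \sum_(j < b) slice_bound j k.
  rewrite /high_gaps_bound sumnE big_map -[a in iota 0 a]subn0 -/(index_iota 0 a) big_mkord.
  apply: eq_bigr => k _.
  by rewrite sumnE big_map -[b in iota 0 b]subn0 -/(index_iota 0 b) big_mkord.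
have slice k : 2 * a * (a * b * \sum_(j < b) slice_bound j k) <= c * ((a - k.+1) * b) ^ 2.
  apply: leq_trans (_ : 2 * a * (c * \sum_(j < b) ((a - k.+1) * b - j.+1 * a)) <= _).
    rewrite leq_mul2l; apply/orP; right; rewrite !big_distrr; apply: leq_sum => j _ /=.
    by rewrite /slice_bound mulnC mulnBl subnAC leq_trunc_div.
  by rewrite mulnCA leq_mul2l sum_slices orbT.
rewrite -(leq_pmul2r ab0).
apply: leq_trans (_ : 6 * (c * b ^ 2 * \sum_(k < a) k ^ 2) <= _); last first.
  have := sum_squares a.-1; rewrite (prednK a_gt0) => E.
  by rewrite mulnCA E (_ : (2 * a.-1).+1 = (2 * a).-1) ?expnS; [nia|lia].
have -> : 12 * a * (\sum_(k < a) \sum_(j < b) slice_bound j k) * (a * b) =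
  6 * \sum_(k < a) (2 * a * (a * b * \sum_(j < b) slice_bound j k)).
  by rewrite -!big_distrr /=; ring.
rewrite leq_mul2l big_distrr (reindex_inj rev_ord_inj) /=; apply: leq_sum => k _.
apply: leq_trans (slice _) _; have -> : a - (a - k.+1).+1 = k by have := ltn_ord k; lia.
by rewrite expnMn [k ^ 2 * _]mulnC mulnA.
Qed.

End Semigroup.

(** The volume bound implies the claim unless (a, b) = (4, 5) and c < 16, or
(a, b, c) = (5, 6, 7); in these cases the lattice points are counted. *)
Lemma high_gaps_bound_small a b c : 4 <= a -> a < b -> b < c ->
  coprime a b -> coprime a c -> coprime b c -> (a, b, c) <> (4, 5, 7) ->
  4 * high_gaps_bound a b c + 3 * (a * b + a * c + b * c) + 7 <= 2 * (a * b * c).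
Proof.
move=> a4 ltab ltbc cab cac cbc n457.
have poly : b * c * (a.-1 * (2 * a).-1) + 3 * a * (3 * (a * b + a * c + b * c) + 7)
      <= 3 * a * (2 * (a * b * c)) ->
    4 * high_gaps_bound a b c + 3 * (a * b + a * c + b * c) + 7 <= 2 * (a * b * c).
  move=> le; have vol := high_gaps_bound_volume (ltnW (ltnW a4)) ltab ltbc cab cac cbc.
  rewrite -(@leq_pmul2l (3 * a)); last by clear -a4; lia.
  apply: leq_trans le; move: vol; move: (high_gaps_bound a b c) (b * c * _) => H V vol.
  by rewrite -addnA mulnDr leq_add2r (_ : 3 * a * (4 * H) = 12 * a * H) //; ring.
have [a6|] := leqP 6 a.
  apply: poly.
  have [z aE] : exists z, a = 6 + z by exists (a - 6); lia.
  have [x bE] : exists x, b = 7 + x by exists (b - 7); lia.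
  have [y cE] : exists y, c = 8 + y by exists (c - 8); lia.
  have h : 56 * (b + c) <= 15 * (b * c) by rewrite bE cE; nia.
  have {}h : 56 * (b + c) * (9 * (a * a)) <= 15 * (b * c) * (9 * (a * a)) by rewrite leq_mul2r
    h orbT.
  have bc56 : 56 <= b * c by rewrite bE cE; nia.
  have h2 : 1176 * a <= b * c * (89 * (a * a) - 336 * a - 56).
    apply: leq_trans (_ : 56 * (89 * (a * a) - 336 * a - 56) <= _);
      last by rewrite leq_mul2r bc56 orbT.
    by rewrite aE; nia.
  have e1 : 89 * (a * a) - 336 * a - 56 + 336 * a + 56 = 89 * (a * a) by rewrite aE; nia.
  have e2 : a.-1 * (2 * a).-1 + 3 * a = 2 * (a * a) + 1 by rewrite aE; nia.
  move: h h2 e1 e2; move: (89 * (a * a) - 336 * a - 56) (a.-1 * (2 * a).-1) => u v h h2 e1 e2.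
  have e3 : b * c * v + b * c * (3 * a) = b * c * (2 * (a * a) + 1) by rewrite -mulnDr e2.
  have e4 : b * c * u + b * c * (336 * a + 56) = b * c * (89 * (a * a)) by rewrite -e1; ring.
  nia.
move=> a6; have [aE|aE] : a = 4 \/ a = 5 by lia.
  subst a.
  have [b5|b5] := eqVneq b 5.
    subst b; have [c16|c16] := leqP 16 c; first by apply: poly; lia.
    have : c \in [:: 6; 7; 8; 9; 10; 11; 12; 13; 14; 15] by rewrite !inE; lia.
    by rewrite !inE; do ![case/predU1P => [?|]; first by subst c; vm_compute in *];
      move=> /eqP ?; subst c.
  have b7 : 7 <= b.
    suff : b != 6 by lia.
    by apply/eqP => b6; subst b.
  have c9 : 9 <= c.
    suff : c != 8 by lia.
    by apply/eqP => b6; subst c.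
  apply: poly.
  have [x bE] : exists x, b = 7 + x by exists (b - 7); lia.
  have [y cE] : exists y, c = 9 + y by exists (c - 9); lia.
  by rewrite bE cE /=; nia.
subst a.
have [b6|b6] := eqVneq b 6.
  subst b; have [c8|c8] := leqP 8 c; first by apply: poly; lia.
  have -> : c = 7 by lia.
  by vm_compute.
apply: poly.
have [x bE] : exists x, b = 7 + x by exists (b - 7); lia.
have [y cE] : exists y, c = 8 + y by exists (c - 8); lia.
by rewrite bE cE /=; nia.
Qed.

Lemma high_gaps_small a b c : 4 <= a -> a < b -> b < c ->
  coprime a b -> coprime a c -> coprime b c -> (a, b, c) <> (4, 5, 7) ->
  a * b + a * c + b * c + 2 * size (high_gaps a b c) + 4 <= size (gaps a b c).
Proof.
move=> a4 ltab ltbc cab cac cbc n457.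
have := high_gaps_bound_small a4 ltab ltbc cab cac cbc n457.
have a2 : 2 <= a by lia.
have := double_size_gaps a2 ltab ltbc cab cac cbc.
have := size_high_gaps a2 ltab ltbc cab cac cbc.
have := frobE a2 ltab ltbc.
rewrite /conductor -addnn; lia.
Qed.

(** * Chains of irreducible sets obtained from a parametrized family *)

Local Open Scope ring_scope.

Lemma ex_nonroot (K : numDomainType) (P : {poly K}) :
  P != 0 -> exists x, P.[x] != 0.
Proof.
move=> nzP; pose rs := [seq i%:R : K | i <- iota 0 (size P)].
have [/(max_poly_roots nzP) ltP | /allPn[x _ nx]] := boolP (all (root P) rs).
  have /ltP : uniq rs by rewrite map_inj_uniq ?iota_uniq //; apply: mulrIn (oner_neq0 _).
  by rewrite size_map size_iota ltnn.
by exists x.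
Qed.

Lemma meval_mmap (K : comNzRingType) (S : comNzRingType) n (f : {rmorphism K -> S})
    (h : 'I_n -> S) (g : {rmorphism S -> K}) (F : {mpoly K[n]}) :
  (forall c, g (f c) = c) -> g (mmap f h F) = F.@[fun i => g (h i)].
Proof.
move=> gf; rewrite /meval /mmap rmorph_sum; apply: eq_bigr => m _.
rewrite rmorphM /= gf; congr (_ * _); rewrite /mmap1 rmorph_prod.
by apply: eq_bigr => i _; rewrite rmorphXn.
Qed.

Arguments meval_mmap {K S n f h} g F.

Section Line.
Variables (K : numClosedFieldType) (n : nat).
Implicit Types (u v : 'I_n -> K) (H : {mpoly K[n]}).

(** The restriction of [H] to the line through [u] and [v], parametrized so that
0 and 1 correspond to [u] and [v]. *)
Definition line_restriction u v H : {poly K} :=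
  mmap polyC (fun i => (u i)%:P + (v i - u i) *: 'X) H.

Lemma horner_line u v H l :
  (line_restriction u v H).[l] = H.@[fun i => u i + l * (v i - u i)].
Proof.
rewrite -horner_evalE (meval_mmap (horner_eval l)); last first.
  by move=> c; exact: hornerC.
apply: meval_eq => i.
transitivity ((u i)%:P + (v i - u i) *: 'X).[l] => //.
by rewrite !hornerE mulrC.
Qed.

Lemma line_neq0 u v H l : H.@[fun i => u i + l * (v i - u i)] != 0 ->
  line_restriction u v H != 0.
Proof. by apply: contraNneq => e; rewrite -horner_line e horner0. Qed.
End Line.

Lemma meval_at0 (K : numClosedFieldType) n (u v : 'I_n -> K) (H : {mpoly K[n]}) :
  H.@[u] = H.@[fun i => u i + 0 * (v i - u i)].
Proof. by apply: meval_eq => i; rewrite mul0r addr0. Qed.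
Lemma meval_at1 (K : numClosedFieldType) n (u v : 'I_n -> K) (H : {mpoly K[n]}) :
  H.@[v] = H.@[fun i => u i + 1 * (v i - u i)].
Proof. by apply: meval_eq => i; rewrite mul1r addrC subrK. Qed.

Section ChainLower.
Variables (K : numClosedFieldType) (p q n : nat).
Variables (X : set 'M[K]_(p, q)) (Phi : 'M[{mpoly K[n]}]_(p, q)).
Variables (u0 : 'I_n -> K) (s : seq 'I_n) (D : {mpoly K[n]}).
Variables (i0 : 'I_p) (j0 : 'I_q).
Hypotheses (us : uniq s) (Phi00 : Phi i0 j0 = 1).
Hypothesis Phis : forall v, v \in s -> exists i j, Phi i j = 'X_v.
Hypothesis Du0 : D.@[u0] != 0.
Hypothesis DX : forall u, D.@[u] != 0 -> X (map_mx (meval u) Phi).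

Definition member u : 'M[K]_(p, q) := map_mx (meval u) Phi.

Definition pull (F : {mpoly K[p * q]}) : {mpoly K[n]} :=
  mmap (@mpolyC n K) (mxvec Phi 0) F.

Lemma meval_pull F u : (pull F).@[u] = F.@[mxvec (member u) 0].
Proof.
rewrite /pull (meval_mmap (meval u)); last by move=> c; exact: mevalC.
by apply: meval_eq => k; case/mxvec_indexP: k => i j; rewrite !mxvecE [RHS]mxE.
Qed.

Definition slice k : set ('I_n -> K) :=
  [set u | D.@[u] != 0 /\ forall v, v \notin take k s -> u v = u0 v].

Definition slice_eqs k : set {mpoly K[p * q]} :=
  [set F | (exists l : nat, F \is l.-homog) /\
           forall u, slice k u -> F.@[mxvec (member u) 0] = 0].

Definition slice_closure k := X `&` zero_locus (slice_eqs k).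

Lemma member_closure k u : slice k u -> slice_closure k (member u).
Proof.
move=> su; split; first by apply: DX; case: su.
by move=> F [_]; apply.
Qed.

Lemma slice_u0 k : slice k u0.
Proof. by split. Qed.

(** If two homogeneous equations fail at points u1 and u2 of the slice, then both
fail, and D does not vanish, at some point of the line joining u1 and u2: the
restrictions of the two equations and of D to this line are nonzero polynomials
in one variable.  The line stays in the slice, which is cut out by the affine
conditions u v = u0 v. *)
Lemma slice_closure_irr k : irreducible_closed X (slice_closure k).
Proof.
split.
- by exists (slice_eqs k) => // F [].
- by exists (member u0); apply/member_closure/slice_u0.
move=> Z1 Z2 [E1 hE1 ->] [E2 hE2 ->] sub.
have key E : homogeneous_eqs E -> ~ slice_closure k `<=` X `&` zero_locus E ->
    exists F u, [/\ E F, slice k u & F.@[mxvec (member u) 0] != 0].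
  move=> hE nS; apply: contrapT => nH; apply: nS => A [XA ZA]; split=> // F EF.
  apply: ZA; split; first exact: hE.
  move=> u su; apply/eqP; apply/negPn/negP => ne.
  by apply: nH; exists F, u.
have [?|/(key _ hE1) [F1 [u1 [EF1 [D1 s1] n1]]]] :=
  pselect (slice_closure k `<=` X `&` zero_locus E1); first by left.
have [?|/(key _ hE2) [F2 [u2 [EF2 [D2 s2] n2]]]] :=
  pselect (slice_closure k `<=` X `&` zero_locus E2); first by right.
exfalso.
pose L := line_restriction u1 u2.
have nz : L (pull F1) * L (pull F2) * L D != 0.
  rewrite !mulf_neq0 //.
  - by apply: (line_neq0 (l := 0)); rewrite -meval_at0 meval_pull.
  - by apply: (line_neq0 (l := 1)); rewrite -meval_at1 meval_pull.
  - by apply: (line_neq0 (l := 0)); rewrite -meval_at0.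
have [l] := ex_nonroot nz.
rewrite !hornerM !horner_line !meval_pull !mulf_eq0 !negb_or -!andbA.
set u := (fun i => _) => /and3P[f1 f2 fD].
have su : slice k u by split=> // v nv; rewrite /u s1 ?s2 // subrr mulr0 addr0.
have [[_ /(_ _ EF1)/eqP]|[_ /(_ _ EF2)/eqP]] := sub _ (member_closure su).
- by rewrite (negPf f1).
- by rewrite (negPf f2).
Qed.

(** The parameter v that is freed is an entry of [Phi], and another entry is the
constant 1.  So 'X_v - u0 v is the pullback of a homogeneous linear form, which
vanishes on the smaller slice and not on the larger one. *)
Lemma slice_closure_proper k : (k < size s)%N ->
  slice_closure k `<` slice_closure k.+1.
Proof.
move=> ks; have [v0 _] : exists v,
  v \in s by exists (nth (tnth (in_tuple s) (Ordinal ks)) s k); rewrite mem_nth.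
pose v := nth v0 s k.
have vs : v \in s by rewrite mem_nth.
have tk : take k.+1 s = rcons (take k s) v by rewrite (take_nth v0).
have nvk : v \notin take k s.
  by move: (take_uniq k.+1 us); rewrite tk rcons_uniq => /andP[].
have [i [j Pij]] := Phis vs.
split.
  move=> A [XA ZA]; split=> // F [hF FF]; apply: ZA; split=> // u [Du su].
  by apply: FF; split=> // w nw; apply: su; apply: contra nw; rewrite tk mem_rcons inE orbC => ->.
move=> sub.
pose F : {mpoly K[p * q]} := 'X_(mxvec_index i j) - u0 v *: 'X_(mxvec_index i0 j0).
have FE u : F.@[mxvec (member u) 0] = u v - u0 v.
  rewrite mevalB mevalZ !mevalXU !mxvecE !mxE Pij Phi00.
  by rewrite mevalXU meval1 mulr1.
have EF : slice_eqs k F.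
  split; first by exists 1%N; rewrite dhomogD ?dhomogN ?dhomogZ // dhomogX /= mdeg1.
  by move=> u [_ su]; rewrite FE su ?subrr.
pose u1 w := if w == v then u0 v + 1 else u0 w.
(* The factor 'X moves the coordinate v away from u0 v, while D stays nonzero. *)
have [l nl] : exists l, ('X * line_restriction u0 u1 D).[l] != 0.
  apply: ex_nonroot; rewrite mulf_neq0 ?polyX_eq0 //.
  by apply: (line_neq0 (l := 0)); rewrite -meval_at0.
move: nl; rewrite hornerM hornerX horner_line mulf_eq0 negb_or => /andP[nl Du].
set u := (fun i => _) in Du.
have su : slice k.+1 u.
  split=> // w; rewrite tk mem_rcons inE negb_or => /andP[nwv _].
  by rewrite /u /u1 (negPf nwv) subrr mulr0 addr0.
have [_ /(_ _ EF)/eqP] := sub _ (member_closure su).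
rewrite FE /u /u1 eqxx addrAC subrr add0r [u0 v + 1]addrC addrK mulr1.
by rewrite (negPf nl).
Qed.

(** A lower bound for the dimension of [X] by the number of parameters of a
family, without reference to the fibres of the parametrization: the
parameters in [s] can be read off from the matrix up to scale. *)
Lemma irreducible_chain_of_family : exists W, irreducible_chain X (size s) W.
Proof.
exists slice_closure; split=> [k _|k ks]; first exact: slice_closure_irr.
exact: slice_closure_proper.
Qed.
End ChainLower.

(** * Chains of irreducible sets in a cone *)

(** The closures in [X] of the members of the chain again form a chain, because a
closed subset of [Z] is recovered from its closure by intersecting with
[Z]. *)
Lemma irreducible_chain_sub (K : fieldType) (p q k : nat) (Z X : set 'M[K]_(p, q)) W :
  Z `<=` X -> irreducible_chain Z k W -> exists W', irreducible_chain X k W'.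
Proof.
move=> ZX [irrW ltW].
pose I i : set {mpoly K[p * q]} :=
  [set F | (exists l : nat, F \is l.-homog) /\ forall A, W i A -> F.@[mxvec A 0] = 0].
pose W' i := X `&` zero_locus (I i).
have closW i : (i <= k)%N -> W i = Z `&` W' i.
  move=> /irrW[[E hE eqW] _ _]; apply/seteqP; split=> [A WA|A [ZA [XA IA]]].
    have ZA : Z A by move: WA; rewrite eqW => -[].
    by split=> //; split; [exact: ZX|move=> F [_]; apply].
  rewrite eqW; split=> // F EF; apply: IA; split; first exact: hE.
  by move=> B; rewrite eqW => -[_]; apply.
exists W'; split=> [i ik|i ik].
  have [_ [A WA] irr] := irrW _ ik.
  split.
  - by exists (I i) => // F [].
  - by exists A; move: WA; rewrite closW // => -[].
  move=> Z1 Z2 [E1 hE1 ->] [E2 hE2 ->] sub.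
  have cl E : homogeneous_eqs E -> closed_in Z (Z `&` zero_locus E) by exists E.
  have up E : homogeneous_eqs E -> W i `<=` Z `&` zero_locus E ->
      W' i `<=` X `&` zero_locus E.
    move=> hE WE B [XB IB]; split=> // F EF; apply: IB; split; first exact: hE.
    by move=> C /WE[_]; apply.
  case: (irr _ _ (cl _ hE1) (cl _ hE2)) => [B|/(up _ hE1)|/(up _ hE2)]; [|by left|by right].
  by rewrite closW // => -[ZB /sub[[_ ?]|[_ ?]]]; [left|right].
have [sub nsub] := ltW _ ik.
split=> [A [XA IA]|sub'].
  by split=> // F [hF vF]; apply: IA; split=> // B /sub; apply: vF.
apply: nsub => A; rewrite closW // => -[ZA /sub' W'A].
by rewrite closW ?(ltnW ik).
Qed.

Lemma meval_homog (K : comNzRingType) n (F : {mpoly K[n]}) k l (v w : 'I_n -> K) :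
  F \is k.-homog -> (forall i, w i = l * v i) -> F.@[w] = l ^+ k * F.@[v].
Proof.
move=> /dhomogP hF wE; rewrite !mevalE mulr_sumr big_seq [RHS]big_seq.
apply: eq_bigr => m mF; rewrite mulrCA; congr (_ * _).
have -> : k = mdeg m by rewrite -(hF _ mF).
rewrite mdegE -prodrXr -big_split /=.
by apply: eq_bigr => i _; rewrite wE exprMn.
Qed.

Section UpperBound.
Variables (K : numClosedFieldType) (p q : nat) (X : set 'M[K]_(p, q)).
Implicit Types (W : set 'M[K]_(p, q)) (F G H : {mpoly K[p * q]}).
Hypothesis coneX : forall A l, X A -> l != 0 -> X (l *: A).

Definition vanishes_on W F := forall A, W A -> F.@[mxvec A 0] = 0.

Lemma meval_scale k F A l : F \is k.-homog ->
  F.@[mxvec (l *: A) 0] = l ^+ k * F.@[mxvec A 0].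
Proof. by move=> hF; apply: meval_homog => // i; rewrite linearZ mxE. Qed.

(** Irreducibility concerns homogeneous equations, whereas [H] is arbitrary.
Since [W] is a cone, the vanishing of F H at all l A with l nonzero makes
F H_d vanish at A for every homogeneous component H_d of [H]. *)
Lemma vanishes_on_prime W k F H : irreducible_closed X W -> F \is k.-homog ->
  vanishes_on W (F * H) -> vanishes_on W F \/ vanishes_on W H.
Proof.
move=> [[E hE WE] _ irr] hF vFH.
have [|nF] := pselect (vanishes_on W F); [by left|right].
have WX A : W A -> X A by rewrite WE => -[].
have coneW A l : W A -> l != 0 -> W (l *: A).
  rewrite WE => -[XA ZA] nzl; split; first exact: coneX.
  by move=> G EG; have [r hG] := hE _ EG; rewrite (meval_scale _ _ hG) ZA ?mulr0.
pose Hd d := pihomog mdeg d H.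
have HE : H = \sum_(d < mmeasure mdeg H) Hd d by exact: pihomog_partitionE.
have hHd d : Hd d \is d.-homog by exact: pihomogP.
suff vd d : (d < mmeasure mdeg H)%N -> vanishes_on W (Hd d).
  by move=> A WA; rewrite HE raddf_sum big1 //= => d _; apply: vd.
move=> ltd.
have split A : W A -> F.@[mxvec A 0] * (Hd d).@[mxvec A 0] = 0.
  move=> WA; pose P : {poly K} := \poly_(j < mmeasure mdeg H) (F.@[mxvec A 0] * (Hd j).@[mxvec
    A 0]).
  suff P0 : P = 0 by have := coef_poly (mmeasure mdeg H) (fun j =>
    F.@[mxvec A 0] * (Hd j).@[mxvec A 0]) d; rewrite -/P P0 coef0 ltd.
  apply/eqP/negPn/negP => nzP.
  have [l] : exists l, ('X * P).[l] != 0 by apply: ex_nonroot; rewrite mulf_neq0 ?polyX_eq0.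
  rewrite hornerM hornerX mulf_eq0 negb_or => /andP[nzl /eqP]; apply.
  have := vFH _ (coneW _ _ WA nzl); rewrite mevalM (meval_scale _ _ hF) HE raddf_sum /=.
  move/eqP; rewrite -mulrA mulf_eq0 expf_eq0 (negPf nzl) andbF /= => /eqP <-.
  rewrite horner_poly mulr_sumr; apply: eq_bigr => j _.
  by rewrite (meval_scale _ _ (hHd j)) mulrCA mulrA mulrC mulrA.
pose E1 : set {mpoly K[p * q]} := [set F]; pose E2 : set {mpoly K[p * q]} := [set Hd d].
case: (irr (X `&` zero_locus E1) (X `&` zero_locus E2)).
- by exists E1 => // _ ->; exists k.
- by exists E2 => // _ ->; exists d.
- move=> A WA; have /eqP := split _ WA; rewrite mulf_eq0 => /orP[]/eqP e.
    by left; split; [exact: WX|move=> _ ->].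
  by right; split; [exact: WX|move=> _ ->].
- by move=> sub; case: nF => A /sub[_]; apply.
by move=> sub A /sub[_]; apply.
Qed.

Fixpoint box (m r : nat) : seq (seq nat) :=
  if r is r'.+1 then [seq j :: e | j <- iota 0 m, e <- box m r'] else [:: [::]].

Lemma size_box m r : size (box m r) = (m ^ r)%N.
Proof. by elim: r => //= r IH; rewrite size_allpairs size_iota IH expnS. Qed.

Lemma box_uniq m r : uniq (box m r).
Proof.
elim: r => //= r IH; apply: allpairs_uniq => //; first exact: iota_uniq.
by move=> [j e] [j' e'] _ _ /= [-> ->].
Qed.

Fixpoint power_product (ys : seq {mpoly K[p * q]}) (e : seq nat) : {mpoly K[p * q]} :=
  match ys, e with
  | y :: ys', j :: e' => y ^+ j * power_product ys' e'
  | _, _ => 1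
  end.

(** Independence of the restrictions of [ys] to [W], tested on the polynomials
with all exponents smaller than m, for every m. *)
Definition alg_independent W ys := forall m (c : seq nat -> K),
  vanishes_on W (\sum_(e <- box m (size ys)) c e *: power_product ys e) ->
  forall e, e \in box m (size ys) -> c e = 0.

(** In a relation between F and ys on W', the coefficients of the powers of F are
polynomials in ys.  If F^j is the lowest power present, it can be cancelled, as
the ideal of W' is prime and does not contain F;
  restricted to W, where F vanishes, the quotient is a
relation between ys alone. *)
Lemma alg_independent_cons W W' k F ys :
  irreducible_closed X W' -> W `<=` W' -> F \is k.-homog ->
  vanishes_on W F -> ~ vanishes_on W' F ->
  alg_independent W ys -> alg_independent W' (F :: ys).
Proof.
move=> irrW' sub hF vF nvF indW m c /= vS.
pose G j := \sum_(e <- box m (size ys)) c (j :: e) *: power_product ys e.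
have cancelF j H : vanishes_on W' (F ^+ j * H) -> vanishes_on W' H.
  elim: j H => [|j IH] H; first by rewrite mul1r.
  by rewrite exprS -mulrA => /(vanishes_on_prime irrW' hF)[|/IH].
have main j : (j < m)%N -> forall e, e \in box m (size ys) -> c (j :: e) = 0.
  elim/ltn_ind: j => j IH ltjm.
  apply: (indW m (fun e => c (j :: e))).
  (* The relation divided by F^j, its coefficients below j being zero by induction. *)
  pose H := \sum_(0 <= i < m - j) F ^+ i * G (i + j)%N.
  have vH : vanishes_on W' H.
    apply: (cancelF j) => A /vS; rewrite big_allpairs_dep /= => <-; congr (_.@[_]).
    have -> : iota 0 m = index_iota 0 m by rewrite /index_iota subn0.
    rewrite (@big_cat_nat _ _ _ j) //=; last exact: ltnW.
    rewrite big_nat big1 ?add0r => [|i /andP[_ ltij]]; last first.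
      rewrite big_seq big1 // => e be; rewrite IH ?scale0r // (ltn_trans ltij) //.
    rewrite -[X in index_iota X _]add0n big_addn /H mulr_sumr; apply: eq_bigr => i _.
    rewrite mulrA -exprD /G mulr_sumr addnC; apply: eq_bigr => e _.
    by rewrite scalerAr.
  move=> A WA; have := vH _ (sub _ WA).
  rewrite /H -{1}(prednK (n := (m - j)%N)) ?subn_gt0 // big_nat_recl // add0n mul1r.
  rewrite mevalD [X in _ + X]raddf_sum [X in _ + X]big1 /= => [|i _]; first by rewrite addr0.
  by rewrite mevalM rmorphXn /= vF // expr0n mul0r.
move=> e /allpairsP[[j e']] /= [jm be ->]; apply: main => //.
by rewrite mem_iota in jm.
Qed.

End UpperBound.

(** A multi-exponent of degree less than L has all its entries less than L. *)
Lemma card_bmultinom n L : (#|{: 'X_{1..n < L}}| <= L ^ n)%N.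
Proof.
pose f (m : 'X_{1..n < L}) : {ffun 'I_n -> 'I_L} :=
  [ffun i => insubd (Ordinal (leq_ltn_trans (leq0n _) (bmdeg m))) (bmnm m i)].
have mi (m : 'X_{1..n < L}) i : (m i < L)%N.
  by apply: leq_ltn_trans (bmdeg m); rewrite mdegE (bigD1 i) //= leq_addr.
have injf : injective f.
  move=> m1 m2 e; apply/val_inj/mnmP => i.
  have := congr1 (fun g : {ffun _ -> _} => val (g i)) e.
  by rewrite !ffunE !val_insubd !mi.
by have := leq_card f injf; rewrite card_ffun !card_ord.
Qed.

(** There are at most L^n monomials of degree less than L in n variables. *)
Lemma linear_dependence (K : fieldType) n L (Fs : seq {mpoly K[n]}) :
  (forall G, G \in Fs -> (msize G <= L)%N) -> (L ^ n < size Fs)%N ->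
  exists2 c : 'I_(size Fs) -> K, (exists i, c i != 0) & \sum_i c i *: Fs`_i = 0.
Proof.
move=> szF ltF.
pose T : finType := 'X_{1..n < L}.
pose M : 'M[K]_(size Fs, #|T|) := \matrix_(i, j) (Fs`_i)@_(bmnm (enum_val j)).
have rkM : (\rank M < size Fs)%N.
  by apply: leq_ltn_trans (rank_leq_col _) (leq_ltn_trans (card_bmultinom _ _) ltF).
have /rowV0Pn[c /sub_kermxP cM nzc] : kermx M != 0.
  by rewrite kermx_eq0 /row_free neq_ltn rkM.
exists (fun i => c 0 i).
  exact/rV0Pn.
apply/mpolyP => m; rewrite raddf_sum mcoeff0 /=.
have [ltm|lem] := ltnP (mdeg m) L.
  have := congr1 (fun A : 'rV[K]_#|T| => A 0 (enum_rank (BMultinom ltm))) cM.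
  rewrite [LHS]mxE [RHS]mxE => cM0; rewrite -[RHS]cM0; apply: eq_bigr => i _.
  by rewrite [in RHS]mxE enum_rankK /= mcoeffZ.
rewrite big1 // => i _; rewrite mcoeffZ memN_msupp_eq0 ?mulr0 //.
by apply: msize_mdeg_ge; apply: leq_trans lem; apply/szF/mem_nth.
Qed.

Lemma expn_leq x y N : (x <= y -> x ^ N <= y ^ N)%N.
Proof. by move=> le; elim: N => // N IH; rewrite !expnS leq_mul. Qed.

Section DimensionBound.
Variables (K : numClosedFieldType) (p q : nat) (X : set 'M[K]_(p, q)).
Hypothesis coneX : forall A l, X A -> l != 0 -> X (l *: A).
Hypothesis nz_X : forall A, X A -> A != 0.

Lemma msize_mul_leq (F G : {mpoly K[p * q]}) s t :
  (msize F <= s.+1 -> msize G <= t.+1 -> msize (F * G) <= (s + t).+1)%N.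
Proof.
have [->|nzF] := eqVneq F 0; first by rewrite mul0r msize0.
have [->|nzG] := eqVneq G 0; first by rewrite mulr0 msize0.
rewrite msizeM //; move: (msize F) (msize G) => u v; lia.
Qed.

Lemma msize_power_product L (ys : seq {mpoly K[p * q]}) m e :
  (forall y, y \in ys -> (msize y <= L.+1)%N) -> e \in box m (size ys) ->
  (msize (power_product ys e) <= (size ys * m * L).+1)%N.
Proof.
elim: ys e => [|y ys IH] e szy; first by case: e => [|? ?]; rewrite msize1.
move=> /allpairsP[[j e'] /= [jm be ->]] /=.
have szj : (msize (y ^+ j) <= (j * L).+1)%N.
  elim: (j) => [|i IHi]; first by rewrite expr0 msize1.
  by rewrite exprS mulSn msize_mul_leq // szy ?mem_head.
have szm := IH _ (fun z zy => szy z (mem_behead (s := y :: ys) zy)) be.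
rewrite mem_iota add0n in jm.
rewrite mulSn mulnDl; apply: msize_mul_leq szm; apply: leq_trans szj _.
by rewrite ltnS leq_mul2r ltnW ?orbT //; case/andP: jm.
Qed.

(** With r polynomials of degree at most L in N < r variables, the m^r products
with exponents below m have degree at most r m L, so they lie in a space of
dimension at most (r m L + 1)^N, which is less than m^r for large m. *)
Lemma alg_independent_size (W : set 'M[K]_(p, q)) ys :
  alg_independent W ys -> (size ys <= p * q)%N.
Proof.
move=> indW; rewrite leqNgt; apply/negP => lts.
pose N := (p * q)%N; pose r := size ys.
pose L := (\sum_(y <- ys) msize y)%N.
(* This choice of m gives (B m)^N = B^N m^N < m^(N+1) <= m^r. *)
pose B := (r * L).+1; pose m := (B ^ N).+1.
have szy y : y \in ys -> (msize y <= L.+1)%N.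
  by move=> yys; apply: leqW; rewrite /L (big_rem y) //= leq_addr.
pose Fs := [seq power_product ys e | e <- box m r].
have szF : size Fs = (m ^ r)%N by rewrite size_map size_box.
have [G||c [i nzc] /= sumc] := @linear_dependence K N (r * m * L).+1 Fs.
- by move=> /mapP[e be ->]; apply: msize_power_product.
- rewrite szF; apply: (@leq_ltn_trans ((B * m) ^ N)).
    by apply: expn_leq; rewrite /B; nia.
  apply: (@leq_trans (m ^ N.+1)); last by rewrite leq_exp2l // ltnS expn_gt0.
  by rewrite expnMn expnS ltn_mul2r expn_gt0 /= ltnS leqnn.
have ltie : (i < size (box m r))%N by rewrite -(size_map (power_product ys)).
pose c' e := if insub (index e (box m r)) is Some j then c j else 0.
have vs : vanishes_on W (\sum_(e <- box m r) c' e *: power_product ys e).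
  move=> A _; rewrite [X in X.@[_]](_ : _ = 0) ?meval0 //; rewrite -[RHS]sumc.
  rewrite (big_nth [::]) big_mkord (_ : size (box m r) = size Fs) ?size_map //;
    apply: eq_bigr => j _.
  have ltj : (j < size (box m r))%N by rewrite -(size_map (power_product ys)).
  rewrite /Fs (nth_map [::]) //; congr (_ *: _).
  by rewrite /c' index_uniq ?box_uniq // insubT //= => ?; congr (c _); apply: val_inj.
have := indW _ _ vs (nth [::] (box m r) i) (mem_nth _ ltie).
rewrite /c' index_uniq ?box_uniq // insubT //= => ? /eqP.
by rewrite (_ : Sub _ _ = i) ?(negPf nzc) //; apply: val_inj.
Qed.

(** Along the line of multiples of a nonzero matrix of W, a coordinate takes
infinitely many values. *)
Lemma alg_independent_coord (W : set 'M[K]_(p, q)) :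
  irreducible_closed X W -> exists y, alg_independent W [:: y].
Proof.
move=> [[E hE ->] [A [XA ZA]] _].
have /matrix0Pn[i [j nzA]] := nz_X XA.
exists 'X_(mxvec_index i j) => m c /= vS e.
rewrite allpairs1r => /mapP[k]; rewrite mem_iota /= add0n => ltkm ->.
pose P : {poly K} := \poly_(l < m) (c [:: l] * A i j ^+ l).
have P0 : P = 0.
  apply/eqP/negPn/negP => nzP.
  have [l] : exists l, ('X * P).[l] != 0 by apply: ex_nonroot; rewrite mulf_neq0 ?polyX_eq0.
  rewrite hornerM hornerX mulf_eq0 negb_or => /andP[nzl /eqP]; apply.
  have lA : (X `&` zero_locus E) (l *: A).
    split=> [|F EF]; first exact: coneX.
    by have [k' hF] := hE _ EF; rewrite (meval_scale _ _ hF) ZA ?mulr0.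
  rewrite -(vS _ lA) horner_poly allpairs1r big_map raddf_sum /=.
  have -> : iota 0 m = index_iota 0 m by rewrite /index_iota subn0.
  rewrite big_mkord; apply: eq_bigr => k' _.
  by rewrite mulr1 mevalZ rmorphXn /= mevalXU mxvecE mxE exprMn -mulrA [A i j ^+ _ * _]mulrC.
have /eqP := coef_poly m (fun l => c [:: l] * A i j ^+ l) k; rewrite -/P P0 coef0 ltkm eq_sym.
by rewrite mulf_eq0 expf_eq0 (negPf nzA) andbF orbF => /eqP.
Qed.

(** Each step of the chain enlarges an independent family by a form which vanishes
on the smaller set and not on the larger one ([alg_independent_cons]).  The
chain starts with one polynomial because W 0 is a nonempty cone of nonzero
matrices. *)
Lemma irreducible_chain_bound k W : irreducible_chain X k W -> (k < p * q)%N.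
Proof.
move=> [irrW ltW].
suff [ys szys indys] : exists2 ys, size ys = k.+1 & alg_independent (W k) ys.
  by rewrite -szys; apply: alg_independent_size indys.
have step i : (i <= k)%N -> exists2 ys, size ys = i.+1 & alg_independent (W i) ys.
  elim: i => [_|i IH ltik].
    by have [y indy] := alg_independent_coord (irrW 0 isT); exists [:: y].
  have [ys szys indys] := IH (ltnW ltik).
  have [sub nsub] := ltW _ ltik.
  have [[E hE WE] _ _] := irrW _ (ltnW ltik).
  have irrW' := irrW _ ltik; have [[E' hE' WE'] _ _] := irrW'.
  have [F EF nF] : exists2 F, E F & ~ vanishes_on (W i.+1) F.
    apply: contrapT => nE; apply: nsub => A WA; rewrite WE.
    split=> [|F EF]; first by move: WA; rewrite WE' => -[].
    by apply: contrapT => nFA; apply: nE; exists F => // vF; apply/nFA/vF.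
  have [l hF] := hE _ EF.
  exists (F :: ys); first by rewrite /= szys.
  apply: (alg_independent_cons coneX irrW' sub hF _ nF indys).
  by move=> A; rewrite WE => -[_]; apply.
exact: step (leqnn k).
Qed.

Lemma krull_dim_exists (Z : set 'M[K]_(p, q)) k W :
  Z `<=` X -> irreducible_chain Z k W -> exists2 e, krull_dim Z e & (k <= e)%N.
Proof.
move=> ZX chainW.
pose P e := `[< exists W', irreducible_chain Z e W' >].
have exP : exists e, P e by exists k; apply/asboolP; exists W.
have bndP e : P e -> (e <= p * q)%N.
  move=> /asboolP[W' chW']; have [W'' chW''] := irreducible_chain_sub ZX chW'.
  exact/ltnW/(irreducible_chain_bound chW'').
have [e /asboolP[W' chW'] maxe] := ex_maxnP exP bndP.
exists e; last by apply: maxe; apply/asboolP; exists W.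
split; first by exists W'.
by move=> l W'' chl; apply: maxe; apply/asboolP; exists W''.
Qed.

Lemma codim_bound (Z : set 'M[K]_(p, q)) M W :
  Z `<=` X -> irreducible_chain Z M W ->
  exists2 k, codim Z X k & (k + M < p * q)%N.
Proof.
move=> ZX chW.
have [e [[W1 ch1] max1] leMe] := krull_dim_exists ZX chW.
have [W2 ch2] := irreducible_chain_sub ZX ch1.
have [m [[W3 ch3] max3] leem] := krull_dim_exists (@subset_refl _ X) ch2.
exists (m - e)%N; last by have := irreducible_chain_bound ch3; lia.
exists e, m; split; [by split; first by exists W1|by split; first by exists W3|].
by rewrite subnKC.
Qed.
End DimensionBound.

(** * Leading terms of polynomials *)

Section Order.
Variable R : comNzRingType.
Implicit Types (p q : {poly R}) (m n : nat) (x y : R).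

Definition ord_ge n p := forall i, (i < n)%N -> p`_i = 0.
Definition starts n x p := ord_ge n p /\ p`_n = x.

Lemma ord_ge0 n : ord_ge n 0.
Proof. by move=> i _; rewrite coef0. Qed.
Lemma ord_geD n p q : ord_ge n p -> ord_ge n q -> ord_ge n (p + q).
Proof. by move=> hp hq i lt; rewrite coefD hp ?hq ?addr0. Qed.
Lemma ord_geN n p : ord_ge n p -> ord_ge n (- p).
Proof. by move=> hp i lt; rewrite coefN hp ?oppr0. Qed.
Lemma ord_geB n p q : ord_ge n p -> ord_ge n q -> ord_ge n (p - q).
Proof. by move=> hp hq; apply/ord_geD/ord_geN. Qed.
Lemma ord_geZ n x p : ord_ge n p -> ord_ge n (x *: p).
Proof. by move=> hp i lt; rewrite coefZ hp ?mulr0. Qed.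
Lemma ord_ge_sum n I (r : seq I) (P : pred I) (F : I -> {poly R}) :
  (forall i, P i -> ord_ge n (F i)) -> ord_ge n (\sum_(i <- r | P i) F i).
Proof. by move=> h; elim/big_rec: _ => [|i p Pi]; [exact: ord_ge0|apply/ord_geD/h]. Qed.
Lemma ord_ge_leq m n p : (m <= n)%N -> ord_ge n p -> ord_ge m p.
Proof. by move=> le hp i lt; apply/hp/(leq_trans lt). Qed.
Lemma ord_geM m n p q : ord_ge m p -> ord_ge n q -> ord_ge (m + n) (p * q).
Proof.
move=> hp hq i lt; rewrite coefM big1 // => j _.
have [ltj|lej] := ltnP j m; first by rewrite hp ?mul0r.
by rewrite hq ?mulr0 //; have := ltn_ord j; lia.
Qed.
Lemma ord_geMr n p q : ord_ge n p -> ord_ge n (p * q).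
Proof. by move=> hp; rewrite -[n]addn0; apply: ord_geM. Qed.
Lemma ord_geMl n p q : ord_ge n q -> ord_ge n (p * q).
Proof. by rewrite mulrC; apply: ord_geMr. Qed.

Lemma starts_ord n x p : starts n x p -> ord_ge n p.
Proof. by case. Qed.
Lemma starts_ordS n p : starts n 0 p -> ord_ge n.+1 p.
Proof. by case=> hp h0 i; rewrite ltnS leq_eqVlt => /predU1P[->|/hp]. Qed.
Lemma startsD n x y p q : starts n x p -> starts n y q -> starts n (x + y) (p + q).
Proof. by move=> [hp px] [hq qy]; split; [exact: ord_geD|rewrite coefD px qy]. Qed.
Lemma startsN n x p : starts n x p -> starts n (- x) (- p).
Proof. by move=> [hp px]; split; [exact: ord_geN|rewrite coefN px]. Qed.
Lemma startsB n x y p q : starts n x p -> starts n y q -> starts n (x - y) (p - q).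
Proof. by move=> hp hq; apply/startsD/startsN. Qed.
Lemma starts_subr n x p q : starts n x p -> starts n x q -> ord_ge n.+1 (p - q).
Proof. by move=> hp hq; apply: starts_ordS; rewrite -(subrr x); apply: startsB. Qed.
Lemma startsZ n x y p : starts n y p -> starts n (x * y) (x *: p).
Proof. by move=> [hp px]; split; [exact: ord_geZ|rewrite coefZ px]. Qed.
Lemma ord_ge_starts n p : ord_ge n.+1 p -> starts n 0 p.
Proof. by move=> hp; split; [exact: ord_ge_leq hp|exact: hp]. Qed.
Lemma startsD_ord n x p q : starts n x p -> ord_ge n.+1 q -> starts n x (p + q).
Proof. by move=> hp /ord_ge_starts hq; rewrite -[x]addr0; apply: startsD. Qed.

Lemma startsM m n x y p q : starts m x p -> starts n y q -> starts (m + n) (x * y) (p * q).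
Proof.
move=> [hp px] [hq qy]; split; first exact: ord_geM.
have ltm : (m < (m + n).+1)%N by rewrite ltnS leq_addr.
rewrite coefM (bigD1 (Ordinal ltm)) //= addKn px qy big1 ?addr0 // => j nej.
have {}nej : j != m :> nat by apply: contra nej => /eqP e; apply/eqP/val_inj.
have [ltj|lej] := ltnP j m; first by rewrite hp ?mul0r.
by rewrite hq ?mulr0 //; have := ltn_ord j; move/eqP: nej; lia.
Qed.

Lemma starts1M m n p q : starts m 1 p -> starts n 1 q -> starts (m + n) 1 (p * q).
Proof. by move=> hp hq; rewrite -[1]mulr1; apply: startsM. Qed.

Lemma starts_exp n p k : starts n 1 p -> starts (k * n) 1 (p ^+ k).
Proof.
move=> hp; elim: k => [|k IH]; first by split=> //; rewrite coef1.
by rewrite exprS mulSn -[1]mulr1; apply: startsM.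
Qed.

Lemma starts_Xn n : starts n 1 'X^n.
Proof. by split=> [i lt|]; rewrite coefXn ?eqxx // ltn_eqF. Qed.

(** The first order term of q^k - p^k is k p^(k-1) (q - p). *)
Lemma starts_perturb n i x p q k : (0 < i)%N -> starts n 1 p ->
  starts (n + i) x (q - p) -> starts (k * n + i) (k%:R * x) (q ^+ k - p ^+ k).
Proof.
move=> i0 hp hqp.
have hq : starts n 1 q.
  rewrite -[q](subrK p) addrC; apply: startsD_ord hp _.
  by apply: ord_ge_leq (starts_ord hqp); lia.
elim: k => [|k IH]; first by rewrite !expr0 subrr mul0r; split; [exact: ord_ge0|exact: coef0].
have -> : q ^+ k.+1 - p ^+ k.+1 = q * (q ^+ k - p ^+ k) + (q - p) * p ^+ k by rewrite !exprS;
  ring.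
have -> : k.+1%:R * x = 1 * (k%:R * x) + x * 1 by rewrite -natr1; ring.
rewrite mulSn -addnA; apply: startsD; first exact: startsM.
by rewrite [(k * n + i)%N]addnC addnA; apply: startsM => //; apply: starts_exp.
Qed.

End Order.

(** * Solving the two relations modulo the conductor *)

Section Relations.
Variables a b c : nat.
Hypotheses (a2 : (2 <= a)%N) (ltab : (a < b)%N) (ltbc : (b < c)%N).
Hypotheses (cab : coprime a b) (cac : coprime a c) (cbc : coprime b c).

Local Notation wt := (weight a b c).
Local Notation inS := (inS a b c).
Local Notation abc := (a * b * c)%N.
Local Notation C := (conductor a b c).

Lemma inS_normal_form n : inS n -> exists t : nat * nat * nat,
  [/\ (t.1.2 < b)%N, (t.2 < a)%N & n = wt t.1.1 t.1.2 t.2].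
Proof.
move=> /asboolP[i [j [k ->]]].
exists (i + j %/ b * c + k %/ a * c, j %% b, k %% a)%N => /=.
rewrite !ltn_mod; split; [lia|lia|].
rewrite /weight {1}(divn_eq j b) {1}(divn_eq k a).
ring.
Qed.

Definition normal_rep n : nat * nat * nat := xget (0, 0, 0)%N
  [set t | [/\ (t.1.2 < b)%N, (t.2 < a)%N & n = wt t.1.1 t.1.2 t.2]].

Lemma normal_repP n : inS n ->
  [/\ ((normal_rep n).1.2 < b)%N,
    ((normal_rep n).2 < a)%N & n = wt (normal_rep n).1.1 (normal_rep n).1.2 (normal_rep n).2].
Proof.
by move=> /inS_normal_form h; exact: (@xgetPex _ (0, 0, 0)%N [set t : nat * nat * nat |
  [/\ (t.1.2 < b)%N, (t.2 < a)%N & n = wt t.1.1 t.1.2 t.2]] h).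
Qed.

Lemma modular_inj m u j j' : coprime m u -> (j < m)%N -> (j' < m)%N ->
  (j * u = j' * u %[mod m])%N -> j = j'.
Proof.
move=> cop; wlog lejj' : j j' / (j <= j')%N => [H ltj ltj' e|].
  by case/orP: (leq_total j j') => le; [apply: H|apply/esym/H].
move=> ltj ltj' /esym/eqP; rewrite eqn_mod_dvd ?leq_mul2r ?lejj' ?orbT //.
rewrite -mulnBl Gauss_dvdl // => /dvdn_leq H.
by case: (posnP (j' - j)) => [|/H]; lia.
Qed.

(** The weight determines j modulo b and k modulo a. *)
Lemma weight_inj i j k i' j' k' : (j < b)%N -> (k < a)%N -> (j' < b)%N -> (k' < a)%N ->
  wt i j k = wt i' j' k' -> [/\ i = i', j = j' & k = k'].
Proof.
move=> ltj ltk ltj' ltk' e.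
have eb i1 j1 k1 : (wt i1 j1 k1 = j1 * (a * c) %[mod b])%N.
  by rewrite /weight (_ : _ + _ = (i1 * a + k1 * c) * b + j1 * (a * c))%N ?modnMDl //; ring.
have ea i1 j1 k1 : (wt i1 j1 k1 = k1 * (b * c) %[mod a])%N.
  by rewrite /weight (_ : _ + _ = (i1 * b + j1 * c) * a + k1 * (b * c))%N ?modnMDl //; ring.
have jE : j = j'.
  apply: (@modular_inj b (a * c)) => //; first by rewrite coprimeMr coprime_sym cab.
  by rewrite -(eb i j k) e eb.
have kE : k = k'.
  apply: (@modular_inj a (b * c)) => //; first by rewrite coprimeMr cab.
  by rewrite -(ea i j k) e ea.
split=> //; apply/eqP; rewrite -(@eqn_pmul2r (a * b)) ?muln_gt0; last lia.
by apply/eqP; move: e; rewrite jE kE /weight; lia.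
Qed.

Section Mono.
Variable R : comNzRingType.
Implicit Types (x y z p q f : {poly R}).

Definition mono n x y z := x ^+ (normal_rep n).1.1 * y ^+ (normal_rep n).1.2 * z ^+ (normal_rep
  n).2.

Lemma starts_monomial i j k x y z :
  starts (a * b) 1 x -> starts (a * c) 1 y -> starts (b * c) 1 z ->
  starts (wt i j k) 1 (x ^+ i * y ^+ j * z ^+ k).
Proof.
by move=> hx hy hz; do 2?[apply: starts1M]; apply: starts_exp.
Qed.

Lemma starts_mono n x y z : inS n ->
  starts (a * b) 1 x -> starts (a * c) 1 y -> starts (b * c) 1 z -> starts n 1 (mono n x y z).
Proof. by move=> /normal_repP[_ _ {1}->]; apply: starts_monomial. Qed.

(** If y and z change only from i orders above their leading terms on, then so does
every monomial. *)
Lemma mono_perturb n i x y z y' z' : inS n -> (0 < i)%N ->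
  starts (a * b) 1 x -> starts (a * c) 1 y -> starts (b * c) 1 z ->
  ord_ge (a * c + i) (y' - y) -> ord_ge (b * c + i) (z' - z) ->
  ord_ge (n + i) (mono n x y' z' - mono n x y z).
Proof.
move=> nS i0 hx hy hz dy dz; have [_ _ nE] := normal_repP nS; rewrite {1}nE /mono {nE}.
move: (normal_rep n).1.1 (normal_rep n).1.2 (normal_rep n).2 => r s t.
have sd m p q k : starts m 1 p -> ord_ge (m + i) (q - p) -> ord_ge (k * m + i) (q ^+ k - p ^+ k).
  move=> hp hqp; apply: (@starts_ord _ _ (k%:R * (q - p)`_(m + i))).
  by apply: starts_perturb.
have hz' : starts (b * c) 1 z'.
  rewrite -[z'](subrK z) addrC; apply: startsD_ord hz _.
  by apply: ord_ge_leq dz; lia.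
have -> : x ^+ r * y' ^+ s * z' ^+ t - x ^+ r * y ^+ s * z ^+ t =
   x ^+ r * ((y' ^+ s - y ^+ s) * z' ^+ t + y ^+ s * (z' ^+ t - z ^+ t)) by ring.
rewrite /weight -!addnA; apply: ord_geM; first exact: starts_ord (starts_exp _ hx).
apply: ord_geD.
  rewrite [(t * _ + i)%N]addnC addnA; apply: ord_geM; first exact: sd.
  exact: starts_ord (starts_exp _ hz').
by apply: ord_geM; [exact: starts_ord (starts_exp _ hy)|exact: sd].
Qed.

Definition tail m (e : nat -> R) x y z :=
  \sum_(n < m | (abc < n)%N && inS n) e n *: mono n x y z.

End Mono.

Section Support.
Variable R : comNzRingType.
Implicit Types p q : {poly R}.
Definition supported p := forall n, (n < C)%N -> ~~ inS n -> p`_n = 0.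

Lemma supportedD p q : supported p -> supported q -> supported (p + q).
Proof. by move=> hp hq n lt nS; rewrite coefD hp ?hq ?addr0. Qed.
Lemma supportedN p : supported p -> supported (- p).
Proof. by move=> hp n lt nS; rewrite coefN hp ?oppr0. Qed.
Lemma supportedZ k p : supported p -> supported (k *: p).
Proof. by move=> hp n lt nS; rewrite coefZ hp ?mulr0. Qed.
Lemma supported_sum I (r : seq I) (P : pred I) (F : I -> {poly R}) :
  (forall i, P i -> supported (F i)) -> supported (\sum_(i <- r | P i) F i).
Proof.
by move=> h; elim/big_rec: _ => [n _ _|i p Pi]; [rewrite coef0|apply/supportedD/h].
Qed.
Lemma supportedM p q : supported p -> supported q -> supported (p * q).
Proof.
move=> hp hq n lt nS; rewrite coefM big1 // => j _.
have lej : (j <= n)%N by rewrite -ltnS.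
have [jS|jS] := boolP (inS j); last by rewrite hp ?mul0r // (leq_ltn_trans lej).
have [kS|kS] := boolP (inS (n - j)); last by rewrite hq ?mulr0 // (leq_ltn_trans (leq_subr _ _)).
by case/negP: nS; rewrite -(subnKC lej) inSD.
Qed.
Lemma inS0 : inS 0.
Proof. by apply/asboolP; exists 0%N, 0%N, 0%N. Qed.
Lemma supported_exp p k : supported p -> supported (p ^+ k).
Proof.
move=> hp; elim: k => [n _|k IH]; last by rewrite exprS; apply: supportedM.
by rewrite expr0 coef1; case: n => // /negP[]; apply: inS0.
Qed.
Lemma supported_mono n x y z : supported x -> supported y -> supported z ->
  supported (mono n x y z).
Proof. by move=> hx hy hz; do ![apply: supportedM]; apply: supported_exp. Qed.
End Support.

Section Solve.
Variables (R R' : comNzRingType) (ev : {rmorphism R -> R'}).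
Variables (phi f1 f2 f3 : {poly R}) (ia ib : R).
Hypotheses (aia : a%:R * ia = 1) (bib : b%:R * ib = 1).
Hypotheses (h0 : starts 0 1 phi) (h1 : starts (a * b) 1 f1).
Hypotheses (h2 : starts (a * c) 1 f2) (h3 : starts (b * c) 1 f3).
Hypothesis s1 : supported (map_poly ev (phi * f1)).
Hypothesis s2 : supported (map_poly ev (phi * f2)).
Hypothesis s3 : supported (map_poly ev (phi * f3)).

Local Notation x := (phi * f1).

(** With p = y and u = b, or p = z and u = a, this is what remains of one of the
two relations once the tail has been subtracted. *)
Definition defect u m (e : nat -> R) p y z := x ^+ c - p ^+ u - tail m e x y z.

Lemma tail_recr m (e : nat -> R) y z : tail m.+1 e x y z =
  tail m e x y z + (if (abc < m)%N && inS m then e m *: mono m x y z else 0).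
Proof. by rewrite /tail big_mkcond big_ord_recr -big_mkcond. Qed.

Lemma eq_tail m (e e' : nat -> R) y z : (forall n, (n < m)%N -> e n = e' n) ->
  tail m e x y z = tail m e' x y z.
Proof. by move=> ee; apply: eq_bigr => i _; rewrite ee. Qed.

Lemma tail_perturb m e y z y' z' : (abc < m)%N ->
  starts (a * c) 1 y -> starts (b * c) 1 z ->
  ord_ge (a * c + (m - abc)) (y' - y) -> ord_ge (b * c + (m - abc)) (z' - z) ->
  ord_ge m.+1 (tail m e x y' z' - tail m e x y z).
Proof.
move=> ltm hy hz dy dz; rewrite /tail -sumrB; apply: ord_ge_sum => n /andP[ltn nS].
rewrite -scalerBr; apply: ord_geZ; apply: (@ord_ge_leq _ _ (n + (m - abc))); first lia.
apply: mono_perturb => //; first lia.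
by rewrite -[X in starts X]add0n; apply: starts1M.
Qed.

Lemma supported_map_defect u m e p y z :
  supported (map_poly ev p) -> supported (map_poly ev y) -> supported (map_poly ev z) ->
  supported (map_poly ev (defect u m e p y z)).
Proof.
move=> hp hy hz; rewrite /defect !rmorphB !rmorphXn /= rmorph_sum /=.
apply: supportedD; last first.
  apply: supportedN; apply: supported_sum => n _; rewrite map_polyZ; apply: supportedZ.
  by rewrite /mono !rmorphM !rmorphXn /=; apply: supported_mono.
by apply: supportedD; [|apply: supportedN]; apply: supported_exp.
Qed.

(** Under [ev], the new series [f'] cannot be told from [f]; so solving the
relations does not move the base point, at which [ev] evaluates. *)
Definition adjusts w f f' := [/\ starts w 1 f', map_poly ev f' = map_poly ev f &
  forall j, f'`_j != f`_j -> exists2 n, n \in high_gaps a b c & (j + abc = n + w)%N].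

(** The correction of f' by (d / u) t^(w + m - abc) changes (phi f')^u by d t^m
plus higher terms.  It is killed by [ev] since d is the coefficient at a gap of
a series which is supported on S after [ev] is applied. *)
Lemma adjusts_step w u m (f f' D : {poly R}) iu :
  u%:R * iu = 1 -> (u * w = abc)%N -> (abc < m)%N -> ~~ inS m -> adjusts w f f' ->
  supported (map_poly ev D) ->
  let d := D`_m in let g := f' + (iu * d) *: 'X^(w + (m - abc)) in
  [/\ adjusts w f g, starts (w + (m - abc)) (iu * d) (phi * g - phi * f') &
      starts m d ((phi * g) ^+ u - (phi * f') ^+ u)].
Proof.
move=> uiu uw ltm mS [hf' evf' adj] hD d g.
have ltC : (m < C)%N.
  by rewrite ltnS leqNgt; apply: contra mS; apply: inS_large.
have hd : starts (w + (m - abc)) (iu * d) (phi * g - phi * f').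
  rewrite -mulrBr /g addrC addKr -[X in starts X]add0n -[X in starts _ X]mul1r.
  by apply: startsM => //; rewrite -[X in starts _ X]mulr1; apply/startsZ/starts_Xn.
split=> //.
- split.
  + apply: startsD_ord hf' _; apply: ord_geZ.
    by apply: ord_ge_leq (starts_ord (starts_Xn _ _)); lia.
  + rewrite /g rmorphD /= map_polyZ rmorphM /=.
    have -> : ev d = 0 by rewrite -coef_map hD.
    by rewrite mulr0 scale0r addr0.
  + move=> j; rewrite /g coefD coefZ coefXn; case: (j =P (w + (m - abc))%N) => [->|_]; last first.
      by rewrite mulr0 addr0; apply: adj.
    move=> _; exists m; last by lia.
    by rewrite !mem_filter ltm mS mem_iota.
- have -> : m = (u * w + (m - abc))%N by lia.
  have -> : d = u%:R * (iu * d) by rewrite mulrA uiu mul1r.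
  apply: starts_perturb => //; first lia.
  by rewrite -[w]add0n; apply: starts1M.
Qed.

(** Induction on m, removing the coefficients of t^m from both defects.  If m is in
S, a new term of the tail does so.  If m is a gap, f2 and f3 are corrected: the
power y^b (or z^a) changes by the wanted term, while all monomials of the tails,
  whose orders exceed abc, change
in degrees beyond m. *)
Lemma solve_relations m : (abc < m)%N -> exists f2' f3' e e',
  [/\ adjusts (a * c) f2 f2', adjusts (b * c) f3 f3',
      ord_ge m (defect b m e (phi * f2') (phi * f2') (phi * f3')) &
      ord_ge m (defect a m e' (phi * f3') (phi * f2') (phi * f3'))].
Proof.
have adj0 w f : starts w 1 f -> adjusts w f f by split=> // j; rewrite eqxx.
have hx : starts (a * b) 1 x by rewrite -[X in starts X]add0n; apply: starts1M.
elim: m => // m IH; rewrite ltnS leq_eqVlt => /predU1P[<-{m IH}|ltm].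
  exists f2, f3, (fun=> 0), (fun=> 0).
  have base u w f : starts w 1 f -> (u * w = abc)%N ->
      ord_ge abc.+1 (defect u abc.+1 (fun=> 0) (phi * f) (phi * f2) (phi * f3)).
    move=> hf uw; rewrite /defect /tail big1 ?subr0 => [|n /andP[]]; last by have := ltn_ord n;
      lia.
    apply: (@starts_subr _ _ 1).
      by rewrite mulnC; apply: starts_exp.
    by rewrite -uw; apply: starts_exp; rewrite -[w]add0n; apply: starts1M.
  by split; [exact: adj0|exact: adj0|apply: base h2 _; ring|apply: base h3 _; ring].
have [f2' [f3' [e [e' [adj2 adj3 D2 D3]]]]] := IH ltm.
have [h2' ev2 _] := adj2; have [h3' ev3 _] := adj3.
set y := phi * f2' in D2 D3; set z := phi * f3' in D2 D3.
have hy : starts (a * c) 1 y by rewrite -[X in starts X]add0n; apply: starts1M.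
have hz : starts (b * c) 1 z by rewrite -[X in starts X]add0n; apply: starts1M.
have [mS|mS] := boolP (inS m).
  pose upd (e : nat -> R) (d : R) n := if n == m then d else e n.
  exists f2', f3', (upd e (defect b m e y y z)`_m), (upd e' (defect a m e' z y z)`_m).
  have step u (e1 : nat -> R) p : ord_ge m (defect u m e1 p y z) ->
      ord_ge m.+1 (defect u m.+1 (upd e1 (defect u m e1 p y z)`_m) p y z).
    set d := _`_m => D.
    have -> : defect u m.+1 (upd e1 d) p y z = defect u m e1 p y z - d *: mono m x y z.
      rewrite /defect tail_recr ltm mS /= {2}/upd eqxx (@eq_tail _ _ e1) ?opprD ?addrA //.
      by move=> n ltn; rewrite /upd ltn_eqF.
    apply: (@starts_subr _ _ d); first by split.
    by rewrite -[X in starts _ X]mulr1; apply/startsZ/starts_mono.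
  by split=> //; apply: step.
have sy : supported (map_poly ev y) by rewrite rmorphM /= ev2 -rmorphM.
have sz : supported (map_poly ev z) by rewrite rmorphM /= ev3 -rmorphM.
have := adjusts_step bib (_ : b * (a * c) =
  abc)%N ltm mS adj2 (supported_map_defect b m e sy sy sz).
have := adjusts_step aia (_ : a * (b * c) =
  abc)%N ltm mS adj3 (supported_map_defect a m e' sz sy sz).
set d' := (defect a m e' z y z)`_m; set d := (defect b m e y y z)`_m.
move=> /(_ ltac:(ring))[adj3' dz dza] /(_ ltac:(ring))[adj2' dy dyb].
set g2 := f2' + _ in adj2' dy dyb; set g3 := f3' + _ in adj3' dz dza.
exists g2, g3, e, e'.
have step u (e1 : nat -> R) p p' : ord_ge m (defect u m e1 p y z) ->
    starts m (defect u m e1 p y z)`_m (p' ^+ u - p ^+ u) ->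
    ord_ge m.+1 (defect u m.+1 e1 p' (phi * g2) (phi * g3)).
  move=> D dp; rewrite /defect tail_recr (negPf mS) andbF addr0.
  have -> : x ^+ c - p' ^+ u - tail m e1 x (phi * g2) (phi * g3) =
     defect u m e1 p y z - (p' ^+ u - p ^+ u) -
      (tail m e1 x (phi * g2) (phi * g3) - tail m e1 x y z) by rewrite /defect; ring.
  apply: ord_geB; last by apply: tail_perturb => //; apply: starts_ord; eassumption.
  by apply: (@starts_subr _ _ (defect u m e1 p y z)`_m).
by split=> //; [apply: step D2 dyb|apply: step D3 dza].
Qed.

End Solve.

Section Span.
Variable R : comNzRingType.
Variables (x y z : {poly R}) (ey ez : nat -> R).
Hypotheses (hx : starts (a * b) 1 x) (hy : starts (a * c) 1 y) (hz : starts (b * c) 1 z).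
Hypothesis rely : ord_ge C (x ^+ c - y ^+ b - tail C ey x y z).
Hypothesis relz : ord_ge C (x ^+ c - z ^+ a - tail C ez x y z).

Definition spanned q := exists e : nat -> R,
  ord_ge C (q - \sum_(n < C | inS n) e n *: mono n x y z).

Lemma spanned_ord q : ord_ge C q -> spanned q.
Proof.
move=> hq; exists (fun=> 0); rewrite big1 ?subr0 // => n _.
by rewrite scale0r.
Qed.

Lemma spannedD p q : spanned p -> spanned q -> spanned (p + q).
Proof.
move=> [e he] [e' he']; exists (fun n => e n + e' n).
rewrite (eq_bigr (fun n : 'I_C => e n *: mono n x y z + e' n *: mono n x y z)) => [|n _];
  last by rewrite scalerDl.
by rewrite big_split /= opprD addrACA; apply: ord_geD.
Qed.

Lemma spannedZ k q : spanned q -> spanned (k *: q).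
Proof.
move=> [e he]; exists (fun n => k * e n).
rewrite (eq_bigr (fun n : 'I_C => k *: (e n *: mono n x y z))) => [|n _]; last by rewrite scalerA.
by rewrite -scaler_sumr -scalerBr; apply: ord_geZ.
Qed.

Lemma spanned_sum I (r : seq I) (P : pred I) (F : I -> {poly R}) :
  (forall i, P i -> spanned (F i)) -> spanned (\sum_(i <- r | P i) F i).
Proof.
by move=> h; elim/big_rec: _ => [|i p Pi]; [exact/spanned_ord/ord_ge0|apply/spannedD/h].
Qed.

Lemma spanned_ord_eq p q : ord_ge C (p - q) -> spanned q -> spanned p.
Proof. by move=> h hq; rewrite -[p](subrK q); apply: spannedD => //; apply: spanned_ord. Qed.

Lemma spanned_mono n : inS n -> spanned (mono n x y z).
Proof.
move=> nS; have [leC|ltC] := leqP C n.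
  by apply/spanned_ord/(ord_ge_leq leC)/starts_ord/starts_mono.
exists (fun m => (m == n)%:R); rewrite (bigD1 (Ordinal ltC)) //= eqxx scale1r.
rewrite big1 ?addr0 ?subrr; first exact: ord_ge0.
by move=> i /andP[_ nei]; rewrite (_ : (i == n :> nat) = false) ?scale0r //; apply: contraNF nei.
Qed.

(** A factor y^b is replaced by x^c minus the tail, and likewise z^a.  The first
term has the same weight and smaller j + k; the other terms have larger weight,
and nothing is left once the weight reaches the conductor. *)
Lemma spanned_monomial i j k : spanned (x ^+ i * y ^+ j * z ^+ k).
Proof.
(* Induction on C - weight, then on j + k. *)
move: {2}(C - wt i j k)%N (leqnn (C - wt i j k)) => w.
elim/ltn_ind: w i j k => w IHw i j k.
move: {2}(j + k)%N (leqnn (j + k)) => v; elim/ltn_ind: v i j k => v IHv i j k lev lew.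
have [leC|ltC] := leqP C (wt i j k).
  by apply/spanned_ord/(ord_ge_leq leC)/starts_ord/starts_monomial.
have reduce (p : {poly R}) (e : nat -> R) i' j' k' :
    ord_ge C (x ^+ c - p - tail C e x y z) ->
    (wt (i' + c) j' k' = wt i j k)%N -> (j' + k' < j + k)%N ->
    spanned (p * (x ^+ i' * y ^+ j' * z ^+ k')).
  set M := _ * z ^+ k' => rel wtE lt.
  apply: (@spanned_ord_eq _ (x ^+ c * M - tail C e x y z * M)).
    have -> : p * M - (x ^+ c * M - tail C e x y z * M) =
      - ((x ^+ c - p - tail C e x y z) * M) by ring.
    by apply/ord_geN/ord_geMr.
  apply: spannedD.
    rewrite (_ : x ^+ c * M = x ^+ (i' + c) * y ^+ j' * z ^+ k'); last by rewrite /M exprD; ring.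
    by apply: (IHv (j' + k')%N (leq_trans lt lev)); rewrite ?wtE.
  rewrite -scaleN1r; apply: spannedZ; rewrite mulr_suml; apply: spanned_sum => n /andP[ltn nS].
  rewrite -scalerAl; apply: spannedZ.
  have [_ _ nE] := normal_repP nS.
  rewrite (_ : mono n x y z * M = x ^+ ((normal_rep n).1.1 + i') * y ^+ ((normal_rep n).1.2 +
    j') * z ^+ ((normal_rep n).2 + k')); last by rewrite /M /mono !exprD; ring.
  apply: (IHw _ _ _ _ _ (leqnn _)).
  suff : (wt i j k < wt ((normal_rep n).1.1 + i') ((normal_rep n).1.2 + j') ((normal_rep n).2 +
    k'))%N by lia.
  have -> : (wt ((normal_rep n).1.1 + i') ((normal_rep n).1.2 + j') ((normal_rep n).2 + k') =
    n + wt i' j' k')%N.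
    transitivity (wt (normal_rep n).1.1 (normal_rep n).1.2 (normal_rep n).2 + wt i' j' k')%N;
      last by rewrite -nE.
    by rewrite /weight; ring.
  by rewrite -wtE /weight mulnDl; lia.
have [leb|ltb] := leqP b j.
  rewrite (_ : _ * z ^+ k = y ^+ b * (x ^+ i * y ^+ (j - b) * z ^+ k)).
    apply: (reduce _ ey) => //; last by lia.
    by rewrite /weight mulnDl mulnBl; nia.
  by rewrite -[in LHS](subnKC leb) exprD; ring.
have [lea|lta] := leqP a k.
  rewrite (_ : _ * z ^+ k = z ^+ a * (x ^+ i * y ^+ j * z ^+ (k - a))).
    apply: (reduce _ ez) => //; last by lia.
    by rewrite /weight mulnDl mulnBl; nia.
  by rewrite -[in LHS](subnKC lea) exprD; ring.
have [n nE] : exists n, n = wt i j k by exists (wt i j k).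
have nS : inS n by rewrite nE; apply: inS_weight.
have [ltb' lta' nE'] := normal_repP nS.
have [-> -> ->] := weight_inj ltb lta ltb' lta' (etrans (esym nE) nE').
exact: spanned_mono.
Qed.

(** The monomials in normal form have distinct orders, all in S, so no
cancellation of leading terms occurs in a combination of them. *)
Lemma spanned_starts q n k : spanned q -> starts n k q -> k != 0 -> (n < C)%N -> inS n.
Proof.
move=> [e he] [hq qn] nzk ltC.
have coefq m : (m < C)%N -> q`_m = (\sum_(n < C | inS n) e n *: mono n x y z)`_m.
  by move=> lt; apply/eqP; rewrite -subr_eq0 -coefB he.
have e0 m : (m < n)%N -> inS m -> e m = 0.
  elim/ltn_ind: m => m IH ltmn mS; have ltmC := ltn_trans ltmn ltC.
  have := hq _ ltmn; rewrite coefq // (bigD1 (Ordinal ltmC)) //= coefD coefZ.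
  have [_ ->] := starts_mono mS hx hy hz;
    rewrite mulr1 coef_sum big1 ?addr0 // => i /andP[iS nei].
  rewrite coefZ; have [lti|lei] := ltnP i m; first by rewrite IH ?mul0r // (ltn_trans lti).
  have [vi _] := starts_mono iS hx hy hz; rewrite vi ?mulr0 // ltn_neqAle lei andbT eq_sym.
  by apply: contra nei => /eqP e'; apply/eqP/val_inj.
apply: contraNT nzk => nS; rewrite -qn coefq // coef_sum big1 // => i iS; rewrite coefZ.
have [lti|lei] := ltnP i n; first by rewrite e0 ?mul0r.
have [vi _] := starts_mono iS hx hy hz; rewrite vi ?mulr0 // ltn_neqAle lei andbT.
by apply: contraNneq nS => ->.
Qed.
End Span.
End Relations.

(** * Forms on the curve as polynomials in one variable *)

Lemma rmorph_mmap (K S S' : comNzRingType) n (f : {rmorphism K -> S})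
    (f' : {rmorphism K -> S'}) (h : 'I_n -> S) (g : {rmorphism S -> S'}) (F : {mpoly K[n]}) :
  (forall c, g (f c) = f' c) -> g (mmap f h F) = mmap f' (fun i => g (h i)) F.
Proof.
move=> gf; rewrite /mmap rmorph_sum; apply: eq_bigr => m _.
rewrite rmorphM /= gf; congr (_ * _); rewrite /mmap1 rmorph_prod.
by apply: eq_bigr => i _; rewrite rmorphXn.
Qed.
Arguments rmorph_mmap {K S S' n f} f' {h} g F.

Lemma size_mul_bound (K : nzRingType) (p q : {poly K}) s t :
  (size p <= s.+1 -> size q <= t.+1 -> size (p * q)%R <= (s + t).+1)%N.
Proof.
move=> szp szq; apply: leq_trans (size_polyMleq _ _) _.
by move: (size p) (size q) szp szq => u v; lia.
Qed.

Section Dehomogenize.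
Variable K : fieldType.
Implicit Types (H : {mpoly K[2]}) (p q : {poly K}).

Definition dehom H : {poly K} := mmap polyC (fun i : 'I_2 => if i == 0 then 1 else 'X) H.
HB.instance Definition _ := GRing.RMorphism.copy dehom dehom.

Definition hom N p : {mpoly K[2]} := \sum_(j < N.+1) p`_j *: ('X_0 ^+ (N - j) * 'X_1 ^+ j).

Lemma dehomZ k H : dehom (k *: H) = k *: dehom H.
Proof. by rewrite /dehom mmapZ mul_polyC. Qed.

Lemma dehomX0 : dehom 'X_0 = 1.
Proof. by rewrite /dehom mmapX mmap1U. Qed.
Lemma dehomX1 : dehom 'X_1 = 'X.
Proof. by rewrite /dehom mmapX mmap1U. Qed.

Lemma dehom_hom N p : (size p <= N.+1)%N -> dehom (hom N p) = p.
Proof.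
move=> szp; rewrite /hom rmorph_sum /=.
transitivity (\poly_(j < N.+1) p`_j); last first.
  apply/polyP => j; rewrite coef_poly; case: ltnP => // le.
  by rewrite nth_default // (leq_trans szp).
rewrite poly_def.
apply: eq_bigr => j _; rewrite dehomZ rmorphM !rmorphXn /= dehomX0 dehomX1.
by rewrite expr1n mul1r.
Qed.

Lemma homXn (i : 'I_2) k : ('X_i ^+ k : {mpoly K[2]}) \is k.-homog.
Proof.
have h : 'X_i \is [in K[2], 1.-homog] by rewrite dhomogX /= mdeg1.
by have := dhomogMn k h; rewrite mul1n.
Qed.

Lemma hom_homog N p : hom N p \is N.-homog.
Proof.
apply: rpred_sum => j _; apply: rpredZ.
by have := dhomogM (homXn 0 (N - j)%N) (homXn 1 j); rewrite subnK // -ltnS.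
Qed.

Lemma hom0 N : hom N 0 = 0.
Proof. by rewrite /hom big1 // => j _; rewrite coef0 scale0r. Qed.
Lemma homD N p q : hom N (p + q) = hom N p + hom N q.
Proof.
by rewrite /hom -big_split /=; apply: eq_bigr => j _; rewrite coefD scalerDl.
Qed.
Lemma homZ N k p : hom N (k *: p) = k *: hom N p.
Proof.
by rewrite /hom scaler_sumr; apply: eq_bigr => j _; rewrite coefZ scalerA.
Qed.

Lemma hom_dehom N H : H \is N.-homog -> hom N (dehom H) = H.
Proof.
move=> /dhomogP hH; rewrite [H in RHS]mpolyE [H in LHS]mpolyE rmorph_sum /=.
rewrite (big_morph (hom N) (homD N) (hom0 N)) big_seq [RHS]big_seq; apply: eq_bigr => m mH.
have degm : (m 0%R + m 1%R)%N = N by rewrite -(hH _ mH) /= mdegE !big_ord_recl big_ord0 /=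
  addn0; congr (_ + m _)%N; apply: val_inj.
rewrite dehomZ homZ; congr (_ *: _).
have mE : 'X_[m] = 'X_0 ^+ m 0 * 'X_1 ^+ m 1 :> {mpoly K[2]}.
  rewrite mpolyXE_id !big_ord_recl big_ord0 mulr1 /=; congr (_ * _).
  by congr ('X_ _ ^+ m _); apply: val_inj.
rewrite mE rmorphM !rmorphXn /= dehomX0 dehomX1 expr1n mul1r.
have lt : (m 1%R < N.+1)%N by rewrite -degm ltnS leq_addl.
rewrite /hom (bigD1 (Ordinal lt)) //= coefXn eqxx scale1r big1 ?addr0; last first.
  by move=> j nej; rewrite coefXn (_ : (j == m 1%R :> nat) = false) ?scale0r //;
    apply: contraNF nej.
by rewrite -degm addnK.
Qed.

Lemma dehom_inj N H1 H2 : H1 \is N.-homog -> H2 \is N.-homog -> dehom H1 = dehom H2 -> H1 = H2.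
Proof. by move=> h1 h2 e; rewrite -(hom_dehom h1) e hom_dehom. Qed.

Lemma meval_hom N p (v : 'I_2 -> K) : (hom N p).@[v] =
  \sum_(j < N.+1) p`_j * (v 0 ^+ (N - j) * v 1 ^+ j).
Proof.
rewrite /hom raddf_sum; apply: eq_bigr => j _ /=.
by rewrite mevalZ mevalM !rmorphXn /= !mevalXU.
Qed.

Lemma meval_hom_Xn N n (v : 'I_2 -> K) : (n <= N)%N ->
  (hom N 'X^n).@[v] = v 0 ^+ (N - n) * v 1 ^+ n.
Proof.
rewrite -ltnS => lt; rewrite meval_hom (bigD1 (Ordinal lt)) //= coefXn eqxx mul1r.
rewrite big1 ?addr0 // => j nej; rewrite coefXn (_ : (j == n :> nat) = false) ?mul0r //.
by apply: contraNF nej.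
Qed.

End Dehomogenize.

Section Rows.
Variables (K : numClosedFieldType) (d : nat).
Variable A : 'M[K]_(4, d.+1).
Implicit Types (F G : {mpoly K[4]}) (p q : {poly K}) (m n : nat).

Definition rowpoly i : {poly K} := \sum_(j < d.+1) A i j *: 'X^j.

Lemma coef_rowpoly i j : (rowpoly i)`_j = if insub j is Some j' then A i j' else 0.
Proof.
rewrite /rowpoly coef_sum; case: insubP => [j' _ <-|nlt].
  rewrite (bigD1 j') //= coefZ coefXn eqxx mulr1 big1 ?addr0 // => k nek.
  rewrite coefZ coefXn (_ : (j' == k :> nat) = false) ?mulr0 //.
  by apply: contraNF nek => /eqP e; apply/eqP/val_inj.
rewrite big1 // => k _; rewrite coefZ coefXn (_ : (j == k :> nat) = false) ?mulr0 //.
by apply: contraNF nlt => /eqP->.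
Qed.

Lemma size_rowpoly i : (size (rowpoly i) <= d.+1)%N.
Proof.
apply/leq_sizeP => j le; rewrite coef_rowpoly insubF //.
by apply/negbTE; rewrite -leqNgt.
Qed.

Lemma binary_formE i : binary_form A i = hom d (rowpoly i).
Proof.
apply: eq_bigr => j _; rewrite coef_rowpoly; case: insubP => [j' _ e|]; last by rewrite ltn_ord.
by rewrite (val_inj e).
Qed.

Definition subst F : {poly K} := mmap polyC rowpoly F.
HB.instance Definition _ := GRing.RMorphism.copy subst subst.

Lemma substZ k F : subst (k *: F) = k *: subst F.
Proof. by rewrite /subst mmapZ mul_polyC. Qed.
Lemma substX i : subst 'X_i = rowpoly i.
Proof. by rewrite /subst mmapX mmap1U. Qed.

Lemma dehom_pullback F : dehom (pullback A F) = subst F.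
Proof.
rewrite /pullback /comp_mpoly (rmorph_mmap polyC (@dehom K)) => [|c]; last first.
  exact: mmapC.
apply: eq_bigr => m _; congr (_ * _); apply: eq_bigr => i _; congr (_ ^+ _).
by rewrite tnth_mktuple binary_formE; exact: dehom_hom (size_rowpoly _).
Qed.

Lemma pullback_homog k F : F \is k.-homog -> pullback A F \is (k * d).-homog.
Proof.
move=> /dhomogP hF; rewrite /pullback comp_mpolyEX big_seq; apply: rpred_sum => m mF.
apply: rpredZ; rewrite comp_mpolyX -(hF _ mF) /= mdegE.
elim/big_rec2: _ => [|i s H _ hH]; first exact: dhomog1.
rewrite mulnDl; apply: dhomogM hH; rewrite mulnC; apply: dhomogMn.
by rewrite tnth_mktuple binary_formE hom_homog.
Qed.

(** The forms on the curve are thus handled through the polynomials in t obtained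
by substituting the rows. *)
Lemma pullbackE k F : F \is k.-homog -> pullback A F = hom (k * d) (subst F).
Proof. by move=> hF; rewrite -dehom_pullback hom_dehom // pullback_homog. Qed.

Lemma size_subst k F : F \is k.-homog -> (size (subst F) <= (k * d).+1)%N.
Proof.
move=> /dhomogP hF; rewrite /subst /mmap big_seq; elim/big_rec: _ => [|m p mF le];
  first by rewrite size_poly0.
apply: leq_trans (size_polyD _ _) _; rewrite geq_max le andbT mul_polyC.
apply: leq_trans (size_scale_leq _ _) _; rewrite -(hF _ mF) /= mdegE /mmap1.
elim/big_rec2: _ => [|i s q _ IH]; first by rewrite size_poly1.
have szX : (size (rowpoly i ^+ m i) <= (m i * d).+1)%N.
  apply: leq_trans (size_poly_exp_leq _ _) _; rewrite ltnS mulnC leq_mul2l.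
  by apply/orP; right; have := size_rowpoly i; case: (size _).
by rewrite mulnDl; apply: size_mul_bound.
Qed.

Lemma meval_map_eval F P : F.@[map_eval A P 0] = (pullback A F).@[P 0].
Proof.
rewrite /pullback comp_mpoly_meval; apply: meval_eq => i.
by rewrite tnth_mktuple mxE.
Qed.

Definition attained m q := exists2 F, F \is m.-homog & subst F = q.

Lemma attainedD m p q : attained m p -> attained m q -> attained m (p + q).
Proof. by move=> [F hF <-] [G hG <-]; exists (F + G); rewrite ?rmorphD // rpredD. Qed.
Lemma attained0 m : attained m 0.
Proof. by exists 0; rewrite ?rmorph0 // rpred0. Qed.
Lemma attainedZ m k p : attained m p -> attained m (k *: p).
Proof. by move=> [F hF <-]; exists (k *: F); rewrite ?substZ // rpredZ. Qed.
Lemma attained_sum m I (r : seq I) (P : pred I) (f : I -> {poly K}) :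
  (forall i, P i -> attained m (f i)) -> attained m (\sum_(i <- r | P i) f i).
Proof. by move=> h; elim/big_rec: _ => [|i p Pi]; [exact: attained0|apply/attainedD/h]. Qed.
Lemma attainedB m p q : attained m p -> attained m q -> attained m (p - q).
Proof. by move=> hp hq; rewrite -scaleN1r; apply/attainedD/attainedZ. Qed.
Lemma attainedM m n p q : attained m p -> attained n q -> attained (m + n) (p * q).
Proof. by move=> [F hF <-] [G hG <-]; exists (F * G); rewrite ?rmorphM // dhomogM. Qed.
Lemma attained1 : attained 0 1.
Proof. by exists 1; rewrite ?rmorph1 // dhomog1. Qed.
Lemma attained_exp m k p : attained m p -> attained (k * m) (p ^+ k).
Proof.
move=> hp; elim: k => [|k IH]; first exact: attained1.
by rewrite exprS mulSn; apply: attainedM.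
Qed.
Lemma attained_row i : attained 1 (rowpoly i).
Proof. by exists 'X_i; rewrite ?substX // dhomogX /= mdeg1. Qed.
Lemma attained_size m p : attained m p -> (size p <= (m * d).+1)%N.
Proof. by move=> [F hF <-]; apply: size_subst. Qed.

End Rows.

(** * Orders of vanishing at the cusp *)

Definition i1 : 'I_4 := @Ordinal 4 1 isT.
Definition i2 : 'I_4 := @Ordinal 4 2 isT.
Definition i3 : 'I_4 := @Ordinal 4 3 isT.

Section Origin.
Variable K : numClosedFieldType.

Definition origin : 'rV[K]_2 := \row_(j < 2) (j == 0)%:R.

Lemma origin0 : origin 0 0 = 1. Proof. by rewrite mxE. Qed.
Lemma origin1 : origin 0 1 = 0. Proof. by rewrite mxE. Qed.
Lemma origin_neq0 : origin != 0.
Proof. by apply/rV0Pn; exists 0; rewrite origin0 oner_neq0. Qed.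

Lemma line_form_origin : line_form origin = - 'X_1.
Proof. by rewrite /line_form origin0 origin1 scale0r scale1r sub0r. Qed.

Lemma dehom_coef0 (H : {mpoly K[2]}) : (dehom H)`_0 = H.@[origin 0].
Proof.
rewrite -horner_coef0 -horner_evalE /dehom (meval_mmap (horner_eval 0)); last first.
  by move=> k; exact: hornerC.
apply: meval_eq => i; rewrite mxE -[LHS]/((if i == 0 then 1 else 'X).[0]).
by case: eqP => _; rewrite ?hornerX ?hornerC.
Qed.

Lemma vanishing_order_starts (H : {mpoly K[2]}) k :
  vanishing_order origin H k -> exists2 x, x != 0 & starts k x (dehom H).
Proof.
move=> [G -> nz]; exists ((-1) ^+ k * G.@[origin 0]); first by rewrite mulf_neq0 ?signr_eq0.
rewrite rmorphM rmorphXn /= line_form_origin rmorphN /= dehomX1 -[X in starts X]addn0.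
apply: startsM; last by split=> //; rewrite dehom_coef0.
by rewrite -scaleN1r exprZn -[X in starts _ X]mulr1; apply/startsZ/starts_Xn.
Qed.

Lemma starts_vanishing_order N (H : {mpoly K[2]}) k x :
  H \is N.-homog -> (size (dehom H) <= N.+1)%N -> x != 0 -> starts k x (dehom H) ->
  vanishing_order origin H k.
Proof.
move=> hH szH nzx [ordk coefk].
have lek : (k <= N)%N.
  rewrite leqNgt; apply: contra nzx => lt; rewrite -coefk nth_default //.
  exact: leq_trans szH lt.
pose r := drop_poly k (dehom H).
have szr : (size r <= (N - k).+1)%N by rewrite size_drop_poly -subSn // leq_sub2r.
exists ((-1) ^+ k *: hom (N - k) r); last first.
  by rewrite mevalZ -dehom_coef0 dehom_hom // coef_drop_poly add0n coefk mulf_neq0 ?signr_eq0.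
rewrite line_form_origin -scaleN1r exprZn -scalerAl -scalerAr scalerA -expr2 sqrr_sign scale1r.
apply: (dehom_inj hH); first by have := dhomogM (homXn K 1 k) (hom_homog (N - k) r);
  rewrite subnKC.
rewrite rmorphM rmorphXn /= dehomX1 dehom_hom // mulrC -[LHS](poly_take_drop k).
rewrite (_ : take_poly k _ = 0) ?add0r //.
by apply/polyP => i; rewrite coef_take_poly coef0; case: ltnP => // /ordk.
Qed.

End Origin.

Section Starts.
Variable K : idomainType.
Implicit Types q : {poly K}.

Lemma exists_starts q : q != 0 -> exists n, exists2 x, x != 0 & starts n x q.
Proof.
move=> nzq; have ex : exists n, q`_n != 0 by exists (size q).-1;
  rewrite -lead_coefE lead_coef_eq0.
have [n nzn minn] := ex_minnP ex.
exists n, q`_n => //; split=> // i lti; apply/eqP; apply: contraTT lti => /minn.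
by rewrite -leqNgt.
Qed.

Lemma starts_uniq n m x y q : starts n x q -> starts m y q -> x != 0 -> y != 0 -> n = m.
Proof.
move=> [on xn] [om ym] nzx nzy; case: (ltngtP n m) => // lt.
  by rewrite -xn om ?eqxx in nzx.
by rewrite -ym on ?eqxx in nzy.
Qed.

(** Successive elimination of leading terms: the orders of elements of V belong to
L, and B contains an element of each order. *)
Lemma triangular_basis (V : {poly K} -> Prop) (L : seq nat) N (B : 'I_(size L) -> {poly K}) :
  sorted ltn L -> (forall i : 'I_(size L), starts (nth 0%N L i) 1 (B i)) -> (forall i, V (B i)) ->
  (forall p q k, V p -> V q -> V (p + k *: q)) ->
  (forall q n x, V q -> starts n x q -> x != 0 -> n \in L) ->
  (forall q, V q -> (size q <= N)%N) ->
  forall q, V q -> exists! u : 'rV[K]_(size L), q = \sum_i u 0 i *: B i.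
Proof.
move=> srtL hB VB VD VL Vsz q Vq.
have Vsum (u : 'rV[K]_(size L)) : V (q - \sum_i u 0 i *: B i).
  rewrite -sumrN; elim/big_rec: _ => [|i p _ Vp]; first by rewrite addr0.
  by rewrite addrCA addrC -scaleNr; apply: VD.
have approx n : exists u : 'rV[K]_(size L), ord_ge n (q - \sum_i u 0 i *: B i).
  elim: n => [|n [u hu]]; first by exists 0.
  set w := q - _ in hu; have [w0|nzw] := eqVneq w`_n 0.
    by exists u; apply: starts_ordS.
  have nL : n \in L := VL _ _ _ (Vsum u) (conj hu erefl) nzw.
  have ltn : (index n L < size L)%N by rewrite index_mem.
  exists (u + w`_n *: delta_mx 0 (Ordinal ltn)).
  rewrite (eq_bigr (fun i => u 0 i *: B i + (w`_n * (i == Ordinal ltn)%:R) *: B i)) => [|i _];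
    last first.
    by rewrite -scalerDl !mxE eqxx.
  rewrite big_split /= opprD addrA -/w (bigD1 (Ordinal ltn)) //= eqxx mulr1.
  rewrite big1 ?addr0 => [|i /negPf->]; last by rewrite mulr0 scale0r.
  apply: (@starts_subr _ _ w`_n); first by split.
  by have := startsZ w`_n (hB (Ordinal ltn)); rewrite /= nth_index // mulr1.
have [u hu] := approx N; exists u; split.
  apply/eqP; rewrite -subr_eq0; apply/eqP/polyP => i; rewrite coef0.
  have [lti|lei] := ltnP i N; first exact: hu.
  by rewrite nth_default // (leq_trans (Vsz _ _) lei).
have qE : q = \sum_i u 0 i *: B i.
  apply/eqP; rewrite -subr_eq0; apply/eqP/polyP => i; rewrite coef0.
  have [lti|lei] := ltnP i N; first exact: hu.
  by rewrite nth_default // (leq_trans (Vsz _ _) lei).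
move=> v vE; apply/rowP => -[i lti]; elim/ltn_ind: i lti => i IH lti.
pose i' := Ordinal lti.
have : (\sum_j (u 0 j - v 0 j) *: B j)`_(nth 0%N L i) = 0.
  rewrite (eq_bigr (fun j => u 0 j *: B j - v 0 j *: B j)) => [|j _]; last by rewrite scalerBl.
  by rewrite sumrB -vE -qE subrr coef0.
rewrite coef_sum (bigD1 i') //= big1 ?addr0 => [|j nej].
  rewrite coefZ; have [_ ->] := hB i'; rewrite mulr1 => /eqP; rewrite subr_eq0 => /eqP.
  by [].
rewrite coefZ; case: (ltngtP j i) => ji.
- by case: j ji {nej} => j ltj /= ji; rewrite (IH _ ji) subrr mul0r.
- have [vB _] := hB j; rewrite vB ?mulr0 //.
  by apply: (sorted_ltn_nth ltn_trans 0%N srtL) => //; rewrite inE.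
- by case/eqP: nej; apply: val_inj.
Qed.
End Starts.

(** * Equisingular matrices in the Severi variety *)

Section Member.
Variables (K : numClosedFieldType) (d a b c : nat).
Hypotheses (a4 : (4 <= a)%N) (ltab : (a < b)%N) (ltbc : (b < c)%N).
Hypotheses (cab : coprime a b) (cac : coprime a c) (cbc : coprime b c).
Variables (A : 'M[K]_(4, d.+1)) (phi : {poly K}) (ey ez : nat -> K) (m0 : nat).
Local Notation p := (rowpoly A).
Local Notation C := (conductor a b c).
Local Notation inS := (inS a b c).
Local Notation x := (phi * p i1).
Local Notation y := (phi * p i2).
Local Notation z := (phi * p i3).
Hypotheses (h0 : starts 0 1 (p ord0)) (h1 : starts (a * b) 1 (p i1)).
Hypotheses (h2 : starts (a * c) 1 (p i2)) (h3 : starts (b * c) 1 (p i3)).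
Hypotheses (hphi : starts 0 1 phi) (phi_inv : ord_ge C (phi * p ord0 - 1)).
Hypothesis rely : ord_ge C (x ^+ c - y ^+ b - tail a b c C ey x y z).
Hypothesis relz : ord_ge C (x ^+ c - z ^+ a - tail a b c C ez x y z).
Hypothesis leCd : (C <= d)%N.
Hypothesis large : forall m n, (m0 <= m)%N -> (C <= n)%N -> (n <= m * d)%N -> attained A m 'X^n.

Let a2 : (2 <= a)%N := ltnW (ltnW a4).

(** After multiplication by phi^m, a form of degree m becomes, modulo t^C, a
polynomial in x, y, z, because phi p0 = 1. *)
Lemma attained_order m q n k : attained A m q -> starts n k q -> k != 0 -> inS n.
Proof.
move=> [F hF <-] hq nzk.
have [ltn|leC] := ltnP n C; last exact: (inS_large a2 ltab ltbc cab cac cbc).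
have hx : starts (a * b) 1 x by rewrite -[X in starts X]add0n; apply: starts1M.
have hy : starts (a * c) 1 y by rewrite -[X in starts X]add0n; apply: starts1M.
have hz : starts (b * c) 1 z by rewrite -[X in starts X]add0n; apply: starts1M.
have hq' : starts n k (phi ^+ m * subst A F).
  by rewrite -[n]add0n -[k]mul1r; apply: startsM => //; rewrite -(muln0 m); apply: starts_exp.
apply: (spanned_starts a2 ltab ltbc cab cac cbc hx hy hz _ hq' nzk ltn).
rewrite /subst /mmap [X in spanned _ _ _ _ _ _ X]mulr_sumr big_seq;
  apply: spanned_sum => // mm mF.
rewrite mul_polyC -scalerAr; apply: spannedZ.
have -> : phi ^+ m * mmap1 p mm =
  (phi * p ord0) ^+ mm ord0 * (x ^+ mm i1 * y ^+ mm i2 * z ^+ mm i3).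
  have -> : m = (mm ord0 + mm i1 + mm i2 + mm i3)%N.
    move/dhomogP: hF => /(_ _ mF) <-; rewrite /= mdegE !big_ord_recl big_ord0 addn0 !addnA.
    by congr (_ + mm _ + mm _ + mm _)%N; apply: val_inj.
  rewrite /mmap1 !big_ord_recl big_ord0 mulr1 !exprD !exprMn.
  have -> : lift ord0 ord0 = i1 by apply: val_inj.
  have -> : lift ord0 (lift ord0 ord0) = i2 by apply: val_inj.
  have -> : lift ord0 (lift ord0 (lift ord0 ord0)) = i3 by apply: val_inj.
  ring.
set M := x ^+ _ * _ * _.
apply: (@spanned_ord_eq _ _ _ _ _ _ _ _ M); last first.
  exact: (spanned_monomial a2 ltab ltbc cab cac cbc hx hy hz rely relz).
rewrite -[X in _ - X]mul1r -mulrBl; apply: ord_geMr.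
elim: (mm ord0) => [|e IH]; first by rewrite subrr; apply: ord_ge0.
have -> : (phi * p ord0) ^+ e.+1 - 1 =
  phi * p ord0 * ((phi * p ord0) ^+ e - 1) + (phi * p ord0 - 1).
  by rewrite exprS; ring.
by apply: ord_geD => //; apply: ord_geMl.
Qed.

Lemma attained_weight m i j k : (i + j + k <= m)%N ->
  exists2 q, attained A m q & starts (weight a b c i j k) 1 q.
Proof.
move=> lem.
exists (p ord0 ^+ (m - (i + j + k))%N * (p i1 ^+ i * p i2 ^+ j * p i3 ^+ k)).
  rewrite -[X in attained _ X](subnK lem); apply: attainedM.
    by rewrite -[X in attained _ X]muln1; apply/attained_exp/attained_row.
  by do 2?[apply: attainedM]; rewrite -[X in attained _ X]muln1; apply/attained_exp/attained_row.
rewrite -[weight _ _ _ _ _ _]add0n; apply: starts1M.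
  by have := starts_exp (m - (i + j + k))%N h0; rewrite muln0.
exact: starts_monomial.
Qed.

Lemma attained_inS s m : inS s -> (s <= m)%N -> exists2 q, attained A m q & starts s 1 q.
Proof.
move=> /asboolP[i [j [k ->]]] le; apply: attained_weight.
apply: leq_trans le; rewrite /weight; apply: leq_add; [apply: leq_add|];
  by apply: leq_pmulr; rewrite muln_gt0; lia.
Qed.

Lemma attained_large m q : (m0 <= m)%N -> ord_ge C q -> (size q <= (m * d).+1)%N ->
  attained A m q.
Proof.
move=> lem hq szq; rewrite -[q]coefK poly_def; apply: attained_sum => i _.
have [lt|le] := ltnP i C; first by rewrite hq // scale0r; apply: attained0.
by apply/attainedZ/large => //; have := ltn_ord i; lia.
Qed.

Lemma eval_member k F Q : F \is k.-homog ->
  F.@[map_eval A Q 0] = (hom (k * d) (subst A F)).@[Q 0].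
Proof. by move=> hF; rewrite meval_map_eval (pullbackE _ hF). Qed.

Lemma eval_origin F : F.@[map_eval A (origin K) 0] = (subst A F)`_0.
Proof. by rewrite meval_map_eval -dehom_coef0 dehom_pullback. Qed.

Lemma exists_Xn m n : (m0 <= m)%N -> (C <= n)%N -> (n <= m * d)%N ->
  exists F, [/\ F \is m.-homog, subst A F = 'X^n &
    forall Q, F.@[map_eval A Q 0] = Q 0 0 ^+ (m * d - n) * Q 0 1 ^+ n].
Proof.
move=> lem leC len; have [F hF FE] := large lem leC len.
by exists F; split=> // Q; rewrite (eval_member _ hF) FE meval_hom_Xn.
Qed.

Definition big_degree := maxn m0.+1 C.+1.
Lemma leq_big_degree : (m0 <= big_degree)%N. Proof. by rewrite /big_degree; lia. Qed.
Lemma big_degree_gt0 : (0 < big_degree)%N. Proof. by rewrite /big_degree; lia. Qed.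
Lemma conductor_lt_big : (C < big_degree * d)%N.
Proof.
apply: (@leq_trans (C.+1 * d)%N); last by rewrite leq_mul2r /big_degree; lia.
by rewrite -[ltnLHS]muln1; apply: leq_trans (_ : C.+1 * C <= _)%N; [have : (0 < C)%N by [];
  nia|rewrite leq_mul2l leCd orbT].
Qed.

Lemma meval0_homog k (F : {mpoly K[4]}) (v : 'I_4 -> K) : (0 < k)%N -> F \is k.-homog ->
  (forall i, v i = 0) -> F.@[v] = 0.
Proof.
move=> k0 hF v0; rewrite (meval_homog (l := 0) (v := v) hF) => [|i]; last by rewrite v0 mulr0.
by rewrite expr0n (gtn_eqF k0) mul0r.
Qed.

Lemma rV2_origin (Q : 'rV[K]_2) : Q != 0 -> Q 0 1 = 0 -> Q 0 0 != 0 /\ Q = Q 0 0 *: origin K.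
Proof.
move=> nzQ Q1; have QE : Q = Q 0 0 *: origin K.
  apply/rowP => j; rewrite mxE; case: j => [[|[|]]] // ltj.
    by rewrite (_ : Ordinal ltj = 0) ?origin0 ?mulr1 //; apply: val_inj.
  by rewrite (_ : Ordinal ltj = 1) ?origin1 ?mulr0 ?Q1 //; apply: val_inj.
by split=> //; apply: contraNneq nzQ => Q0; rewrite QE Q0 scale0r.
Qed.

(** The pullback X_1^(md) vanishes only at the cusp, where p0 does not. *)
Lemma member_morphism : @morphisms K 3 d A.
Proof.
move=> Q nzQ; apply/negP => /eqP AQ0.
have [Q1|Q1] := eqVneq (Q 0 1) 0.
  have [Q0 _] := rV2_origin nzQ Q1.
  have h : ('X_ord0 : {mpoly K[4]}) \is 1.-homog by rewrite dhomogX /= mdeg1.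
  have := eval_member Q h; rewrite AQ0 (meval0_homog _ h) // => [|i]; last by rewrite mxE.
  rewrite substX meval_hom big_ord_recl big1 ?addr0 => [|i _];
    last by rewrite Q1 exprS mul0r !mulr0.
  have [_ ->] := h0; rewrite mul1r expr0 mulr1 => /esym/eqP.
  by rewrite expf_eq0 (negPf Q0) andbF.
have [F [hF _ /(_ Q)]] := exists_Xn leq_big_degree (ltnW conductor_lt_big) (leqnn _).
rewrite AQ0 (meval0_homog big_degree_gt0 hF) => [|i]; last by rewrite mxE.
by move/esym/eqP; rewrite subnn mul1r expf_eq0 (negPf Q1) andbF.
Qed.

(** The coordinate t is the quotient of t^(C+1) by t^C. *)
Lemma member_birational : @birational K 3 d A.
Proof.
have [F hF FE] := large leq_big_degree (leqnn C) (ltnW conductor_lt_big).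
have [G hG GE] := large leq_big_degree (leqnSn C) conductor_lt_big.
exists big_degree, F, G; split=> //.
  have : dehom (pullback A G) != 0 by rewrite dehom_pullback GE -size_poly_eq0 size_polyXn.
  by apply: contraNneq => ->; rewrite rmorph0.
apply: (@dehom_inj _ (big_degree * d + 1));
  try by apply: dhomogM (pullback_homog _ _) (homXn _ _ 1).
by rewrite !rmorphM /= !dehom_pullback FE GE dehomX0 dehomX1 mulr1 -exprSr.
Qed.

(** The form with pullback X_1^(md) vanishes at the image of the cusp and at no
image of another point. *)
Lemma member_injective Q : Q != 0 ->
  (map_eval A Q == map_eval A (origin K))%MS -> (Q == origin K)%MS.
Proof.
move=> nzQ e; have [Q1|Q1] := eqVneq (Q 0 1) 0.
  have [Q0 ->] := rV2_origin nzQ Q1.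
  by apply/eqmxP; apply: eqmx_scale.
have [F [hF _ FE]] := exists_Xn leq_big_degree (ltnW conductor_lt_big) (leqnn _).
have /sub_rVP[l lE] : (map_eval A Q <= map_eval A (origin K))%MS by case/andP: e.
have := FE Q; rewrite (meval_homog (l := l) (v := map_eval A (origin K) 0) hF) => [|i];
  last first.
  by rewrite lE mxE.
rewrite FE origin1 expr0n (gtn_eqF (leq_ltn_trans (leq0n _) conductor_lt_big)) !mulr0 subnn mul1r.
by move/esym/eqP; rewrite expf_eq0 (negPf Q1) andbF.
Qed.

(** If the maximal ideal were generated by an element of order v0, then v0,
ab - v0 and ac - v0 would belong to S.  As ab is the least positive element of
S, this gives v0 = ab, and ac - ab = s' in S leads to b | c. *)
Lemma member_cuspidal : ~ smooth_at A (@origin K).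
Proof.
move=> [F0 [G0 [[[k [hF0 hG0]] nzG0] vF0 gen]]].
have [v0 v0S [v0gt0 factor]] : exists2 v0, inS v0 & (0 < v0)%N /\
    forall i w, starts w 1 (p i) -> (0 < w)%N -> exists2 s, inS s & w = (v0 + s)%N.
  have hX i : ('X_i : {mpoly K[4]}) \is 1.-homog by rewrite dhomogX /= mdeg1.
  have fact i w : starts w 1 (p i) -> (0 < w)%N -> exists v0 s,
      [/\ exists2 y0, y0 != 0 & starts v0 y0 (subst A F0), inS s & w = (v0 + s)%N].
    move=> hw w0.
    have lX : local_fraction A (@origin K) 'X_i 'X_ord0.
      split; first by exists 1%N; rewrite !hX.
      by rewrite eval_origin substX; case: h0 => _ ->; apply: oner_neq0.
    have [|F1 [G1 [[[k1 [hF1 hG1]] nzG1] e]]] := gen _ _ lX.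
      by have [ow _] := hw; rewrite eval_origin substX; exact: ow.
    have {}e : p i * (subst A G0 * subst A G1) = subst A F0 * subst A F1 * p ord0.
      by have := congr1 (@dehom K) e; rewrite !rmorphM /= !dehom_pullback !rmorphM /= !substX.
    have st G : G.@[map_eval A (@origin K) 0] != 0 ->
      starts 0 (subst A G)`_0 (subst A G) by split.
    have hl : starts (w + (0 + 0)) (1 * ((subst A G0)`_0 * (subst A G1)`_0)) (p i * (subst A G0
      * subst A G1)).
      by apply: startsM => //; apply: startsM; apply: st.
    rewrite eval_origin in nzG0; rewrite eval_origin in nzG1.
    have nzl : 1 * ((subst A G0)`_0 * (subst A G1)`_0) != 0 by rewrite mul1r mulf_neq0.
    have nzr : subst A F0 * subst A F1 * p ord0 != 0.
      by rewrite -e; apply: contraNneq nzl => e0; case: hl => _ <-; rewrite e0 coef0.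
    have /exists_starts [v0 [y0 nzy0 hv0]] : subst A F0 != 0.
      by apply: contraNneq nzr => ->; rewrite !mul0r.
    have /exists_starts [s [y1 nzy1 hs]] : subst A F1 != 0.
      by apply: contraNneq nzr => ->; rewrite mulr0 mul0r.
    exists v0, s; split; first by exists y0.
      exact: attained_order (ex_intro2 _ _ F1 hF1 erefl) hs nzy1.
    have hr : starts (v0 + s + 0) (y0 * y1 * 1) (subst A F0 * subst A F1 * p ord0).
      by apply: startsM => //; apply: startsM.
    rewrite -e in hr; have := starts_uniq hl hr nzl; rewrite !mulr1 !addn0 => -> //.
    by rewrite mulf_neq0.
  have [v0 [s [[y0 nzy0 hv0] sS wE]]] := fact i1 _ h1 ltac:(by rewrite muln_gt0; lia).
  exists v0; first exact: attained_order (ex_intro2 _ _ F0 hF0 erefl) hv0 nzy0.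
  split.
    rewrite lt0n; apply: contraNneq nzy0 => v00; case: hv0 => _ <-.
    by rewrite v00 -eval_origin vF0.
  move=> i w hw w0; have [v1 [s' [[y1 nzy1 hv1] sS' wE']]] := fact i w hw w0.
  by exists s' => //; rewrite wE' (starts_uniq hv0 hv1).
have ab0 : (0 < a * b)%N by rewrite muln_gt0; lia.
have ac0 : (0 < a * c)%N by rewrite muln_gt0; lia.
have [s _ abE] := factor i1 _ h1 ab0.
have [s' s'S acE] := factor i2 _ h2 ac0.
have leac : (a * b <= a * c)%N by rewrite leq_mul2l; lia.
have lebc : (a * c < b * c)%N by rewrite ltn_mul2r; lia.
have geS n : inS n -> (0 < n)%N -> (a * b <= n)%N.
  move=> /asboolP[i [j [l ->]]]; rewrite /weight.
  by case: i j l => [|i] [|j] [|l] //; rewrite ?mulSn; lia.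
have v0E : v0 = (a * b)%N by have := geS _ v0S v0gt0; lia.
move/asboolP: s'S => [i [j [l s'E]]]; rewrite v0E s'E /weight in acE.
have l0 : l = 0%N by case: l acE {s'E} => // l; rewrite mulSn; lia.
have j0 : j = 0%N by case: j acE {s'E} => // j; rewrite mulSn; lia.
rewrite l0 j0 !mul0n !addn0 in acE.
have : (b %| c)%N.
  apply/dvdnP; exists i.+1; apply/eqP; rewrite -(@eqn_pmul2l a); last by lia.
  by rewrite acE mulSn; apply/eqP; ring.
by move=> /gcdn_idPl bE; move: cbc; rewrite /coprime bE; lia.
Qed.

Lemma member_value_semigroup :
  value_semigroup A (@origin K) = semigroup_gen [:: a * b; a * c; b * c]%N.
Proof.
rewrite semigroup_genE; apply/seteqP; split=> v /=.
  move=> [F [G [[[k [hF hG]] nzG] /vanishing_order_starts[x0 nzx]]]].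
  rewrite dehom_pullback => hv; exact: attained_order (ex_intro2 _ _ F hF erefl) hv nzx.
move=> vS; have [q [F hF FE] hq] := attained_inS vS (leqnn v).
exists F, ('X_ord0 ^+ v); split.
  split; first exists v; first split=> //.
    have h : ('X_ord0 : {mpoly K[4]}) \is 1.-homog by rewrite dhomogX /= mdeg1.
    by have := dhomogMn v h; rewrite mul1n.
  rewrite eval_origin rmorphXn /= substX.
  have := starts_exp v h0; rewrite muln0 => -[_ ->]; exact: oner_neq0.
apply: (starts_vanishing_order (pullback_homog A hF) _ (oner_neq0 _)).
  by rewrite dehom_pullback size_subst.
by rewrite dehom_pullback FE.
Qed.

Lemma member_ramification :
  ramification_profile A (@origin K) [tuple (a * b)%N; (a * c)%N; (b * c)%N].
Proof.
split; first by rewrite /= ltn_mul2l ltn_mul2r; lia.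
exists 1%:M; rewrite mul1mx; split; first exact: unitmx1.
  rewrite binary_formE; apply: (starts_vanishing_order (hom_homog _ _) _ (oner_neq0 _)).
    by rewrite dehom_hom size_rowpoly.
  by rewrite dehom_hom ?size_rowpoly.
move=> i; rewrite binary_formE; apply: (starts_vanishing_order (hom_homog _ _) _ (oner_neq0 _)).
  by rewrite dehom_hom size_rowpoly.
rewrite dehom_hom ?size_rowpoly //.
case: i => [[|[|[|]]]] // lti.
- by rewrite (_ : lift ord0 _ = i1) //; apply: val_inj.
- by rewrite (_ : lift ord0 _ = i2) //; apply: val_inj.
- by rewrite (_ : lift ord0 _ = i3) //; apply: val_inj.
Qed.

(** Here [hom N f] is the form with dehomogenization [f], and the factor is the
linear form that vanishes at [Q]. *)
Lemma line_factor N (Q : 'rV[K]_2) (f : {poly K}) : Q 0 1 != 0 -> (size f <= N.+1)%N ->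
  (hom N f).@[Q 0] = 0 ->
  exists2 h, f = ((Q 0 1)%:P - Q 0 0 *: 'X) * h & (size h <= N)%N.
Proof.
move=> Q1 szf; rewrite meval_hom; have [Q0|Q0] := eqVneq (Q 0 0) 0.
  rewrite big_ord_recr big1 /= ?add0r => [|j _]; last first.
    by rewrite Q0 expr0n subn_eq0 leqNgt ltn_ord mul0r mulr0.
  rewrite subnn mul1r => /eqP; rewrite mulf_eq0 expf_eq0 (negPf Q1) andbF orbF => /eqP fN.
  exists ((Q 0 1)^-1 *: f).
    by rewrite Q0 scale0r subr0 mul_polyC scalerA divff // scale1r.
  apply: leq_trans (size_scale_leq _ _) _; apply/leq_sizeP => j.
  by rewrite leq_eqVlt => /predU1P[<- //|ltj]; rewrite nth_default // (leq_trans szf).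
move=> e0; have root_f : root f (Q 0 1 / Q 0 0).
  rewrite /root (horner_coef_wide _ szf); apply/eqP.
  have nzN : Q 0 0 ^+ N != 0 by rewrite expf_eq0 (negPf Q0) andbF.
  apply: (mulfI nzN); rewrite mulr0 -[RHS]e0 mulr_sumr; apply: eq_bigr => j _.
  rewrite mulrCA; congr (_ * _).
  have lej : (j <= N)%N by rewrite -ltnS.
  have -> : Q 0 0 ^+ N = Q 0 0 ^+ (N - j) * Q 0 0 ^+ j by rewrite -exprD subnK.
  by rewrite expr_div_n -mulrA; congr (_ * _);
    rewrite mulrCA divff ?mulr1 // expf_eq0 (negPf Q0) andbF.
have [h0' fE] := factor_theorem _ _ root_f.
exists ((- Q 0 0)^-1 *: h0').
  have nz : - Q 0 0 != 0 by rewrite oppr_eq0.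
  have -> : (Q 0 1)%:P - Q 0 0 *: 'X = - Q 0 0 *: ('X - (Q 0 1 / Q 0 0)%:P).
    by rewrite scalerBr !scaleNr opprK addrC -[_ *: _%:P]mul_polyC -polyCM mulrC divfK.
  by rewrite -scalerAl -scalerAr scalerA divff // scale1r mulrC.
apply: leq_trans (size_scale_leq _ _) _.
have [->|nzh] := eqVneq h0' 0; first by rewrite size_poly0.
by move: szf; rewrite fE size_Mmonic ?monicXsubC // size_XsubC addn2.
Qed.

(** Let l be the linear form vanishing at Q.  The generator of the maximal ideal is
l t^(N) / t^(N+1), with N + 1 = Md.  A form whose pullback vanishes at Q has a
pullback l h, and h t^(N+2) is the pullback of a form, being divisible by
t^C. *)
Lemma member_smooth Q : Q != 0 -> ~~ (Q == @origin K)%MS -> smooth_at A Q.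
Proof.
move=> nzQ nQ; have Q1 : Q 0 1 != 0.
  apply: contraNneq nQ => Q1; have [Q0 ->] := rV2_origin nzQ Q1.
  by apply/eqmxP; apply: eqmx_scale.
pose N := (big_degree * d).-1.
have NE : (big_degree * d)%N = N.+1 by rewrite /N prednK // (leq_ltn_trans _ conductor_lt_big).
have leCN : (C <= N)%N by have := conductor_lt_big; rewrite NE.
pose l : {poly K} := (Q 0 1)%:P - Q 0 0 *: 'X.
have lXE : l * 'X^N = Q 0 1 *: 'X^N - Q 0 0 *: 'X^(N.+1).
  by rewrite mulrBl mul_polyC -scalerAl exprS.
have [F0 hF0 F0E] : attained A big_degree (l * 'X^N).
  apply: attained_large leq_big_degree _ _;
    first by apply/ord_geMl/(ord_ge_leq leCN)/(starts_ord (starts_Xn _ _)).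
  rewrite NE -[N.+1]add1n; apply: size_mul_bound; last by rewrite size_polyXn.
  apply: leq_trans (size_polyD _ _) _; rewrite geq_max (leq_trans (size_polyC_leq1 _)) //=.
  by rewrite size_polyN (leq_trans (size_scale_leq _ _)) ?size_polyX.
have [G0 [hG0 G0E G0Q]] := exists_Xn leq_big_degree (ltnW conductor_lt_big) (leqnn _).
have nzG0Q : G0.@[map_eval A Q 0] != 0.
  by rewrite G0Q subnn mul1r expf_eq0 (negPf Q1) andbF.
exists F0, G0; split.
- by split=> //; exists big_degree.
- rewrite (eval_member _ hF0) F0E lXE homD -scaleNr !homZ mevalD !mevalZ.
  rewrite !meval_hom_Xn NE ?leqnSn // subnn subSnn expr1 expr0 mul1r exprS.
  ring.
move=> F G [[k [hF hG]] nzG] vF.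
have [h fE szh] := line_factor Q1 (size_subst A hF) (etrans (esym (eval_member _ hF)) vF).
have [F1 hF1 F1E] : attained A (big_degree + k) (h * 'X^((big_degree * d).+1)).
  apply: attained_large; first by rewrite (leq_trans leq_big_degree) ?leq_addr.
    by apply/ord_geMl/(ord_ge_leq _ (starts_ord (starts_Xn _ _)))/leqW/ltnW/conductor_lt_big.
  apply: leq_trans (size_polyMleq _ _) _; rewrite size_polyXn addnS /= mulnDl addnS ltnS addnC.
  by rewrite leq_add2l.
exists F1, (G0 * G); split.
  split; first by exists (big_degree + k)%N; split=> //; apply: dhomogM.
  by rewrite mevalM mulf_neq0.
have hG00 := pullback_homog A (dhomogM hG0 (dhomogM hG0 hG)).
have hF01 := pullback_homog A (dhomogM hF0 hF1).
apply: (dehom_inj (dhomogM (pullback_homog A hF) hG00)).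
  have := dhomogM hF01 (pullback_homog A hG).
  by rewrite -!mulnDl (_ : big_degree + (big_degree + k) + k =
    k + (big_degree + (big_degree + k)))%N //; lia.
rewrite !rmorphM /= !dehom_pullback !rmorphM /= F0E F1E G0E fE NE -/l !exprS.
ring.
Qed.

Lemma size_orders m : (C <= m.+1)%N ->
  (size [seq s <- iota 0 m.+1 | inS s] + size (gaps a b c) = m.+1)%N.
Proof.
move=> leCm; rewrite /gaps !size_filter -(subnKC leCm) iotaD count_cat.
rewrite [X in (_ + X + _)%N](_ : _ = m.+1 - C)%N; last first.
  rewrite -[RHS](size_iota (0 + C)); apply/eqP; rewrite -all_count; apply/allP => n.
  by rewrite mem_iota add0n => /andP[len _]; apply: (inS_large a2 ltab ltbc cab cac cbc).
by rewrite addnAC -[X in (_ + X + _)%N]/(count (predC inS) _) count_predC size_iota.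
Qed.

(** Elements of S below the conductor are orders of monomials in the rows; those
above are covered by [large]. *)
Lemma member_forms m : (big_degree <= m)%N ->
  exists B : 'I_(size [seq s <- iota 0 (m * d).+1 | inS s]) -> {mpoly K[4]},
  forall i, B i \is m.-homog /\
    starts (nth 0%N [seq s <- iota 0 (m * d).+1 | inS s] i) 1 (subst A (B i)).
Proof.
move=> leMm; set L := [seq _ <- _ | _].
suff exB (i : 'I_(size L)) : exists F, F \is m.-homog /\ starts (nth 0%N L i) 1 (subst A F).
  by have [B BP] := choice exB; exists B.
have := mem_nth 0%N (ltn_ord i); rewrite mem_filter mem_iota add0n /= ltnS => /andP[nS ltn].
have [ltC|leC] := ltnP (nth 0%N L i) C.
  have [|q [F hF FE] hq] := attained_inS nS (_ : _ <= m)%N.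
    by apply: leq_trans leMm; rewrite /big_degree; lia.
  by exists F; rewrite FE.
have [F hF FE] := large (leq_trans leq_big_degree leMm) leC ltn.
by exists F; split=> //; rewrite FE; apply: starts_Xn.
Qed.

(** Forms of degree m have their orders in S and bounded by md, and each such
order occurs. *)
Lemma member_hilbert m : (big_degree <= m)%N ->
  hilbert_function A m (size [seq s <- iota 0 (m * d).+1 | inS s]).
Proof.
move=> leMm; have [B] := member_forms leMm; set L := [seq _ <- _ | _] in B * => BP.
exists B; split=> [i|F hF]; first by case: (BP i).
have [|||||||u [uE uu]] := @triangular_basis K (attained A m) L (m * d).+1 (fun i =>
  subst A (B i)) _ _ _ _ _ _ (subst A F).
- by apply: sorted_filter; [exact: ltn_trans|exact: iota_ltn_sorted].
- by move=> i; case: (BP i).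
- by move=> i; exists (B i) => //; case: (BP i).
- by move=> q r k hq hr; apply/attainedD/attainedZ.
- move=> q n x hq hqn nzx; rewrite mem_filter (attained_order hq hqn nzx) mem_iota add0n ltnS /=.
  rewrite leqNgt; apply: contra nzx => lt; case: hqn => _ <-.
  by rewrite nth_default // (leq_trans (attained_size hq)).
- by move=> q; apply: attained_size.
- by exists F.
have hB i := (BP i).1.
have sumE (v : 'rV[K]_(size L)) : dehom (\sum_(i < size L) v 0 i *: pullback A (B i)) =
  \sum_i v 0 i *: subst A (B i).
  by rewrite rmorph_sum; apply: eq_bigr => i _ /=; rewrite dehomZ dehom_pullback.
exists u; split=> [|v vE].
  apply: (dehom_inj (pullback_homog A hF)); last by rewrite sumE dehom_pullback.
  by apply: rpred_sum => i _; apply/rpredZ/pullback_homog.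
by apply: uu; rewrite -sumE -vE dehom_pullback.
Qed.

(** There are md + 1 - g elements of S up to md. *)
Lemma member_arithmetic_genus : arithmetic_genus A (size (gaps a b c)).
Proof.
exists (d%:R *: 'X + (1 - (size (gaps a b c))%:R)%:P); last by rewrite !hornerE ?mulr0 ?add0r.
exists big_degree => m leMm; exists (size [seq s <- iota 0 (m * d).+1 | inS s]);
  first exact: member_hilbert.
have : (C <= (m * d).+1)%N.
  by apply: leq_trans (ltnW conductor_lt_big) _; apply: leqW; rewrite leq_mul2r leMm orbT.
move/size_orders => /(congr1 (fun n => n%:R : rat)); rewrite natrD -natr1 natrM => e.
rewrite hornerD hornerZ hornerX hornerC.
by apply: (addIr (size (gaps a b c))%:R); rewrite e; ring.
Qed.

Lemma member_severi : @severi K 3 d (genus (semigroup_gen [:: a * b; a * c; b * c]%N))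
  (semigroup_gen [:: a * b; a * c; b * c]%N) [tuple (a * b)%N; (a * c)%N; (b * c)%N] A.
Proof.
split; first exact: member_morphism.
split; first by rewrite (genus_gaps a2 ltab ltbc cab cac cbc); apply: member_arithmetic_genus.
exists (@origin K); split.
- exact: origin_neq0.
- split; [exact: member_birational|exact: member_cuspidal|exact: member_injective|exact:
    member_smooth].
- exact: member_value_semigroup.
exact: member_ramification.
Qed.

End Member.

(** * Open conditions on the forms of one degree *)

(** With n = q m + r and r < m <= q, one has n = (q - r) m + r (m + 1). *)
Lemma two_generators (P : nat -> Prop) m :
  (forall i j, P i -> P j -> P (i + j)%N) -> P m -> P m.+1 ->
  forall n, (0 < n)%N -> (m * m <= n)%N -> P n.
Proof.
move=> PD Pm Pm1 n n0 len; pose Q k := k = 0%N \/ P k.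
have QD i j : Q i -> Q j -> Q (i + j)%N.
  by move=> [->|Pi] [->|Pj]; rewrite /Q ?addn0 ?add0n; auto.
have QM k i : Q i -> Q (k * i)%N.
  by move=> Qi; elim: k => [|k IH]; [left|rewrite mulSn; apply: QD].
suff : Q n by case=> // n0'; rewrite n0' in n0.
have [m0|m0] := posnP m.
  by rewrite -[n]muln1; apply: QM; right; rewrite -[1%N]/(0.+1) -m0.
have lt : (n %% m < m)%N by rewrite ltn_mod.
have leq : (m <= n %/ m)%N by rewrite leq_divRL.
rewrite (_ : n = (n %/ m - n %% m) * m + n %% m * m.+1)%N; last first.
  have := divn_eq n m; move: (n %/ m)%N (n %% m)%N lt leq => q r lt leq nE.
  have : (r * m <= q * m)%N by rewrite leq_mul2r (ltnW (leq_trans lt leq)) orbT.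
  by rewrite mulnBl mulnS; lia.
by apply: QD; apply: QM; right.
Qed.

Section Fullness.
Variables (K : numClosedFieldType) (d : nat).
Implicit Types (A : 'M[K]_(4, d.+1)).

Definition full A (C m : nat) := forall n, (C <= n)%N -> (n <= m * d)%N -> attained A m 'X^n.

(** From 2C on, t^n is a product of two powers.  Below, t^n p0^m' has leading term
t^n, and the higher terms are removed by descending induction. *)
Lemma fullD A C m m' : (C <= d)%N -> starts 0 1 (rowpoly A ord0) -> (1 < m)%N -> (1 < m')%N ->
  full A C m -> full A C m' -> full A C (m + m').
Proof.
move=> leCd h0 m1 m1' fm fm'.
have leC2 k : (1 < k)%N -> (2 * C <= k * d)%N by move=> k1; apply: leq_mul.
have big n : (2 * C <= n)%N -> (n <= (m + m') * d)%N -> attained A (m + m') 'X^n.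
  move=> le1 le2; have lm := leC2 _ m1; have lm' := leC2 _ m1'; rewrite mulnDl in le2.
  have [n1 [n2 [h1 h2 h3 h4 ->]]] : exists n1 n2, [/\ C <= n1, n1 <= m * d, C <= n2,
    n2 <= m' * d & n = n1 + n2]%N.
    have [lt|ge] := leqP (n - C) (m * d).
      by exists (n - C)%N, C; split; lia.
    by exists (m * d)%N, (n - m * d)%N; split; lia.
  by rewrite exprD; apply: attainedM; [apply: fm|apply: fm'].
move=> n leC len; move: {2}(2 * C - n)%N (leqnn (2 * C - n)) => e.
elim/ltn_ind: e n leC len => e IH n leC len le.
have [le2|ltn] := leqP (2 * C) n; first exact: big.
have at1 : attained A (m + m') ('X^n * rowpoly A ord0 ^+ m').
  apply: attainedM; first by apply: fm => //; have := leC2 _ m1; lia.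
  by rewrite -[X in attained _ X]muln1; apply/attained_exp/attained_row.
have st : starts n 1 ('X^n * rowpoly A ord0 ^+ m').
  rewrite -[n in starts n]addn0; apply: starts1M; first exact: starts_Xn.
  by have := starts_exp m' h0; rewrite muln0.
set q := _ * _ in at1 st.
have -> : 'X^n = q - \sum_(i < size q | (n < i)%N) q`_i *: 'X^i.
  rewrite -[q in q - _]coefK poly_def (bigID (fun i : 'I_(size q) => (n < i)%N)) /= addrC addrK.
  have ltnq : (n < size q)%N.
    rewrite ltnNge; apply/negP => le'; case: st => _; rewrite nth_default // => /esym/eqP.
    by rewrite oner_eq0.
  rewrite (bigD1 (Ordinal ltnq)) /= ?ltnn //; case: st => ordq ->;
    rewrite scale1r big1 ?addr0 // => i.
  rewrite -leqNgt => /andP[le' ne]; rewrite ordq ?scale0r // ltn_neqAle le' andbT.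
  by apply: contra ne => /eqP e'; apply/eqP/val_inj.
apply: attainedB => //; apply: attained_sum => i lti; apply: attainedZ.
have := attained_size at1; have := ltn_ord i => lt1 lt2.
by apply: (IH (2 * C - i)%N) => //; lia.
Qed.

End Fullness.

Section Open.
Variables (K : numClosedFieldType) (d N : nat) (Phi : 'M[{mpoly K[N]}]_(4, d.+1)).
Variables (u0 : 'I_N -> K) (S : pred nat) (C m : nat).
Local Notation at_ u := (map_mx (meval u) Phi).
Hypothesis SC : forall n, (C <= n)%N -> S n.
Local Notation L := [seq s <- iota 0 (m * d).+1 | S s].
Variable B : 'I_(size L) -> {mpoly K[4]}.
Hypothesis homB : forall i, B i \is m.-homog.
Hypothesis startB : forall i : 'I_(size L), starts (nth 0%N L i) 1 (subst (at_ u0) (B i)).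

Definition generic_subst (F : {mpoly K[4]}) : {poly {mpoly K[N]}} :=
  mmap (polyC \o @mpolyC N K) (fun i => \sum_(j < d.+1) Phi i j *: 'X^j) F.

Lemma map_generic_subst u F : map_poly (meval u) (generic_subst F) = subst (at_ u) F.
Proof.
rewrite /generic_subst (rmorph_mmap polyC (map_poly (meval u))) => [|k]; last first.
  by rewrite /= map_polyC /= mevalC.
apply: eq_bigr => mm _; congr (_ * _); apply: eq_bigr => i _; congr (_ ^+ _).
rewrite /rowpoly rmorph_sum; apply: eq_bigr => j _.
by rewrite /= map_polyZ map_polyXn mxE.
Qed.

(** Rows: the forms [B], one for each order in S up to md at the base point.
Columns: their coefficients at these orders. *)
Definition minor : 'M[{mpoly K[N]}]_(size L) :=
  \matrix_(i, j) (generic_subst (B i))`_(nth 0%N L j).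

Lemma minor_at u : (\det minor).@[u] = \det (\matrix_(i, j) (subst (at_ u) (B i))`_(nth 0%N L j)).
Proof.
rewrite -det_map_mx; congr (\det _); apply/matrixP => i j.
by rewrite !mxE -map_generic_subst coef_map.
Qed.

Lemma minor_neq0 : (\det minor).@[u0] != 0.
Proof.
rewrite minor_at -det_tr det_trig.
  by rewrite big1 ?oner_neq0 // => i _; rewrite !mxE; case: (startB i).
apply/is_trig_mxP => i j ltij; rewrite !mxE; have [vB _] := startB j; rewrite vB //.
have srt : sorted ltn L by apply: sorted_filter; [exact: ltn_trans|exact: iota_ltn_sorted].
by apply: (sorted_ltn_nth ltn_trans 0%N srt) => //; rewrite inE.
Qed.

(** As the minor does not vanish, some combination q of the forms has coefficient 1
at t^n and 0 at all other orders in S up to md.  The leading order of q is in S,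
hence equals n; all later orders exceed C and so are in S.
So q = t^n. *)
Lemma full_open u : (\det minor).@[u] != 0 ->
  (forall q n x, attained (at_ u) m q -> starts n x q -> x != 0 -> S n) ->
  full (at_ u) C m.
Proof.
rewrite minor_at; set D := \matrix_(i, j) _ => nzD ordS n leC len.
have uD : D \in unitmx by rewrite unitmxE unitfE.
have nL : n \in L by rewrite mem_filter SC // mem_iota add0n ltnS.
have ltn : (index n L < size L)%N by rewrite index_mem.
pose j0 := Ordinal ltn; pose w : 'rV[K]_(size L) := delta_mx 0 j0 *m invmx D.
pose q := \sum_i w 0 i *: subst (at_ u) (B i).
have atq : attained (at_ u) m q by apply: attained_sum => i _; apply: attainedZ; exists (B i).
have coefq s : S s -> (s <= m * d)%N -> q`_s = (s == n)%:R.
  move=> sS les; have sL : s \in L by rewrite mem_filter sS mem_iota add0n ltnS.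
  have lts : (index s L < size L)%N by rewrite index_mem.
  have := congr1 (fun v : 'rV[K]_(size L) => v 0 (Ordinal lts)) (mulmxKV uD (delta_mx 0 j0)).
  rewrite -/w [LHS]mxE [RHS]mxE eqxx andTb => e.
  transitivity (\sum_j w 0 j * D j (Ordinal lts)).
    rewrite /q coef_sum; apply: eq_bigr => i _;
      rewrite coefZ /D [in RHS]mxE [nat_of_ord _]/(index s L) nth_index //.
  rewrite e; congr (_%:R); congr nat_of_bool; apply/eqP/eqP => [/(congr1 val) e'|e'].
    by rewrite -(nth_index 0%N sL) [index _ _]e' nth_index.
  by apply: val_inj; rewrite [LHS]/(index s L) e'.
suff -> : 'X^n = q by [].
have nzq : q != 0.
  by apply: contra_eqN (coefq n (SC leC) len) => /eqP->; rewrite coef0 eqxx eq_sym oner_eq0.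
have [s [x nzx hs]] := exists_starts nzq.
have sS := ordS _ _ _ atq hs nzx.
have szq := attained_size atq.
have les : (s <= m * d)%N.
  by rewrite leqNgt; apply: contra nzx => lt; case: hs => _ <-;
    rewrite nth_default // (leq_trans szq).
have sn : s = n.
  by apply/eqP; move: nzx; case: hs => _ <-; rewrite coefq //; case: (s =P n) => // _;
    rewrite mulr0n eqxx.
apply/polyP => i; rewrite coefXn; have [lti|lei] := ltnP i n.
  by have [vq _] := hs; rewrite vq ?sn // ltn_eqF.
have [lei'|lti'] := leqP i (m * d); first by rewrite coefq // SC // (leq_trans leC).
rewrite nth_default; last exact: leq_trans szq lti'.
by rewrite gtn_eqF // (leq_ltn_trans len).
Qed.

End Open.

(** * A subalgebra of K[t] containing all high powers of t *)

Lemma ex_common_nonroot (K : numDomainType) (ps : seq {poly K}) :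
  (forall P, P \in ps -> P != 0) -> exists2 x, x != 0 & forall P, P \in ps -> P.[x] != 0.
Proof.
move=> nz; have [|x nx] := @ex_nonroot K ('X * \prod_(P <- ps) P).
  rewrite mulf_neq0 ?polyX_eq0 // prodf_seq_neq0; apply/allP => P Pps /=.
  exact: nz.
exists x; move: nx; rewrite hornerM hornerX mulf_eq0 negb_or => /andP[] // _ nx P Pps.
apply: contra nx => /eqP Px.
by rewrite horner_prod (big_rem P) //= Px mul0r.
Qed.

Lemma closed_root_list (K : closedFieldType) (P : {poly K}) : P != 0 ->
  exists rs : seq K, forall x, root P x -> x \in rs.
Proof.
have [rs PE] := closed_field_poly_normal P => nzP; exists rs => x.
by rewrite PE rootZ ?lead_coef_eq0 // root_prod_XsubC.
Qed.

Lemma exp_fibre (K : numClosedFieldType) e (s : K) : (0 < e)%N -> s != 0 ->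
  exists rs : seq K, [/\ uniq rs, size rs = e & forall r, r \in rs -> r ^+ e = s].
Proof.
move=> e0 nzs; have [zs PE] := closed_field_poly_normal ('X^e - 1 : {poly K}).
have monP : 'X^e - 1 \is @monic K by exact: monicXnsubC.
rewrite (monicP monP) scale1r in PE.
pose t := e.-root s; have tE : t ^+ e = s by apply: rootCK.
have nzt : t != 0 by apply: contraNneq nzs => t0; rewrite -tE t0 expr0n (gtn_eqF e0).
exists [seq t * z | z <- zs]; split.
- rewrite map_inj_uniq; last exact: mulfI.
  by rewrite -separable_prod_XsubC -PE separable_Xn_sub_1 // pnatr_eq0 -lt0n.
- have := congr1 (fun p : {poly K} => size p) PE.
  by rewrite size_XnsubC // size_prod_XsubC size_map => -[].
move=> r /mapP[z zz ->]; rewrite exprMn tE.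
have : root ('X^e - 1) z by rewrite PE root_prod_XsubC.
by rewrite /root !hornerE subr_eq0 => /eqP->; rewrite mulr1.
Qed.

Section Components.
Variables (K : fieldType) (e : nat).
Hypothesis e0 : (0 < e)%N.
Implicit Types (p q : {poly K}).

Definition component q j : {poly K} := \poly_(n < size q) q`_(n * e + j).

Lemma componentK q : q = \sum_(j < e) (component q j \Po 'X^e) * 'X^j.
Proof.
apply/polyP => i; rewrite coef_sum.
have lt : (i %% e < e)%N by rewrite ltn_mod.
rewrite (bigD1 (Ordinal lt)) //= big1 ?addr0 => [|j nej].
  rewrite coefMXn ltnNge leq_mod /= coef_comp_poly_Xn //.
  have -> : (i - i %% e)%N = (i %/ e * e)%N by rewrite {1}(divn_eq i e) addnK.
  rewrite dvdn_mull // mulnK // coef_poly -divn_eq; case: ltnP => // le.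
  by rewrite nth_default // (leq_trans le) // leq_div.
rewrite coefMXn; case: ltnP => // leji.
rewrite coef_comp_poly_Xn //; case: ifP => // dv; exfalso; case/eqP: nej.
apply: val_inj => /=; rewrite -[LHS](modn_small (ltn_ord j)).
by rewrite -[in RHS](subnK leji) -modnDml (eqP dv) add0n.
Qed.

(** The components are constant along a fibre of t^e. *)
Lemma horner_component q r : q.[r] = \sum_(j < e) (component q j).[r ^+ e] * r ^+ j.
Proof.
rewrite {1}(componentK q) horner_sum; apply: eq_bigr => j _.
by rewrite hornerM horner_comp !hornerXn.
Qed.

End Components.

Section Conductor.
Variables (K : numClosedFieldType) (e : nat) (Q : {poly K} -> Prop).
Hypothesis e0 : (0 < e)%N.
Hypotheses (Q1 : Q 1) (QD : forall p q, Q p -> Q q -> Q (p + q)).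
Hypotheses (QZ : forall k p, Q p -> Q (k *: p)) (QM : forall p q, Q p -> Q q -> Q (p * q)).
Hypothesis QX : Q 'X^e.

(** These p, evaluated at t^e, form the part in K[t^e] of the conductor of Q in
K[t], since 1, t, ..., t^(e-1) generate K[t] over K[t^e]. *)
Definition conducts (p : {poly K}) := forall j, (j < e)%N -> Q ((p \Po 'X^e) * 'X^j).

Lemma closed_sum I (r : seq I) (P : pred I) (F : I -> {poly K}) :
  (forall i, P i -> Q (F i)) -> Q (\sum_(i <- r | P i) F i).
Proof.
by move=> h; elim/big_rec: _ => [|i p Pi]; [rewrite -(scale0r 1); apply: QZ|apply/QD/h].
Qed.
Lemma closed_exp p k : Q p -> Q (p ^+ k).
Proof. by move=> Qp; elim: k => [|k IH] //; rewrite exprS; apply: QM. Qed.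
Lemma closed_comp p : Q (p \Po 'X^e).
Proof.
by rewrite comp_polyE; apply: closed_sum => i _; apply/QZ/closed_exp.
Qed.

(** Let W be the matrix of coordinates of 1, y, ..., y^(e-1) in the basis
1, t, ..., t^(e-1) of K[t] over K[t^e].  By Cramer's rule det W carries each t^j
into the algebra generated by t^e and y.  At s, multiplying W by the matrix of
powers of the points of the fibre gives the Vandermonde matrix of the values of
y, which are distinct. *)
Lemma conducts_det y s (rs : seq K) : Q y -> uniq rs -> size rs = e ->
  (forall r, r \in rs -> r ^+ e = s) ->
  (forall r r', r \in rs -> r' \in rs -> r != r' -> y.[r] != y.[r']) ->
  exists2 p, conducts p & p.[s] != 0.
Proof.
move=> Qy urs szrs rsE sep.
pose W : 'M[{poly K}]_e := \matrix_(k, j) component e (y ^+ k) j.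
exists (\det W).
  move=> j ltj; pose j' := Ordinal ltj.
  have -> : (\det W \Po 'X^e) * 'X^j = \sum_(k < e) ((\adj W j' k) \Po 'X^e) * y ^+ k.
    transitivity (\sum_(l < e) (((\adj W *m W) j' l) \Po 'X^e) * 'X^l).
      rewrite mul_adj_mx (bigD1 j') //= big1 ?addr0 => [|l nel]; last first.
        by rewrite mxE eq_sym (negPf nel) mulr0n comp_poly0 mul0r.
      by rewrite mxE eqxx mulr1n.
    rewrite (eq_bigr (fun l : 'I_e =>
      \sum_(k < e) ((\adj W j' k) \Po 'X^e) * ((W k l \Po 'X^e) * 'X^l))).
      rewrite exchange_big /=; apply: eq_bigr => k _; rewrite -mulr_sumr; congr (_ * _).
      by rewrite [RHS](componentK e0); apply: eq_bigr => l _; rewrite mxE.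
    move=> l _; rewrite mxE rmorph_sum /= mulr_suml; apply: eq_bigr => k _.
    by rewrite comp_polyM mulrA.
  by apply: closed_sum => k _; apply: QM; [apply: closed_comp|apply: closed_exp].
have lt (i : 'I_e) : (i < size rs)%N by rewrite szrs.
pose V : 'M[K]_e := \matrix_(l, i) (rs`_i) ^+ l.
pose yv : 'rV[K]_e := \row_i y.[rs`_i].
have WV : map_mx (horner_eval s) W *m V = Vandermonde e yv.
  apply/matrixP => k i; rewrite !mxE.
  transitivity ((y ^+ k).[rs`_i]); last by rewrite horner_exp.
  rewrite (horner_component e0); apply: eq_bigr => l _; rewrite !mxE /horner_eval.
  by rewrite rsE // mem_nth.
have nzV' : \det (Vandermonde e yv) != 0.
  rewrite det_Vandermonde; apply/prodf_neq0 => i _; apply/prodf_neq0 => j ltij.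
  rewrite !mxE subr_eq0; apply: sep; rewrite ?mem_nth //.
  by rewrite nth_uniq // gtn_eqF.
apply: contra nzV' => /eqP detW; rewrite -WV det_mulmx det_map_mx /=.
by rewrite [X in X * _]detW mul0r.
Qed.

Lemma conductsM p q : conducts p -> conducts (q * p).
Proof.
by move=> hp j ltj; rewrite comp_polyM -mulrA; apply: QM; [apply: closed_comp|apply: hp].
Qed.
Lemma conductsB p q : conducts p -> conducts q -> conducts (p - q).
Proof.
move=> hp hq j ltj; rewrite comp_polyB mulrBl -scaleN1r.
by apply: QD; [apply: hp|apply: QZ; apply: hq].
Qed.

(** The conducting polynomials form an ideal with no zero other than 0.
A nonzero element of least degree divides all the others, so it has no zero
other than 0 either, and is a multiple of a power. *)
Lemma eventually_closed_Xn :
  (forall s, s != 0 -> exists2 p, conducts p & p.[s] != 0) ->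
  exists n, forall i, (n <= i)%N -> Q 'X^i.
Proof.
move=> sepJ; pose P n := `[< exists2 p, conducts p & p != 0 /\ size p = n >].
have exP : exists n, P n.
  have [p hp np] := sepJ 1 (oner_neq0 _); exists (size p); apply/asboolP; exists p => //.
  by split=> //; apply: contraNneq np => ->; rewrite horner0.
have [n /asboolP[p hp [nzp szp]] minn] := ex_minnP exP.
have root0 s : root p s -> s = 0.
  move=> /rootP ps; apply/eqP; apply/negPn/negP => nzs; have [q hq nq] := sepJ s nzs.
  case/eqP: nq; rewrite (divp_eq q p) hornerD hornerM ps mulr0 add0r.
  have [->|nzr] := eqVneq (q %% p) 0; first by rewrite horner0.
  have : P (size (q %% p)).
    apply/asboolP; exists (q %% p) => //; have -> : q %% p = q - (q %/ p) * p.
      by rewrite {2}(divp_eq q p) addrC addKr.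
    by apply: conductsB => //; apply: conductsM.
  by move/minn; rewrite -szp leqNgt ltn_modp nzp.
have [rs pE] := closed_field_poly_normal p.
have rs0 : rs = nseq (size rs) 0.
  apply/all_pred1P/allP => r rrs /=; apply/eqP/root0.
  by rewrite pE rootZ ?lead_coef_eq0 // root_prod_XsubC.
have hX : conducts 'X^(size rs).
  have -> : 'X^(size rs) = (lead_coef p)^-1%:P * p.
    rewrite {2}pE mul_polyC scalerA mulVf ?lead_coef_eq0 // scale1r.
    by rewrite {2}rs0 big_nseq subr0 iter_mulr mulr1.
  exact: conductsM.
exists (size rs * e)%N => i lei.
have lt : (i %% e < e)%N by rewrite ltn_mod.
have := QM (closed_exp (i %/ e - size rs) QX) (hX _ lt).
have -> : 'X^(size rs) \Po 'X^e = 'X^e ^+ size rs :> {poly K} by rewrite rmorphXn /= comp_polyX.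
rewrite -!exprM mulrA -!exprD -mulnDr subnK; last by rewrite leq_divRL.
by rewrite mulnC -divn_eq.
Qed.
End Conductor.

(** * The base curve *)

Lemma rowpoly_coef (K : numClosedFieldType) d (P : 'I_4 -> {poly K}) i :
  (size (P i) <= d.+1)%N -> rowpoly (\matrix_(i < 4, j < d.+1) (P i)`_j) i = P i.
Proof.
move=> szP; apply/polyP => j; rewrite coef_rowpoly.
case: insubP => [j' _ <-|]; first by rewrite mxE.
by rewrite -leqNgt => le; rewrite nth_default // (leq_trans szP).
Qed.

Lemma attained_isolate (K : numClosedFieldType) d (A : 'M[K]_(4, d.+1)) m q n :
  attained A m q -> q`_n != 0 ->
  (forall i, i != n -> q`_i != 0 -> attained A m 'X^i) -> attained A m 'X^n.
Proof.
move=> hq nz other.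
have lt : (n < size q)%N.
  by rewrite ltnNge; apply: contra nz => le; rewrite nth_default.
have -> : 'X^n = (q`_n)^-1 *: (q - \sum_(i < size q | i != Ordinal lt) q`_i *: 'X^i).
  rewrite -[q in q - _]coefK poly_def (bigD1 (Ordinal lt)) //= addrK.
  by rewrite scalerA mulVf // scale1r.
apply/attainedZ/attainedB => //; apply: attained_sum => i nei.
have [->|nzi] := eqVneq q`_i 0; first by rewrite scale0r; apply: attained0.
by apply/attainedZ/other => //; apply: contra nei => /eqP e; apply/eqP/val_inj.
Qed.

Lemma coef_sum_Xn (K : nzRingType) (f : nat -> K) (ns : seq nat) i : uniq ns ->
  (\sum_(n <- ns) f n *: 'X^n)`_i = if i \in ns then f i else 0.
Proof.
move=> uns; rewrite coef_sum; case: ifP => ins.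
  rewrite (big_rem i) //= coefZ coefXn eqxx mulr1 big_seq big1 ?addr0 // => n nns.
  rewrite coefZ coefXn; case: eqP => [e|_]; last by rewrite mulr0.
  by move: nns; rewrite -e mem_rem_uniq // inE eqxx.
rewrite big_seq big1 // => n nns; rewrite coefZ coefXn; case: eqP => [e|_]; last by rewrite mulr0.
by rewrite e nns in ins.
Qed.

Section Base.
Variables (K : numClosedFieldType) (a b c d : nat).
Hypotheses (a2 : (2 <= a)%N) (ltab : (a < b)%N) (ltbc : (b < c)%N).
Hypotheses (cab : coprime a b) (cac : coprime a c) (cbc : coprime b c).
Hypothesis ltd : ((b * c + a * b).+1 < d)%N.

Local Notation e := (a * (c - b))%N.

(** Monomials p1 and p2 make p2/p1 a power of t.  The term t^(bc+ab) of p3 puts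
both t^(bc-ab) and t^(bc) into p3/p1, which keeps this quotient from being
invariant under a nontrivial e-th root of unity.  The parameter s lets p0
separate the remaining points, and the two highest terms of p0 make p0 - s^2 p3
a polynomial of degree exactly d - 1. *)
Definition base_poly (s : K) (i : 'I_4) : {poly K} :=
  nth 0 [:: 1 + s *: 'X^(d.-1) + s ^+ 2 *: 'X^d; 'X^(a * b); 'X^(a * c);
            'X^(b * c) + 'X^(b * c + a * b) + 'X^d] i.

Definition base_mx s : 'M[K]_(4, d.+1) := \matrix_(i < 4, j < d.+1) (base_poly s i)`_j.

Let ltac : (a * c < b * c)%N. Proof. by rewrite ltn_mul2r; lia. Qed.
Let leab : (a * b < a * c)%N. Proof. by rewrite ltn_mul2l; lia. Qed.
Let ab0 : (0 < a * b)%N. Proof. by rewrite muln_gt0; lia. Qed.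
Let e0 : (0 < e)%N. Proof. by rewrite muln_gt0; lia. Qed.
Let eE : (e + a * b = a * c)%N. Proof. by rewrite -mulnDr subnK // ltnW. Qed.

Lemma size_base s i : (size (base_poly s i) <= d.+1)%N.
Proof.
have sX n : (n <= d)%N -> (size ('X^n : {poly K}) <= d.+1)%N by rewrite size_polyXn.
have sD (p q : {poly K}) : (size p <= d.+1 -> size q <= d.+1 -> size (p + q)%R <= d.+1)%N.
  by move=> hp hq; apply: leq_trans (size_polyD _ _) _; rewrite geq_max hp.
have sZ k (p : {poly K}) : (size p <= d.+1 ->
  size (k *: p)%R <= d.+1)%N by apply: leq_trans (size_scale_leq _ _).
case: i => [[|[|[|[|i]]]] lti] //; rewrite /base_poly /=.
- by apply/sD; [apply/sD; [rewrite size_poly1|apply/sZ/sX; lia]|apply/sZ/sX].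
- by apply/sX; lia.
- by apply/sX; lia.
- by apply/sD; [apply/sD; apply/sX; lia|apply/sX].
Qed.

Lemma base_row s i : rowpoly (base_mx s) i = base_poly s i.
Proof. exact/rowpoly_coef/size_base. Qed.

(** The quotient p3/p1. *)
Definition sep3 : {poly K} := 'X^(b * c - a * b) + 'X^(b * c) + 'X^(d - a * b).
(** The quotient p0/p1 is not a polynomial; its product with t^(e ab), a power of
p2/p1, is. *)
Definition sep0 (s : K) : {poly K} := 'X^(e.-1 * (a * b)) * base_poly s ord0.

Lemma unity_trivial (z : K) : z ^+ (a * b) = 1 -> z ^+ (a * c) = 1 -> z ^+ (b * c) = 1 -> z = 1.
Proof.
move=> zab zac zbc; have [m prim _] := prim_order_exists ab0 zab.
have mab : (m %| a * b)%N by rewrite (prim_order_dvd prim) zab.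
have mac : (m %| a * c)%N by rewrite (prim_order_dvd prim) zac.
have mbc : (m %| b * c)%N by rewrite (prim_order_dvd prim) zbc.
have ma : (m %| a)%N.
  have : (m %| gcdn (a * b) (a * c))%N by rewrite dvdn_gcd mab.
  by rewrite -muln_gcdr (eqP cbc) muln1.
have m1 : m = 1%N.
  apply/eqP; rewrite -dvdn1 -(_ : gcdn a (b * c) = 1%N) ?dvdn_gcd ?ma //.
  by apply/eqP; rewrite -/(coprime _ _) coprimeMr cab.
by have := prim_expr_order prim; rewrite m1 expr1.
Qed.

(** The difference of the values of [sep3] at z t and t, as a polynomial in t. *)
Definition sep3_diff (z : K) : {poly K} :=
  \sum_(n <- [:: b * c - a * b; b * c; d - a * b]%N) (z ^+ n - 1) *: 'X^n.

(** Otherwise z^(bc) = z^(bc-ab) = 1, so z^(ab) = 1, and z^(ac) = 1 by z^e = 1; as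
ab, ac and bc have no common divisor, z = 1. *)
Lemma sep3_diff_neq0 z : z ^+ e = 1 -> z != 1 -> sep3_diff z != 0.
Proof.
move=> ze nz1; apply: contra nz1 => /eqP sep0_diff.
have un : uniq [:: b * c - a * b; b * c; d - a * b]%N by rewrite /= !inE !negb_or; lia.
have z1 n : n \in [:: b * c - a * b; b * c; d - a * b]%N -> z ^+ n = 1.
  move=> nin; have := coef_sum_Xn (fun n => z ^+ n - 1) n un.
  by rewrite -/(sep3_diff z) sep0_diff coef0 nin => /esym/eqP; rewrite subr_eq0 => /eqP.
have zbc : z ^+ (b * c) = 1 by apply: z1; rewrite !inE eqxx orbT.
have zab : z ^+ (a * b) = 1.
  have := zbc; rewrite -[(b * c)%N](@subnK (a * b)); last lia.
  by rewrite exprD z1 ?mem_head // mul1r.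
by apply/eqP/unity_trivial => //; rewrite -eE exprD ze zab mulr1.
Qed.

Lemma sep3_diffE z t : (sep3_diff z).[t] = sep3.[z * t] - sep3.[t].
Proof.
rewrite /sep3_diff /sep3 !big_cons big_nil addr0 !(hornerD, hornerZ, hornerXn) !exprMn.
ring.
Qed.

(** The difference of the values of [sep0] at z t and t, up to a power of t, as a
polynomial in the parameter of the base curve. *)
Definition sep0_diff (z t : K) : {poly K} :=
  (t ^+ d.-1 * (z ^+ (e.-1 * (a * b) + d.-1) - 1)) *: 'X +
  (t ^+ d * (z ^+ (e.-1 * (a * b) + d) - 1)) *: 'X^2 + (z ^+ (e.-1 * (a * b)) - 1)%:P.

(** The coefficients involve two consecutive powers of z, which cannot both be
1. *)
Lemma sep0_diff_neq0 z t : z != 1 -> t != 0 -> sep0_diff z t != 0.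
Proof.
move=> nz1 nzt; apply: contra nz1 => /eqP E.
have h1 : z ^+ (e.-1 * (a * b) + d.-1) = 1.
  have /eqP := congr1 (fun p : {poly K} => p`_1) E.
  rewrite !coefD !coefZ coefX coefXn coefC coef0 /= mulr1 mulr0 !addr0.
  by rewrite mulf_eq0 expf_eq0 (negPf nzt) andbF /= subr_eq0 => /eqP.
have h2 : z ^+ (e.-1 * (a * b) + d) = 1.
  have /eqP := congr1 (fun p : {poly K} => p`_2) E.
  rewrite !coefD !coefZ coefX coefXn coefC coef0 /= mulr1 mulr0 add0r !addr0.
  by rewrite mulf_eq0 expf_eq0 (negPf nzt) andbF /= subr_eq0 => /eqP.
apply/eqP; move: h2; rewrite -[d in (_ + d)%N](@prednK d); last by lia.
by rewrite addnS exprS h1 mulr1.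
Qed.

Lemma sep0_diffE z t s : (sep0 s).[z * t] - (sep0 s).[t] =
  t ^+ (e.-1 * (a * b)) * (sep0_diff z t).[s].
Proof.
rewrite /sep0 /sep0_diff /base_poly /= !(hornerM, hornerD, hornerZ, hornerXn, hornerX,
  hornerC) !exprMn !exprD.
ring.
Qed.

(** Points of one fibre of t^e differ by a root of unity z.  For each z different
from 1, [sep3] fails to separate z t and t for finitely many t only, and for each
such t different from 0, [sep0] separates them unless the parameter is one of
finitely many. *)
Lemma exists_separating : exists2 s, s != 0 & forall t t', t != 0 -> t ^+ e = t' ^+ e ->
  t != t' -> sep3.[t] = sep3.[t'] -> (sep0 s).[t] != (sep0 s).[t'].
Proof.
have nzU : 'X^e - 1 != 0 :> {poly K} by rewrite monic_neq0 // monicXnsubC.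
have [zs zsP] := closed_root_list nzU.
have tsP z : exists ts : seq K, z ^+ e = 1 -> z != 1 -> forall t,
  root (sep3_diff z) t -> t \in ts.
  have [[ze nz1]|H] := pselect (z ^+ e = 1 /\ z != 1); last by exists [::] => ? ?; case: H.
  by have [ts tsP] := closed_root_list (sep3_diff_neq0 ze nz1); exists ts.
have [ts tsP'] := choice tsP.
pose ps := [seq sep0_diff z t | z <- [seq z <- zs | z != 1], t <- [seq t <- ts z | t != 0]].
have [|s nzs sP] := @ex_common_nonroot K ps.
  move=> _ /allpairsPdep[z [t [zin tin ->]]].
  by move: zin tin; rewrite !mem_filter => /andP[nz1 _] /andP[nzt _]; apply: sep0_diff_neq0.
exists s => // t t' nzt te ntt' y3e.
have nzt' : t' != 0.
  by apply: contra nzt => /eqP t'0; move/eqP: te;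
    rewrite t'0 expr0n (gtn_eqF e0) expf_eq0 => /andP[].
pose z := t / t'; have tE : t = z * t' by rewrite divfK.
have ze : z ^+ e = 1 by rewrite expr_div_n te divff // expf_eq0 (negPf nzt') andbF.
have nz1 : z != 1 by apply: contra ntt' => /eqP z1; rewrite tE z1 mul1r.
rewrite -subr_eq0 tE sep0_diffE mulf_neq0 //; first by rewrite expf_eq0 (negPf nzt') andbF.
apply: sP; apply: allpairs_f_dep; rewrite mem_filter ?nz1 ?nzt' /=.
  by apply: zsP; rewrite /root !hornerE ze subrr.
by apply: tsP' => //; rewrite /root sep3_diffE -tE y3e subrr.
Qed.

Section Fixed.
Variable s : K.
Hypothesis nzs : s != 0.
Hypothesis sep : forall t t', t != 0 -> t ^+ e = t' ^+ e ->
  t != t' -> sep3.[t] = sep3.[t'] -> (sep0 s).[t] != (sep0 s).[t'].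

Local Notation A := (base_mx s).
Local Notation p0 := (base_poly s ord0).

(** The quotients of the pullbacks of forms of degree k by p1^k. *)
Definition quotient_attained (q : {poly K}) := exists k, attained A k (q * 'X^(a * b * k)).
Local Notation Q := quotient_attained.

Lemma attained_p0 : attained A 1 p0.
Proof. by have := attained_row A ord0; rewrite base_row. Qed.
Lemma attained_p1 : attained A 1 'X^(a * b).
Proof. by have := attained_row A i1; rewrite base_row. Qed.
Lemma attained_p2 : attained A 1 'X^(a * c).
Proof. by have := attained_row A i2; rewrite base_row. Qed.
Lemma attained_p3 : attained A 1 ('X^(b * c) + 'X^(b * c + a * b) + 'X^d).
Proof. by have := attained_row A i3; rewrite base_row. Qed.

Lemma quotient_lift q k k' : (k <= k')%N -> attained A k (q * 'X^(a * b * k)) ->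
  attained A k' (q * 'X^(a * b * k')).
Proof.
move=> le h; have := attainedM h (attained_exp (k' - k) attained_p1).
by rewrite muln1 subnKC // -mulrA -exprM -exprD -mulnDr subnKC.
Qed.

Lemma quotient1 : Q 1.
Proof. by exists 0%N; rewrite muln0 mulr1; apply: attained1. Qed.
Lemma quotientD p q : Q p -> Q q -> Q (p + q).
Proof.
move=> [k hk] [k' hk']; exists (maxn k k'); rewrite mulrDl; apply: attainedD.
  exact: quotient_lift (leq_maxl _ _) hk.
exact: quotient_lift (leq_maxr _ _) hk'.
Qed.
Lemma quotientZ l p : Q p -> Q (l *: p).
Proof. by move=> [k hk]; exists k; rewrite -scalerAl; apply: attainedZ. Qed.
Lemma quotientM p q : Q p -> Q q -> Q (p * q).
Proof.
move=> [k hk] [k' hk']; exists (k + k')%N; have := attainedM hk hk'.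
by rewrite mulrACA -exprD -mulnDr.
Qed.
Lemma quotientXe : Q 'X^e.
Proof. by exists 1%N; rewrite muln1 -exprD eE; apply: attained_p2. Qed.
Lemma quotient_sep3 : Q sep3.
Proof.
exists 1%N; rewrite muln1 /sep3 !mulrDl -!exprD !subnK; [exact: attained_p3|lia|lia].
Qed.
(** Multiplication by the quotient p0/p1, which is not a polynomial. *)
Lemma quotient_pull q : Q ('X^(a * b) * q) -> Q (p0 * q).
Proof.
move=> [k hk]; exists k.+1; have := attainedM attained_p0 hk.
by rewrite add1n mulnS exprD; congr attained; ring.
Qed.
Lemma quotient_sep0 : Q (sep0 s).
Proof.
rewrite /sep0 mulrC; apply: quotient_pull; rewrite -exprD -mulSn prednK // exprM.
exact: (closed_exp quotient1 quotientM _ quotientXe).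
Qed.

(** A general combination of [sep0] and [sep3] takes distinct values on a whole
fibre of t^e. *)
Lemma quotient_conductor t : t != 0 -> exists2 p, conducts e Q p & p.[t] != 0.
Proof.
move=> nzt; have [rs [urs szrs rsE]] := exp_fibre e0 nzt.
pose P (r r' : K) : {poly K} := ((sep0 s).[r] - (sep0 s).[r'])%:P + (sep3.[r] - sep3.[r']) *: 'X.
have [|m _ mP] := @ex_common_nonroot K [seq P r.1 r.2 | r <- [seq r <- allpairs pair rs rs |
  r.1 != r.2]].
  move=> _ /mapP[[r r'] /= rin ->]; move: rin;
    rewrite mem_filter /= => /andP[nerr /allpairsP[[x x'] /= [xin xin' [e1 e2]]]].
  subst x x'; apply/negP => /eqP E.
  have E0 : (sep0 s).[r] = (sep0 s).[r'].
    have /eqP := congr1 (fun p : {poly K} => p`_0) E.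
    by rewrite coefD coefC coefZ coefX mulr0 addr0 coef0 subr_eq0 => /eqP.
  have E1 : sep3.[r] = sep3.[r'].
    have /eqP := congr1 (fun p : {poly K} => p`_1) E.
    by rewrite coefD coefC coefZ coefX mulr1 add0r coef0 subr_eq0 => /eqP.
  have nzr : r != 0.
    by apply: contra nzt => /eqP r0; rewrite -(rsE _ xin) r0 expr0n (gtn_eqF e0).
  by case/eqP: (sep nzr (etrans (rsE _ xin) (esym (rsE _ xin'))) nerr E1).
apply: (@conducts_det K e Q e0 quotient1 quotientD quotientZ quotientM quotientXe (sep0 s + m
  *: sep3) t rs) => //.
  by apply/quotientD/quotientZ/quotient_sep3/quotient_sep0.
move=> r r' rin rin' nerr; rewrite -subr_eq0.
suff -> : (sep0 s + m *: sep3).[r] - (sep0 s + m *: sep3).[r'] = (P r r').[m].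
  apply: mP; apply/mapP; exists (r, r') => //; rewrite mem_filter nerr.
  by apply/allpairsP; exists (r, r').
by rewrite /P !(hornerD, hornerZ, hornerX, hornerC); ring.
Qed.

(** If t^(n + ab) is in the algebra, then so is p0 t^n, and p0 t^n - t^n consists of
higher powers of t.  This descends from the high powers to all. *)
Lemma quotient_Xn n : Q 'X^n.
Proof.
have [N QN] := eventually_closed_Xn e0 quotient1 quotientD quotientZ quotientM quotientXe
  quotient_conductor.
suff H k : forall n, (N - k <= n)%N -> Q 'X^n by apply: (H N); rewrite subnn.
elim: k => [|k IH] {n} n len; first by apply: QN; rewrite subn0 in len.
have [/IH//|ltn] := leqP (N - k) n.
have h : Q (p0 * 'X^n) by apply: quotient_pull; rewrite -exprD; apply: IH; move: ab0; lia.
have -> : 'X^n = p0 * 'X^n - (s *: 'X^(n + d.-1) + s ^+ 2 *: 'X^(n + d)).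
  rewrite /base_poly /= !mulrDl mul1r -!scalerAl -!exprD ![(n + _)%N]addnC.
  by move: (s *: _) (s ^+ 2 *: _) => u v; ring.
rewrite -scaleN1r; apply: quotientD => //; apply: quotientZ; apply: quotientD;
  apply/quotientZ/IH; lia.
Qed.

Lemma attained_seeds : exists k, forall n, (n <= 2 * d)%N -> attained A k 'X^(n + a * b * k).
Proof.
have /choice[f fP] n : exists k, attained A k ('X^n * 'X^(a * b * k)) by exact: quotient_Xn.
exists (\max_(n < (2 * d).+1) f n)%N => n len; rewrite exprD.
by apply: quotient_lift (fP n);
  apply: (@leq_bigmax _ (fun n : 'I_(2 * d).+1 => f n) (Ordinal (_ : n < (2 * d).+1)%N)).
Qed.

(** Multiplication by p1 raises the lower end of the interval by ab only.  With
p3, whose highest term is t^d, the upper end rises by d, the two other terms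
being removed by induction. *)
Lemma attained_grow m x y : (x + 2 * d <= y)%N ->
  (forall n, (x <= n <= y)%N -> attained A m 'X^n) ->
  forall n, (x + a * b <= n <= y + d)%N -> attained A m.+1 'X^n.
Proof.
move=> lexy h; elim/ltn_ind => n IH /andP[len ltn].
have [le|lt] := leqP n (y + a * b).
  have := attainedM (h (n - a * b)%N _) attained_p1; rewrite -exprD subnK ?addn1; last lia.
  by apply; lia.
have hd : attained A m 'X^(n - d) by apply: h; lia.
have := attainedM hd attained_p3; rewrite !mulrDr -!exprD addn1 => hq.
have -> : 'X^n = 'X^(n - d + b * c) + 'X^(n - d + (b * c + a * b)) + 'X^(n - d + d) -
   ('X^(n - d + b * c) + 'X^(n - d + (b * c + a * b))) :> {poly K}.
  by rewrite addrAC subrr add0r subnK //; lia.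
by apply: attainedB => //; apply: attainedD; apply: IH; lia.
Qed.

Lemma attained_middle : exists k, forall m n,
  (k * (a * b) + m * (a * b) <= n <= k * (a * b) + 2 * d + m * d)%N ->
  attained A (k + m) 'X^n.
Proof.
have [k kP] := attained_seeds; exists k; elim=> [|m IH] n.
  rewrite !mul0n !addn0 => /andP[h1 h2].
  have -> : n = (n - k * (a * b) + a * b * k)%N by rewrite [(a * b * k)%N]mulnC subnK.
  by apply: kP; lia.
move=> H; rewrite addnS; apply: (attained_grow (x := k * (a * b) + m * (a * b)) (y :=
  k * (a * b) + 2 * d + m * d)) IH _ _.
  have : (m * (a * b) <= m * d)%N by rewrite leq_mul2l; apply/orP; right; lia.
  lia.
by move: H; rewrite !mulSn; lia.
Qed.

(** A combination of the rows of degree exactly d - 1, needed to reach the degrees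
just below md. *)
Definition subtop : {poly K} := p0 - s ^+ 2 *: ('X^(b * c) + 'X^(b * c + a * b) + 'X^d).

Lemma attained_subtop : attained A 1 subtop.
Proof. by apply: attainedB attained_p0 _; apply/attainedZ/attained_p3. Qed.

Lemma size_subtop : size subtop = d.
Proof.
have -> : subtop = s *: 'X^(d.-1) + (1 - s ^+ 2 *: ('X^(b * c) + 'X^(b * c + a * b))).
  by rewrite /subtop /base_poly /= !scalerDr; ring.
have d1 : (d.-1.+1 = d)%N by apply: prednK; lia.
rewrite size_polyDl size_scale // size_polyXn d1 //.
apply: leq_ltn_trans (size_polyD _ _) _; rewrite gtn_max size_poly1 size_polyN.
apply/andP; split; first lia.
apply: leq_ltn_trans (size_scale_leq _ _) _; apply: leq_ltn_trans (size_polyD _ _) _.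
by rewrite gtn_max !size_polyXn; lia.
Qed.

Lemma starts_p3 : starts (b * c) 1 ('X^(b * c) + 'X^(b * c + a * b) + 'X^d : {poly K}).
Proof.
apply: startsD_ord; first apply: startsD_ord; first exact: starts_Xn.
  by apply: ord_ge_leq (starts_ord (starts_Xn _ _)); lia.
by apply: ord_ge_leq (starts_ord (starts_Xn _ _)); lia.
Qed.

Lemma size_p3 : size ('X^(b * c) + 'X^(b * c + a * b) + 'X^d : {poly K}) = d.+1.
Proof.
rewrite addrC size_polyDl size_polyXn //.
by apply: leq_ltn_trans (size_polyD _ _) _; rewrite gtn_max !size_polyXn; lia.
Qed.

(** The product of the m - j th power of p3 and the j th power of the row
combination of degree d - 1 has degree md - j.  For large m and j < kd, all its
terms lie above m ab, so the lower ones are removed by induction. *)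
Lemma base_attained_top : exists m0, forall m n,
  (m0 <= m)%N -> (m * (a * b) <= n)%N -> (n <= m * d)%N ->
  attained A m 'X^n.
Proof.
(* So large that (m - j) bc >= m ab whenever j < kd. *)
have [k kP] := attained_middle; exists (k + b * c * (k * d))%N => m n lem.
have [m' mE] : exists m', m = (k + m')%N by exists (m - k)%N; lia.
elim/ltn_ind: n => n IH le1 le2.
have [le|lt] := leqP n (k * (a * b) + 2 * d + m' * d).
  by rewrite mE; apply: kP; move: le1; rewrite mE mulnDl le andbT.
have [j jE] : exists j, (n + j = m * d)%N by exists (m * d - n)%N; rewrite subnKC.
have d0 : (0 < d)%N by lia.
have ltj : (j < k * d)%N by move: jE; rewrite mE mulnDl; lia.
have lej : (j <= m)%N.
  have : (1 * (k * d) <= b * c * (k * d))%N by rewrite leq_mul2r muln_gt0; lia.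
  lia.
set p3 : {poly K} := 'X^(b * c) + 'X^(b * c + a * b) + 'X^d.
have atq : attained A m (p3 ^+ (m - j) * subtop ^+ j).
  have := attainedM (attained_exp (m - j) attained_p3) (attained_exp j attained_subtop).
  by rewrite !muln1 subnK.
have nzp3 : p3 != 0 by rewrite -size_poly_eq0 size_p3.
have nz_subtop : subtop != 0 by rewrite -size_poly_eq0 size_subtop; lia.
have szq : size (p3 ^+ (m - j) * subtop ^+ j) = n.+1.
  have sE (p : {poly K}) r : p != 0 -> size (p ^+ r) = ((size p).-1 * r).+1.
    by move=> nzp; rewrite -size_exp prednK // size_poly_gt0 expf_neq0.
  rewrite size_mul ?expf_neq0 // !sE // size_p3 size_subtop /=.
  have e1 : ((m - j) * d + j * d = m * d)%N by rewrite -mulnDl subnK.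
  have e2 : (d.-1 * j + j = j * d)%N by rewrite [(d.-1 * j)%N]mulnC addnC -mulnS prednK.
  rewrite [(d * _)%N]mulnC addnS; congr _.+1; move: e1 e2 jE.
  by move: ((m - j) * d)%N (j * d)%N (m * d)%N (d.-1 * j)%N => u v w x; clear; lia.
apply: (attained_isolate atq).
  by rewrite -[n]/(n.+1.-1) -szq -lead_coefE lead_coef_eq0 -size_poly_eq0 szq.
move=> i nei nzi.
have ltin : (i < n)%N.
  have : (i < n.+1)%N by rewrite -szq ltnNge; apply: contra nzi => le; rewrite nth_default.
  by rewrite ltnS leq_eqVlt (negPf nei).
apply: IH => //; last by lia.
apply: leq_trans (_ : (m - j) * (b * c) <= _)%N.
  have h1 : (m * (a * b).+1 <= m * (b * c))%N by rewrite leq_mul2l; lia.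
  have h2 : (j * (b * c) <= k * d * (b * c))%N by rewrite leq_mul2r ltnW ?orbT.
  by rewrite mulnBl; move: h1; rewrite mulnS; lia.
rewrite leqNgt; apply: contra nzi => lti.
have [vq _] := starts_exp (m - j) starts_p3.
by apply/eqP; apply: (@ord_geMr _ _ _ (subtop ^+ j) vq).
Qed.

Lemma base_starts0 : starts 0 1 (rowpoly A ord0).
Proof.
rewrite base_row; split=> //; rewrite /base_poly /= !coefD !coefZ coef1 !coefXn.
have -> : (0 == d.-1)%N = false by lia.
have -> : (0 == d)%N = false by lia.
by rewrite !mulr0 !addr0.
Qed.
Lemma base_starts1 : starts (a * b) 1 (rowpoly A i1).
Proof. by rewrite base_row; apply: starts_Xn. Qed.
Lemma base_starts2 : starts (a * c) 1 (rowpoly A i2).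
Proof. by rewrite base_row; apply: starts_Xn. Qed.
Lemma base_starts3 : starts (b * c) 1 (rowpoly A i3).
Proof. by rewrite base_row; apply: starts_p3. Qed.

(** Below m ab, a power t^n is the lowest term of a product of powers of the
rows, and the higher terms are removed by descending induction. *)
Lemma base_full : exists m0, forall m, (m0 <= m)%N -> full A (conductor a b c) m.
Proof.
have [m0 top] := base_attained_top; exists m0 => m lem n leC len.
move: {2}(m * d - n)%N (leqnn (m * d - n)) => w; elim/ltn_ind: w n leC len => w IH n leC len lew.
have [le|lt] := leqP (m * (a * b)) n; first exact: top.
have /asboolP[i [j [k nE]]] : inS a b c n by apply: (inS_large a2 ltab ltbc cab cac cbc).
have leijk : (i + j + k <= m)%N.
  rewrite -(leq_pmul2r ab0); apply: leq_trans (ltnW lt); rewrite nE /weight !mulnDl.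
  have lebc : (a * b <= b * c)%N := leq_trans (ltnW leab) (ltnW ltac).
  by apply: leq_add; [apply: leq_add => //|]; rewrite leq_mul2l ?lebc ?(ltnW leab) orbT.
have [q atq hq] := attained_weight base_starts0 base_starts1 base_starts2 base_starts3 leijk.
rewrite -nE in hq; have [ordq q1] := hq.
apply: (attained_isolate atq); first by rewrite q1 oner_neq0.
move=> l nel nzl.
have ltl : (n < l)%N.
  rewrite ltn_neqAle eq_sym nel leqNgt; apply: contra nzl => lt'.
  by rewrite ordq.
have lel : (l <= m * d)%N.
  rewrite leqNgt; apply: contra nzl => lt'; rewrite nth_default //.
  exact: leq_trans (attained_size atq) lt'.
by apply: (IH (m * d - l)%N) => //; lia.
Qed.

End Fixed.
End Base.

(** * The equisingular family *)

(** A truncated geometric series. *)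
Lemma starts0_inverse (R : comNzRingType) (f : {poly R}) C : starts 0 1 f -> (0 < C)%N ->
  exists2 phi, starts 0 1 phi & ord_ge C (phi * f - 1).
Proof.
move=> [_ f0] C0; pose g := f - 1.
have g1 : ord_ge 1 g by move=> i; rewrite ltnS leqn0 => /eqP->; rewrite coefB coef1 f0 subrr.
pose phi := \sum_(i < C) (- g) ^+ i.
have hphi : ord_ge C (phi * f - 1).
  have -> : phi * f - 1 = - (- g) ^+ C.
    have := subrX1 (- g) C; rewrite -/phi => E.
    by rewrite -[(- g) ^+ C](subrK 1) E /g; ring.
  apply: ord_geN; elim: (C) => [i|n IH] //.
  by rewrite exprS -add1n; apply: ord_geM => //; apply: ord_geN.
exists phi => //; split=> //.
have := hphi _ C0; rewrite coefB coef1 eqxx coefM big_ord_recl big_ord0 addr0 /= f0 mulr1.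
by move/eqP; rewrite subr_eq0 => /eqP.
Qed.

Lemma ord_ge_map (R R' : comNzRingType) (ev : {rmorphism R -> R'}) n (q : {poly R}) :
  ord_ge n q -> ord_ge n (map_poly ev q).
Proof. by move=> hq i lti; rewrite coef_map /= hq ?rmorph0. Qed.
Lemma starts_map (R R' : comNzRingType) (ev : {rmorphism R -> R'}) n x (q : {poly R}) :
  starts n x q -> starts n (ev x) (map_poly ev q).
Proof. by move=> [hq <-]; split; [apply: ord_ge_map|rewrite coef_map]. Qed.

Section Equisingular.
Variables (K : numClosedFieldType) (a b c d : nat).

(** The series [phi] is the inverse of p0 modulo t^C, so that x, y, z are
coordinates at the cusp. *)
Definition equisingular (A : 'M[K]_(4, d.+1)) := exists phi ey ez,
  let x := phi * rowpoly A i1 in let y := phi * rowpoly A i2 in let z := phi * rowpoly A i3 in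
  let C := conductor a b c in
  [/\ [/\ starts 0 1 (rowpoly A ord0), starts (a * b) 1 (rowpoly A i1),
          starts (a * c) 1 (rowpoly A i2) & starts (b * c) 1 (rowpoly A i3)],
      starts 0 1 phi, ord_ge C (phi * rowpoly A ord0 - 1),
      ord_ge C (x ^+ c - y ^+ b - tail a b c C ey x y z) &
      ord_ge C (x ^+ c - z ^+ a - tail a b c C ez x y z)].
End Equisingular.

Section Family.
Variables (K : numClosedFieldType) (a b c d : nat).
Hypotheses (a4 : (4 <= a)%N) (ltab : (a < b)%N) (ltbc : (b < c)%N).
Hypotheses (cab : coprime a b) (cac : coprime a c) (cbc : coprime b c).
Local Notation C := (conductor a b c).
Local Notation inS := (inS a b c).
Local Notation abc := (a * b * c)%N.
Hypothesis leCd : (C <= d)%N.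
Let a2 : (2 <= a)%N := ltnW (ltnW a4).

Let ltac : (a * c < b * c)%N. Proof. by rewrite ltn_mul2r; lia. Qed.
Let leab : (a * b < a * c)%N. Proof. by rewrite ltn_mul2l; lia. Qed.
Let ab0 : (0 < a * b)%N. Proof. by rewrite muln_gt0; lia. Qed.
Let ltabcC : (abc < C)%N.
Proof.
have h : (4 * (b * c) <= a * (b * c))%N by rewrite leq_mul2r a4 orbT.
by rewrite ltnS; have := frobE a2 ltab ltbc; move: (frob a b c) => F; lia.
Qed.
Lemma degree_bound : ((b * c + a * b).+1 < d)%N.
Proof.
have h : (4 * (b * c) <= a * (b * c))%N by rewrite leq_mul2r a4 orbT.
apply: leq_trans leCd; rewrite ltnS; have := frobE a2 ltab ltbc; move: (frob a b c) => F; lia.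
Qed.
Let ltd := degree_bound.
Let bcabc : (b * c <= abc)%N. Proof. by rewrite -mulnA leq_pmull //; lia. Qed.
Let leCbc n : (n < C)%N -> (n + b * c < d + abc)%N.
Proof. by move=> ltn; move: bcabc leCd; lia. Qed.

Definition lead (i : 'I_4) := nth 0%N [:: 0; a * b; a * c; b * c]%N i.
(** The coefficients which are used to solve the relations, one for each of p2, p3
and each gap greater than abc. *)
Definition determined (i : 'I_4) j :=
  (1 < i)%N && has (fun n => j + abc == n + lead i)%N (high_gaps a b c).
Definition free_entry (i : 'I_4) j := (lead i < j)%N && ~~ determined i j.

Local Notation R := {mpoly K[4 * d.+1]}.

Definition start_coef i j : R :=
  if (j < lead i)%N then 0 else if (j == lead i)%N then 1
  else if determined i j then 0 else 'X_(mxvec_index i (inord j)).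
Definition start_poly i : {poly R} := \poly_(j < d.+1) start_coef i j.

Lemma lead_leq i : (lead i <= d)%N.
Proof. by case: i => [[|[|[|[|i]]]] lti] //; rewrite /lead /=; move: ltd ltac leab; lia. Qed.

Lemma starts_start_poly i : starts (lead i) 1 (start_poly i).
Proof.
split=> [j ltj|]; rewrite coef_poly /start_coef; last by rewrite ltnn eqxx ltnS lead_leq.
by rewrite ltj; case: ifP.
Qed.

Section BasePoint.
Variable s : K.
Hypothesis nzs : s != 0.
Definition base_point v : K := mxvec (base_mx a b c d s) 0 v.

Lemma base_starts i : starts (lead i) 1 (base_poly a b c d s i).
Proof.
case: i => [[|[|[|[|i]]]] lti] //; rewrite /lead /=.
- by have := base_starts0 a2 ltab ltbc cab cac cbc ltd nzs;
    rewrite base_row // (_ : Ordinal lti = ord0) //; apply: val_inj.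
- exact: starts_Xn.
- exact: starts_Xn.
  by have := starts_p3 a2 ltab ltbc cab cac cbc ltd nzs.
Qed.

Lemma high_gapP n : n \in high_gaps a b c -> [/\ (abc < n)%N, ~~ inS n & (n < C)%N].
Proof. by rewrite !mem_filter mem_iota add0n => /and3P[]. Qed.

(** The only terms to be examined are t^(bc+ab) and t^d in p3.  The first would
correspond to abc + ab, which is not a gap, and the second to an exponent beyond
the conductor. *)
Lemma base_determined i j : determined i j -> (base_poly a b c d s i)`_j = 0.
Proof.
move=> /andP[i2' /hasP[n /high_gapP[ltn nS ltnC] /eqP jE]].
have neq (m : nat) : (j != m)%N -> ('X^m : {poly K})`_j = 0 by move=> ne;
  rewrite coefXn (negPf ne).
case: i i2' jE => [[|[|[|[|i]]]] lti] // _; rewrite /lead /base_poly /= => jE.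
  by rewrite neq //; lia.
rewrite !coefD !neq ?addr0 //; [| |lia].
  by have := leCbc ltnC; lia.
apply: contra nS => /eqP jE'; have -> : n = (c * (a * b) + 1 * (a * b))%N by move: jE;
  rewrite jE'; lia.
by apply/asboolP; exists (c + 1)%N, 0%N, 0%N; rewrite /weight mulnDl !mul0n !addn0.
Qed.

Lemma map_start_poly i : map_poly (meval base_point) (start_poly i) = base_poly a b c d s i.
Proof.
apply/polyP => j; rewrite coef_map coef_poly /=; case: ltnP => ltj; last first.
  by rewrite meval0 nth_default // (leq_trans (size_base a2 ltab ltbc cab cac cbc ltd s i)).
have [ordb coefb] := base_starts i.
rewrite /start_coef; case: ltnP => lej; first by rewrite meval0 ordb.
case: eqP => [->|_]; first by rewrite meval1 coefb.
case: ifP => [dj|_]; first by rewrite meval0 base_determined.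
by rewrite mevalXU /base_point mxvecE mxE inordK.
Qed.

Lemma supported_Xn n : inS n || (C <= n)%N -> supported a b c ('X^n : {poly K}).
Proof.
move=> h i lti iS; rewrite coefXn; case: eqP => // e; move: h; rewrite -e (negPf iS) /=.
by rewrite leqNgt lti.
Qed.

Lemma supported_ord (q : {poly K}) : ord_ge C q -> supported a b c q.
Proof. by move=> hq i lti _; apply: hq. Qed.

Lemma supported_base (i : 'I_4) : (0 < i)%N -> supported a b c (base_poly a b c d s i).
Proof.
have sX i' j' k' n : n = weight a b c i' j' k' -> supported a b c ('X^n : {poly K}).
  by move=> ->; apply: supported_Xn; rewrite inS_weight.
case: i => [[|[|[|[|i]]]] lti] // _; rewrite /base_poly /=.
- by apply: (sX 1%N 0%N 0%N); rewrite /weight; ring.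
- by apply: (sX 0%N 1%N 0%N); rewrite /weight; ring.
- apply: supportedD; last by apply: supported_Xn; rewrite leCd orbT.
  by apply: supportedD; [apply: (sX 0 0 1)%N|apply: (sX 1 0 1)%N]; rewrite /weight; ring.
Qed.

(** Modulo t^(C-1) the base curve has p0 = 1, and the other rows are divisible by
t, so dividing them by p0 changes nothing below t^C. *)
Lemma supported_quotient (psi : {poly K}) (i : 'I_4) : (0 < i)%N ->
  ord_ge C (psi * base_poly a b c d s ord0 - 1) -> supported a b c (psi * base_poly a b c d s i).
Proof.
move=> i0 hpsi.
have psi1 : ord_ge C.-1 (psi - 1).
  have -> : psi - 1 = (psi * base_poly a b c d s ord0 - 1) - psi * (base_poly a b c d s ord0 -
    1) by ring.
  apply: ord_geB; first by apply: ord_ge_leq hpsi; apply: leq_pred.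
  apply: ord_geMl; have -> : base_poly a b c d s ord0 - 1 = s *: 'X^(d.-1) + s ^+ 2 *: 'X^d.
    by rewrite /base_poly /=; move: (s *: _) (s ^+ 2 *: _) => u v; ring.
  apply: ord_geD; apply: ord_geZ;
    by apply: ord_ge_leq (starts_ord (starts_Xn _ _)); move: leCd; lia.
have -> : psi * base_poly a b c d s i =
  base_poly a b c d s i + (psi - 1) * base_poly a b c d s i by ring.
apply: supportedD; first exact: supported_base.
apply: supported_ord; rewrite -[C]/(C.-1.+1) -addn1; apply: ord_geM => //.
apply: ord_ge_leq (starts_ord (base_starts i)).
by case: i i0 => [[|[|[|[|i]]]] lti] // _; rewrite /lead /=; move: ab0 leab ltac; lia.
Qed.

(** Start with rows whose coefficients are independent variables, except that the
leading ones are 1 and the determined ones 0, and solve the relations.  At the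
base point the rows divided by p0 are supported on S modulo t^C, so that solving
changes nothing there, and the base curve is a member of the family. *)
Lemma equisingular_family : exists Phi : 'M[R]_(4, d.+1),
  [/\ Phi ord0 ord0 = 1,
      forall i (j : 'I_d.+1), free_entry i j -> Phi i j = 'X_(mxvec_index i j),
      map_mx (meval base_point) Phi = base_mx a b c d s &
      forall u, equisingular a b c (map_mx (meval u) Phi)].
Proof.
have [phi hphi phi_inv] := starts0_inverse (starts_start_poly ord0) (isT : 0 < C)%N.
have inv n : (0 < n)%N -> (n%:R : R) * (n%:R^-1)%:MP = 1.
  by move=> n0; rewrite -mpolyC_nat -mpolyCM divff ?mpolyC1 // pnatr_eq0 -lt0n.
have hpsi : ord_ge C (map_poly (meval base_point) phi * base_poly a b c d s ord0 - 1).
  have := ord_ge_map (meval base_point) phi_inv.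
  by rewrite rmorphB rmorphM rmorph1 /= map_start_poly.
have supp (i : 'I_4) : (0 < i)%N ->
  supported a b c (map_poly (meval base_point) (phi * start_poly i)).
  by move=> i0; rewrite rmorphM /= map_start_poly; apply: supported_quotient.
have [f2' [f3' [e [e' [adj2 adj3 D2 D3]]]]] := solve_relations a2 ltab ltbc cab cac cbc
  (inv a ltac:(lia)) (inv b ltac:(lia)) hphi (starts_start_poly i1) (starts_start_poly i2)
  (starts_start_poly i3) (supp i1 isT) (supp i2 isT) (supp i3 isT) ltabcC.
have [h2 ev2 adj2'] := adj2; have [h3 ev3 adj3'] := adj3.
pose F (i : 'I_4) := nth 0 [:: start_poly ord0; start_poly i1; f2'; f3'] i.
have Fstart i j : ~~ determined i j -> (F i)`_j = (start_poly i)`_j.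
  move=> ndet; case: i ndet => [[|[|[|[|i]]]] lti] // ndet; rewrite /F /=.
  - by congr (start_poly _)`_ _; apply: val_inj.
  - by congr (start_poly _)`_ _; apply: val_inj.
  - apply/eqP; rewrite (_ : Ordinal lti = i2); last exact: val_inj.
    apply: contraNT ndet => /adj2'[n nG nE]; apply/andP; split=> //.
    by apply/hasP; exists n => //; rewrite nE.
  - apply/eqP; rewrite (_ : Ordinal lti = i3); last exact: val_inj.
    apply: contraNT ndet => /adj3'[n nG nE]; apply/andP; split=> //.
    by apply/hasP; exists n => //; rewrite nE.
have szF i j : (d < j)%N -> (F i)`_j = 0.
  move=> ltj; rewrite Fstart; first by rewrite coef_poly ltnNge ltj.
  apply/negP => /andP[_ /hasP[n /high_gapP[_ _ ltn] /eqP jE]].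
  have := leCbc ltn; have : (lead i <= b * c)%N.
    by case: i {Fstart} jE => [[|[|[|[|i]]]] lti] // _; rewrite /lead /=; move: leab ltac; lia.
  by move: jE; lia.
have hF i : starts (lead i) 1 (F i).
  case: i => [[|[|[|[|i]]]] lti] //; rewrite /F /lead /=.
  - exact: (starts_start_poly ord0).
  - exact: (starts_start_poly i1).
have evF i : map_poly (meval base_point) (F i) = base_poly a b c d s i.
  rewrite -map_start_poly; case: i => [[|[|[|[|i]]]] lti] //; rewrite /F /=.
  - by congr (map_poly _ (start_poly _)); apply: val_inj.
  - by congr (map_poly _ (start_poly _)); apply: val_inj.
  - by rewrite ev2; congr (map_poly _ (start_poly _)); apply: val_inj.
  - by rewrite ev3; congr (map_poly _ (start_poly _)); apply: val_inj.
pose Phi : 'M[R]_(4, d.+1) := \matrix_(i, j) (F i)`_j.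
have rowF u i : rowpoly (map_mx (meval u) Phi) i = map_poly (meval u) (F i).
  apply/polyP => j; rewrite coef_rowpoly coef_map /=; case: insubP => [j' _ <-|].
    by rewrite !mxE.
  by rewrite -leqNgt => ltj; rewrite szF ?meval0.
exists Phi; split.
- by rewrite mxE; case: (hF ord0).
- move=> i j /andP[ltj ndet]; rewrite mxE Fstart // coef_poly ltn_ord /start_coef.
  by rewrite ltnNge (ltnW ltj) /= gtn_eqF // (negPf ndet) inord_val.
- by apply/matrixP => i j; rewrite !mxE -coef_map /= evF.
move=> u; exists (map_poly (meval u) phi), (fun n => (e n).@[u]), (fun n => (e' n).@[u]).
rewrite !rowF /=.
have map_tail (e1 : nat -> R) x y z : map_poly (meval u) (tail a b c C e1 x y z) =
   tail a b c C (fun n => (e1 n).@[u]) (map_poly (meval u) x) (map_poly (meval u) y) (map_poly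
     (meval u) z).
  rewrite /tail rmorph_sum; apply: eq_bigr => n _; rewrite /= map_polyZ /mono.
  by rewrite !rmorphM !rmorphXn.
have map1 n q : starts n 1 q -> starts n 1 (map_poly (meval u) q).
  by move=> /(starts_map (meval u)); rewrite /= meval1.
split.
- by split; apply: map1; [apply: (hF ord0)|apply: (hF i1)|apply: (hF i2)|apply: (hF i3)].
- exact: map1.
- by have := ord_ge_map (meval u) phi_inv; rewrite rmorphB rmorphM rmorph1.
- by have := ord_ge_map (meval u) D2; rewrite /defect !rmorphB !rmorphXn /= map_tail !rmorphM.
- by have := ord_ge_map (meval u) D3; rewrite /defect !rmorphB !rmorphXn /= map_tail !rmorphM.
Qed.
End BasePoint.

End Family.

(** * The number of parameters *)

Section FreeCount.
Variables (a b c d : nat).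
Hypothesis lead_leq : forall i, (lead a b c i <= d)%N.

Definition free_positions : {set 'I_4 * 'I_d.+1} :=
  [set t : 'I_4 * 'I_d.+1 | free_entry a b c t.1 t.2].

(** Leading terms take ab + ac + bc + 4 coefficients, and each gap greater than abc
takes one in each of two rows. *)
Lemma card_free_positions :
  (4 * d.+1 <= #|free_positions| + (a * b + a * c + b * c + 2 * size (high_gaps a b c) + 4))%N.
Proof.
pose below i := [seq (i, inord j : 'I_d.+1) | j <- iota 0 (lead a b c i).+1].
pose solved i := [seq (i, inord (n + lead a b c i - a * b * c) : 'I_d.+1) | n <- high_gaps a b c].
pose l := below ord0 ++ below i1 ++ below i2 ++ below i3 ++ solved i2 ++ solved i3.
have szl : size l = (a * b + a * c + b * c + 2 * size (high_gaps a b c) + 4)%N.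
  by rewrite !size_cat !size_map !size_iota /lead /=; lia.
have -> : (4 * d.+1 = #|free_positions| + #|~: free_positions|)%N.
  by rewrite cardsC card_prod !card_ord.
have sub_below i : {subset below i <= l}.
  move=> x; case: i => [[|[|[|[|i]]]] lti]; last by [].
  - by rewrite (_ : Ordinal lti = ord0); [rewrite /l !mem_cat => ->|exact: val_inj].
  - by rewrite (_ : Ordinal lti = i1); [rewrite /l !mem_cat => ->; rewrite !orbT|exact: val_inj].
  - by rewrite (_ : Ordinal lti = i2); [rewrite /l !mem_cat => ->; rewrite !orbT|exact: val_inj].
  - by rewrite (_ : Ordinal lti = i3); [rewrite /l !mem_cat => ->; rewrite !orbT|exact: val_inj].
have sub_solved (i : 'I_4) : (1 < i)%N -> {subset solved i <= l}.
  move=> i2' x; case: i i2' => [[|[|[|[|i]]]] lti] // _.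
  - by rewrite (_ : Ordinal lti = i2); [rewrite /l !mem_cat => ->; rewrite !orbT|exact: val_inj].
  - by rewrite (_ : Ordinal lti = i3); [rewrite /l !mem_cat => ->; rewrite !orbT|exact: val_inj].
rewrite leq_add2l -szl cardE; apply: uniq_leq_size; first exact: enum_uniq.
move=> [i j]; rewrite mem_enum !inE /free_entry /= negb_and negbK -leqNgt => /orP[lej|].
  apply: (sub_below i).
  by apply/mapP; exists (val j); rewrite ?inord_val // mem_iota.
move=> /andP[i2' /hasP[n nG /eqP jE]]; apply: (sub_solved i i2').
by apply/mapP; exists n => //; rewrite -jE addnK inord_val.
Qed.
End FreeCount.

Lemma mxvec_index_inj m n : injective (fun t : 'I_m * 'I_n => mxvec_index t.1 t.2).
Proof.
move=> [i j] [i' j'] /= e.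
have [g gK _] := curry_mxvec_bij m n.
have := gK (i, j) isT; rewrite /= e; have := gK (i', j') isT => /= -> //.
Qed.

Section MorphismsCone.
Variables (K : numClosedFieldType) (n d : nat).
Implicit Types A : 'M[K]_(n.+1, d.+1).

Lemma map_eval_scale A l P : map_eval (l *: A) P = l *: map_eval A P.
Proof.
apply/rowP => i; rewrite !mxE /binary_form !raddf_sum /= mulr_sumr.
by apply: eq_bigr => j _; rewrite !mevalZ mxE mulrA.
Qed.

Lemma morphisms_scale A l : @morphisms K n d A -> l != 0 -> @morphisms K n d (l *: A).
Proof. by move=> mA nzl P /mA; rewrite map_eval_scale scaler_eq0 negb_or nzl. Qed.

Lemma morphisms_neq0 A : @morphisms K n d A -> A != 0.
Proof.
move=> mA; apply/negP => /eqP A0; have := mA (@origin K) (@origin_neq0 K).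
by rewrite A0 -(scale0r 0) map_eval_scale scale0r eqxx.
Qed.
End MorphismsCone.

Section Main.
Variables (K : numClosedFieldType) (a b c d : nat).
Hypotheses (a4 : (4 <= a)%N) (ltab : (a < b)%N) (ltbc : (b < c)%N).
Hypotheses (cab : coprime a b) (cac : coprime a c) (cbc : coprime b c).
Local Notation C := (conductor a b c).
Hypothesis leCd : (C <= d)%N.
Let a2 : (2 <= a)%N := ltnW (ltnW a4).
Local Notation Sev := (@severi K 3 d (genus (semigroup_gen [:: a * b; a * c; b * c]%N))
  (semigroup_gen [:: a * b; a * c; b * c]%N) [tuple (a * b)%N; (a * c)%N; (b * c)%N]).

Lemma equisingular_order (A : 'M[K]_(4, d.+1)) : equisingular a b c A -> forall m q n (x : K),
  attained A m q -> starts n x q -> x != 0 -> inS a b c n.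
Proof.
move=> [phi [ey [ez [[h0 h1 h2 h3] hphi phi_inv rely relz]]]] m q n x.
exact: (attained_order a4 ltab ltbc cab cac cbc h1 h2 h3 hphi phi_inv rely relz).
Qed.

Lemma equisingular_severi (A : 'M[K]_(4, d.+1)) m : equisingular a b c A -> (1 < m)%N ->
  full A C m -> full A C m.+1 -> Sev A.
Proof.
move=> [phi [ey [ez [[h0 h1 h2 h3] hphi phi_inv rely relz]]]] m1 fm fm1.
apply: (member_severi a4 ltab ltbc cab cac cbc h0 h1 h2 h3 hphi phi_inv rely relz leCd
  (m0 := (m * m)%N)).
move=> k n lek; have k0 : (0 < k)%N by apply: leq_trans lek; rewrite muln_gt0; lia.
have [_ full_k] : (1 < k)%N /\ full A C k.
  apply: (@two_generators (fun k => (1 < k)%N /\ full A C k) m) => // [i j [i1 fi] [j1 fj]|].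
    by split; [lia|apply: fullD].
  by split=> //; lia.
exact: full_k.
Qed.

(** The open condition is the nonvanishing of the minors in two consecutive
degrees, from which all large degrees follow. *)
Lemma severi_chain : exists M, exists2 W, irreducible_chain Sev M W &
  (4 * d.+1 <= M + (a * b + a * c + b * c + 2 * size (high_gaps a b c) + 4))%N.
Proof.
have ltd := degree_bound a4 ltab ltbc cab cac cbc leCd.
have [s nzs sep] := exists_separating K a2 ltab ltbc cab cac cbc ltd.
have [Phi [Phi00 PhiX Phi_base equi]] := equisingular_family a4 ltab ltbc cab cac cbc leCd nzs.
have [m0 base] := base_full a2 ltab ltbc cab cac cbc ltd nzs sep.
set A0 := base_mx _ _ _ _ _ in base Phi_base.
have [_ [_ [_ [[h0 h1 h2 h3] _ _ _ _]]]] := equi (base_point a b c s).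
rewrite Phi_base in h0 h1 h2 h3.
have forms m := member_forms a4 ltab ltbc cab cac cbc h0 h1 h2 h3 leCd
  (fun m n lem => base m lem n) (m := m).
pose m := maxn 2 (big_degree a b c m0).
have [B BP] := forms m (leq_maxr _ _).
have [B' BP'] := forms m.+1 (leqW (leq_maxr _ _)).
pose D := \det (minor Phi B) * \det (minor Phi B').
have SC n : (C <= n)%N -> inS a b c n by apply: (inS_large a2 ltab ltbc cab cac cbc).
pose l := [seq mxvec_index t.1 t.2 | t <- enum (free_positions a b c d)].
have us : uniq l by rewrite map_inj_uniq ?enum_uniq //; apply: mxvec_index_inj.
have Phis v : v \in l -> exists i j, Phi i j = 'X_v.
  by move=> /mapP[[i j]]; rewrite mem_enum inE /= => fij ->; exists i, j; apply: PhiX.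
have Du0 : D.@[base_point a b c s] != 0.
  rewrite mevalM mulf_neq0 //; apply: minor_neq0 => i; rewrite Phi_base.
    by case: (BP i).
  by case: (BP' i).
have DX u : D.@[u] != 0 -> Sev (map_mx (meval u) Phi).
  rewrite mevalM mulf_eq0 negb_or => /andP[D1 D2].
  have ord := equisingular_order (equi u).
  apply: (equisingular_severi (m := m)) => //; first by rewrite leq_maxl.
    apply: (full_open SC _ D1) => [i|q n x]; [by case: (BP i)|exact: ord].
  apply: (full_open SC _ D2) => [i|q n x]; [by case: (BP' i)|exact: ord].
have [W chW] := irreducible_chain_of_family us Phi00 Phis Du0 DX.
exists (size l), W => //; rewrite size_map -cardE.
by apply: card_free_positions => i; exact: (lead_leq a4 ltab ltbc cab cac cbc leCd).
Qed.

Lemma severi_excess : (a, b, c) <> (4, 5, 7)%N ->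
  @excess_dimensional K 3 d (genus (semigroup_gen [:: a * b; a * c; b * c]%N))
  (semigroup_gen [:: a * b; a * c; b * c]%N) [tuple (a * b)%N; (a * c)%N; (b * c)%N].
Proof.
move=> n457; have [M [W chW leM]] := severi_chain.
have coneX A l : @morphisms K 3 d A -> l != 0 -> @morphisms K 3 d (l *: A).
  exact: morphisms_scale.
have nzX A : @morphisms K 3 d A -> A != 0 by apply: morphisms_neq0.
have sub : Sev `<=` @morphisms K 3 d by move=> A [].
have [k kP ltk] := codim_bound coneX nzX sub chW.
exists k => //; rewrite mul1n (genus_gaps a2 ltab ltbc cab cac cbc).
have := high_gaps_small a4 ltab ltbc cab cac cbc n457; lia.
Qed.

End Main.

Theorem theorem3p4 (R : realType) (a b c d : nat) :
  let S := semigroup_gen [:: a * b; a * c; b * c]%N in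
  let r := [tuple (a * b)%N; (a * c)%N; (b * c)%N] in
  let g := genus S in
  (2 <= a)%N -> (a < b)%N -> (b < c)%N ->
  coprime a b -> coprime a c -> coprime b c ->
  (2 * g <= d)%N ->
  (4 <= a)%N -> (a, b, c) <> (4, 5, 7)%N ->
  @excess_dimensional R[i] 3 d g S r.
Proof.
move=> S r g a2 ltab ltbc cab cac cbc led a4 n457.
apply: severi_excess => //.
by rewrite -(genus_conductor a2 ltab ltbc cab cac cbc).
Qed.
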